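(* Let $j=(uv)^2$. The elements $$a_1=vuv^{-1}j^4buvj^2,\qquad a_2=v^2ubuv^{-1}uv^2j,\qquad a_3=u^{-1}v^2uj^9bv^{-1}uv^{-1}j^8$$ of $\Gamma$ generate a torsion-free subgroup $\Pi$ of $\Gamma$ of index $864$, for which $\Pi/[\Pi,\Pi]\cong\mathbb Z^2$.
   Context: Let $\zeta=e^{2\pi i/12}$, $r=\zeta+\zeta^{-1}=\sqrt3$, and $$F=\begin{pmatrix}-r-1&1&0\\1&1-r&0\\0&0&1\end{pmatrix}.$$ Let $\Gamma=\{g\in M_{3\times3}(\mathbb Z[\zeta]):g^*Fg=F\}/Z$, where $g^*$ is the conjugate transpose of $g$ and $Z=\{\zeta^\nu I:\nu=0,1,\ldots,11\}$. Elements $gZ$ of $\Gamma$ are denoted by matrix representatives $g$. The following matrices are unitary with respect to $F$ and so define elements of $\Gamma$: $$u=\begin{pmatrix}\zeta^3+\zeta^2-\zeta&1-\zeta&0\\ \zeta^3+\zeta^2-1&\zeta-\zeta^3&0\\0&0&1\end{pmatrix},\quad v=\begin{pmatrix}\zeta^3&0&0\\ \zeta^3+\zeta^2-\zeta-1&1&0\\0&0&1\end{pmatrix},$$ $$b=\begin{pmatrix}1&0&0\\-2\zeta^3-\zeta^2+2\zeta+2&\zeta^3+\zeta^2-\zeta-1&-\zeta^3-\zeta^2\\ \zeta^2+\zeta&-\zeta^3-1&-\zeta^3+\zeta+1\end{pmatrix}.$$ The element $j=(uv)^2$ is the diagonal matrix with diagonal entries $\zeta,\zeta,1$. *)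

(* Defs.v *)
From HB Require Import structures.
From mathcomp Require Import all_boot all_order all_algebra.
From mathcomp Require Import all_classical all_reals.
From mathcomp Require Import trigo.
From mathcomp Require Import complex.
From mathcomp Require Import ring lra.

Set Implicit Arguments.
Unset Strict Implicit.
Unset Printing Implicit Defensive.

Import Order.TTheory GRing.Theory Num.Theory.

Local Open Scope classical_set_scope.
Local Open Scope quotient_scope.
Local Open Scope group_scope.

Section SubgroupType.
Variables (G : groupType) (H : groupClosed G).

Record subgroup_type : predArgType :=
  Subgroup { subgroup_val :> G; _ : subgroup_val \in H }.

HB.instance Definition _ := [isSub for subgroup_val].
HB.instance Definition _ := [Choice of subgroup_type by <:].

Lemma subgroup_closed : group_closed [pred x in H].
Proof. by split=> [|x y]; rewrite ?inE; [exact: gpred1 | exact: gpredF]. Qed.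

HB.instance Definition _ :=
  SubChoice_isSubGroup.Build G [pred x in H] subgroup_type subgroup_closed.

End SubgroupType.

Section Generated.
Variables (G : groupType) (A : set G).

(* The intersection of all subgroups containing [A]. *)
Definition generated : {pred G} :=
  fun x =>
    `[< forall H : groupClosed G, (forall a, A a -> a \in H) -> x \in H >].

Lemma generatedP x :
  reflect (forall H : groupClosed G, (forall a, A a -> a \in H) -> x \in H)
          (x \in generated).
Proof. exact: asboolP. Qed.

Lemma generated_mul : mulg_closed generated.
Proof.
move=> x y /generatedP Hx /generatedP Hy; apply/generatedP => H AH.
exact: gpredM (Hx H AH) (Hy H AH).
Qed.

Lemma generated_one : 1 \in generated.
Proof. by apply/generatedP => H _; exact: gpred1. Qed.

Lemma generated_inv : invg_closed generated.
Proof.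
move=> x /generatedP Hx; apply/generatedP => H AH.
by rewrite gpredV Hx.
Qed.

HB.instance Definition _ := isMulClosed.Build G generated generated_mul.
HB.instance Definition _ := isMul1Closed.Build G generated generated_one.
HB.instance Definition _ := isInvClosed.Build G generated generated_inv.

End Generated.

(* Normal subgroups: [x ^ y] is the conjugate [y^-1 * x * y]. *)
HB.mixin Record isConjClosed (G : groupType) (S : {pred G}) := {
  gpred_conj : forall x y, x \in S -> x ^ y \in S
}.

#[short(type="normalClosed")]
HB.structure Definition NormalClosed (G : groupType) :=
  {S of GroupClosed G S & isConjClosed G S}.

Section Quotient.
Variables (G : groupType) (N : normalClosed G).

Definition coset_eq : rel G := fun x y => x^-1 * y \in N.

Lemma coset_eq_equiv : equiv_class_of coset_eq.
Proof.
split=> [x|x y|y x z]; rewrite /coset_eq.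
- by rewrite mulVg gpred1.
- by rewrite -gpredV invgM invgK.
- by move=> xy yz; have := gpredM _ _ xy yz; rewrite mulgA mulgK.
Qed.

Canonical coset_eq_rel := EquivRelPack coset_eq_equiv.
Canonical coset_eq_encModRel := defaultEncModRel coset_eq.

Definition quotient_group := {eq_quot coset_eq}.

HB.instance Definition _ : EqQuotient G coset_eq quotient_group :=
  EqQuotient.on quotient_group.
HB.instance Definition _ := Choice.on quotient_group.

Definition quotient_one : quotient_group := lift_cst quotient_group 1.
Definition quotient_mul := lift_op2 quotient_group *%g.
Definition quotient_inv := lift_op1 quotient_group (fun x => x^-1).

Canonical pi_quotient_one := PiConst quotient_one.

Lemma coset_eqE x y : (x == y %[mod quotient_group]) = (x^-1 * y \in N).
Proof. by rewrite piE. Qed.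

Lemma pi_quotient_inv :
  {morph \pi_quotient_group : x / x^-1 >-> quotient_inv x}.
Proof.
move=> x; unlock quotient_inv; apply/eqP; rewrite coset_eqE invgK.
set y := repr _; have: y^-1 * x \in N by rewrite -coset_eqE reprK.
by move=> /(gpred_conj _ x^-1); rewrite conjgE invgK !mulgA mulgK.
Qed.
Canonical pi_quotient_inv_morph := PiMorph1 pi_quotient_inv.

Lemma pi_quotient_mul :
  {morph \pi_quotient_group : x y / x * y >-> quotient_mul x y}.
Proof.
move=> x y; unlock quotient_mul; apply/eqP; rewrite coset_eqE.
set x' := repr _; set y' := repr _.
have Nx : x^-1 * x' \in N by rewrite -coset_eqE reprK.
have Ny : y^-1 * y' \in N by rewrite -coset_eqE reprK.
have -> : (x * y)^-1 * (x' * y') = (x^-1 * x') ^ y * (y^-1 * y').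
  by rewrite conjgE invgM !mulgA mulgK.
by apply: gpredM => //; exact: gpred_conj.
Qed.
Canonical pi_quotient_mul_morph := PiMorph2 pi_quotient_mul.

Lemma quotient_mulA : associative quotient_mul.
Proof. by move=> x y z; rewrite -[x]reprK -[y]reprK -[z]reprK !piE mulgA. Qed.

Lemma quotient_mul1g : left_id quotient_one quotient_mul.
Proof. by move=> x; rewrite -[x]reprK !piE mul1g. Qed.

Lemma quotient_mulg1 : right_id quotient_one quotient_mul.
Proof. by move=> x; rewrite -[x]reprK !piE mulg1. Qed.

Lemma quotient_mulVg : left_inverse quotient_one quotient_inv quotient_mul.
Proof. by move=> x; rewrite -[x]reprK !piE mulVg. Qed.

Lemma quotient_mulgV : right_inverse quotient_one quotient_inv quotient_mul.
Proof. by move=> x; rewrite -[x]reprK !piE mulgV. Qed.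

HB.instance Definition _ := isGroup.Build quotient_group quotient_mulA
  quotient_mul1g quotient_mulg1 quotient_mulVg quotient_mulgV.

End Quotient.

Section Derived.
Variable G : groupType.

Definition derived : {pred G} :=
  generated [set z | exists x y : G, z = [~ x, y]].

HB.instance Definition _ := GroupClosed.on derived.

Lemma derived_conj (x y : G) : x \in derived -> x ^ y \in derived.
Proof.
move=> Dx; rewrite -[x ^ y](mulVKg x); apply: gpredM => //.
by apply/generatedP => H; apply; exists x, y; rewrite commgEl.
Qed.

HB.instance Definition _ := isConjClosed.Build G derived derived_conj.

Definition abelianization : Type := quotient_group derived.

HB.instance Definition _ := Group.on abelianization.

End Derived.

Definition torsion_free (G : groupType) : Prop :=
  forall (x : G) n, (0 < n)%N -> x ^+ n = 1 -> x = 1.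

Definition left_cosets (G : groupType) (H : {pred G}) : set (set G) :=
  [set [set x * h | h in [set` H]] | x in [set: G]].

Definition has_index (G : groupType) (H : groupClosed G) (n : nat) : Prop :=
  (left_cosets H #= `I_n)%card.

Definition isomorphic (G H : groupType) : Prop :=
  exists f : {multiplicative G -> H}, bijective f.

Local Open Scope ring_scope.
Local Open Scope complex_scope.
Local Open Scope sesquilinear_scope.

(* The matrix with the given rows; [s] must be 3 x 3. *)
Definition mx3 (K : pzRingType) (s : seq (seq K)) : 'M[K]_3 :=
  \matrix_(i, j) nth 0 (nth [::] s i) j.

Section Mx3.
Variable K : pzRingType.

Lemma mx3M (a b c d e f g h k a' b' c' d' e' f' g' h' k' : K) :
  mx3 [:: [:: a; b; c]; [:: d; e; f]; [:: g; h; k]] *m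
  mx3 [:: [:: a'; b'; c']; [:: d'; e'; f']; [:: g'; h'; k']] =
  mx3 [:: [:: a * a' + b * d' + c * g'; a * b' + b * e' + c * h';
              a * c' + b * f' + c * k'];
          [:: d * a' + e * d' + f * g'; d * b' + e * e' + f * h';
              d * c' + e * f' + f * k'];
          [:: g * a' + h * d' + k * g'; g * b' + h * e' + k * h';
              g * c' + h * f' + k * k']].
Proof.
apply/matrixP=> i j; rewrite !mxE !big_ord_recl big_ord0 !mxE addr0 !addrA.
by case: i => [[|[|[|i]]] //= _]; case: j => [[|[|[|j]]] //= _].
Qed.

Lemma mx3_scalar (a : K) :
  a%:M = mx3 [:: [:: a; 0; 0]; [:: 0; a; 0]; [:: 0; 0; a]].
Proof.
apply/matrixP=> i j; rewrite !mxE -val_eqE.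
by case: i => [[|[|[|i]]] //= _]; case: j => [[|[|[|j]]] //= _].
Qed.

Lemma mx3_over (S : {pred K}) (a b c d e f g h k : K) :
  all [in S] [:: a; b; c; d; e; f; g; h; k] ->
  mx3 [:: [:: a; b; c]; [:: d; e; f]; [:: g; h; k]] \is a mxOver S.
Proof.
rewrite /= andbT => /andP[? /and5P[? ? ? ? /and4P[*]]].
apply/mxOverP=> i j; rewrite !mxE.
by case: i => [[|[|[|i]]] //= _]; case: j => [[|[|[|j]]] //= _].
Qed.

End Mx3.

Lemma mx3_adjoint (K : numClosedFieldType) (a b c d e f g h k : K) :
  (mx3 [:: [:: a; b; c]; [:: d; e; f]; [:: g; h; k]]) ^t* =
  mx3 [:: [:: a^*; d^*; g^*]; [:: b^*; e^*; h^*]; [:: c^*; f^*; k^*]]%R.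
Proof.
apply/matrixP=> i j; rewrite !mxE.
by case: i => [[|[|[|i]]] //= _]; case: j => [[|[|[|j]]] //= _].
Qed.

Section Gamma.
Variable R : realType.
Local Notation C := R[i].

(* e^(i t); the complex exponential is not in the library *)
Definition expi (t : R) : C := cos t +i* sin t.

Lemma expiD s t : expi (s + t) = expi s * expi t.
Proof.
rewrite /expi cosD sinD [sin s * cos t + _]addrC.
by apply/eqP; rewrite eq_complex /= !eqxx.
Qed.

Lemma expiN t : expi (- t) = (expi t)^*.
Proof. by rewrite /expi cosN sinN. Qed.

Definition zeta : C := expi (2 * pi / 12).

Lemma zeta3 : zeta ^+ 3 = 0 +i* 1.
Proof.
rewrite !exprS expr0 mulr1 -!expiD.
have -> : 2 * pi / 12 + (2 * pi / 12 + 2 * pi / 12) = pi / 2 :> R by lra.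
by rewrite /expi cos_pihalf sin_pihalf.
Qed.

Lemma zeta4 : zeta ^+ 4 = zeta ^+ 2 - 1.
Proof.
have z6 : zeta ^+ 6 = -1 by rewrite (exprM _ 3 2) zeta3 sqr_i.
have /eqP : (zeta ^+ 2 + 1) * (zeta ^+ 4 - zeta ^+ 2 + 1) = 0 by ring: z6.
rewrite mulf_eq0 => /orP[/eqP z2|/eqP z4]; last first.
  by rewrite -[LHS]subr0 -z4; ring.
have zE : zeta = - zeta ^+ 3.
  by rewrite -[LHS]subr0 -(mulr0 zeta) -z2; ring.
move: zE; rewrite zeta3 => /(congr1 (@complex.Re R)); rewrite /= oppr0 => c0.
suff : 0 < cos (2 * pi / 12 : R) by rewrite c0 ltxx.
by have := pi_gt0 R => pi0; apply: cos_gt0_pihalf; apply/andP; split; lra.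
Qed.

Lemma zetaV : zeta^-1 = zeta - zeta ^+ 3.
Proof.
have z1 : zeta * (zeta - zeta ^+ 3) = 1 by ring: zeta4.
have z0 : zeta != 0.
  by apply: contra_eq_neq z1 => ->; rewrite mul0r eq_sym oner_eq0.
by apply: (mulfI z0); rewrite z1 divff.
Qed.

Lemma zetaJ : (zeta^*)%R = zeta - zeta ^+ 3.
Proof.
rewrite -zetaV; have z1 : (zeta^*)%R * zeta = 1.
  rewrite -[(zeta^*)%R]/(zeta^*)%C -expiN -expiD addNr.
  by rewrite /expi cos0 sin0.
have z0 : zeta != 0.
  by apply: contra_eq_neq z1 => ->; rewrite mulr0 eq_sym oner_eq0.
by apply: (mulIf z0); rewrite z1 mulVf.
Qed.

Definition Zzeta : {pred C} :=
  fun z => `[< exists p : {poly int}, z = (map_poly intr p).[zeta] >].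

Lemma ZzetaP z :
  reflect (exists p : {poly int}, z = (map_poly intr p).[zeta]) (z \in Zzeta).
Proof. exact: asboolP. Qed.

Lemma Zzeta_subring : subring_closed Zzeta.
Proof.
split=> [|x y|x y].
- by apply/ZzetaP; exists 1; rewrite rmorph1 hornerC.
- move=> /ZzetaP[p ->] /ZzetaP[q ->]; apply/ZzetaP; exists (p - q).
  by rewrite rmorphB hornerD hornerN.
- move=> /ZzetaP[p ->] /ZzetaP[q ->]; apply/ZzetaP; exists (p * q).
  by rewrite rmorphM hornerM.
Qed.

HB.instance Definition _ := GRing.isSubringClosed.Build C Zzeta Zzeta_subring.

Lemma zeta_in : zeta \in Zzeta.
Proof. by apply/ZzetaP; exists 'X; rewrite map_polyX hornerX. Qed.

Lemma Zzeta_conj z : z \in Zzeta -> (z^*)%R \in Zzeta.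
Proof.
move=> /ZzetaP[p ->]; apply/ZzetaP; exists (p \Po ('X - 'X^3)).
rewrite map_comp_poly horner_comp rmorphB /= map_polyX map_polyXn.
rewrite !hornerE -zetaJ.
rewrite -[LHS](horner_map Num.conj) /= -map_poly_comp /=.
by congr _.[_]; apply: eq_map_poly => x /=; rewrite rmorph_int.
Qed.

Definition F : 'M[C]_3 :=
  let r := zeta + zeta^-1 in
  mx3 [:: [:: - r - 1; 1;     0];
          [:: 1;       1 - r; 0];
          [:: 0;       0;     1]].

(* [g ^t*] is the conjugate transpose. *)
Definition F_unitary : {pred 'M[C]_3} :=
  [pred g | (g \is a mxOver Zzeta) && (g ^t* *m F *m g == F)].

Record unitary_group : predArgType :=
  Unitary { unitary_val :> 'M[C]_3; _ : unitary_val \in F_unitary }.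

HB.instance Definition _ := [isSub for unitary_val].
HB.instance Definition _ := [Choice of unitary_group by <:].

Definition F_inv : 'M[C]_3 :=
  let r := 2 * zeta - zeta ^+ 3 in
  mx3 [:: [:: 1 - r; -1; 0]; [:: -1; - r - 1; 0]; [:: 0; 0; 1]].

Lemma F_inv_mul : F_inv *m F = 1%:M.
Proof.
rewrite /F zetaV /F_inv mx3M mx3_scalar.
by congr (mx3 [:: [:: _; _; _]; [:: _; _; _]; [:: _; _; _]]); ring: zeta4.
Qed.

Lemma mxOver_Zzeta_F : (F \is a mxOver Zzeta) && (F_inv \is a mxOver Zzeta).
Proof.
have Zz := zeta_in.
have Z1 : (zeta - zeta ^+ 3) \in Zzeta by rewrite rpredB ?rpredX.
rewrite /F zetaV; apply/andP; split; apply: mx3_over => /=.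
  by rewrite !(rpredB, rpredD, rpredN, rpred1, rpred0, rpredX).
by rewrite !(rpredB, rpredD, rpredN, rpred1, rpred0, rpredX, rpredM, rpred_nat).
Qed.

Lemma F_unitary_invE (g : 'M[C]_3) :
  g \in F_unitary -> g \in unitmx /\ invmx g = F_inv *m g ^t* *m F.
Proof.
case/andP=> _ /eqP gF.
have Vg : F_inv *m g ^t* *m F *m g = 1%:M.
  by rewrite -!mulmxA mulmxA -F_inv_mul -[in RHS]gF !mulmxA.
have [_ ug] := mulmx1_unit Vg; split=> //.
by rewrite -[RHS]mulmx1 -(mulmxV ug) mulmxA Vg mul1mx.
Qed.

Lemma F_unitary_mul : {in F_unitary &, forall g h, g *m h \in F_unitary}.
Proof.
move=> g h /andP[Zg /eqP gF] /andP[Zh /eqP hF]; apply/andP; split.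
  exact: mxOverM.
rewrite trmx_mul map_mxM /= -!mulmxA (mulmxA F) (mulmxA (g ^t*)).
by rewrite (mulmxA (g ^t*) F) gF mulmxA hF.
Qed.

Lemma F_unitary_one : 1%:M \in F_unitary.
Proof.
rewrite inE mxOver_scalar ?rpred0 ?rpred1 //=.
by rewrite trmx1 map_mx1 mul1mx mulmx1.
Qed.

Lemma F_unitary_inv (g : 'M[C]_3) : g \in F_unitary -> invmx g \in F_unitary.
Proof.
move=> Ug; have [ug gV] := F_unitary_invE Ug; case/andP: Ug => Zg /eqP gF.
have /andP[ZF ZFi] := mxOver_Zzeta_F.
apply/andP; split.
  rewrite gV; do 2?apply: mxOverM => //; apply/mxOverP=> i j; rewrite !mxE.
  exact/Zzeta_conj/(mxOverP Zg).
rewrite -[in X in X == _]gF -!mulmxA mulmxV // mulmx1 mulmxA.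
by rewrite -map_mxM -trmx_mul mulmxV // trmx1 map_mx1 mul1mx.
Qed.

Definition unitary_one : unitary_group := Unitary F_unitary_one.
Definition unitary_mul (g h : unitary_group) : unitary_group :=
  Unitary (F_unitary_mul (valP g) (valP h)).
Definition unitary_inv (g : unitary_group) : unitary_group :=
  Unitary (F_unitary_inv (valP g)).

Lemma unitary_mulA : associative unitary_mul.
Proof. by move=> g h k; apply: val_inj; rewrite /= mulmxA. Qed.
Lemma unitary_mul1g : left_id unitary_one unitary_mul.
Proof. by move=> g; apply: val_inj; rewrite /= mul1mx. Qed.
Lemma unitary_mulg1 : right_id unitary_one unitary_mul.
Proof. by move=> g; apply: val_inj; rewrite /= mulmx1. Qed.
Lemma unitary_mulVg : left_inverse unitary_one unitary_inv unitary_mul.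
Proof.
move=> g; apply: val_inj; rewrite /= mulVmx //.
by case: (F_unitary_invE (valP g)).
Qed.
Lemma unitary_mulgV : right_inverse unitary_one unitary_inv unitary_mul.
Proof.
move=> g; apply: val_inj; rewrite /= mulmxV //.
by case: (F_unitary_invE (valP g)).
Qed.

HB.instance Definition _ := isGroup.Build unitary_group
  unitary_mulA unitary_mul1g unitary_mulg1 unitary_mulVg unitary_mulgV.

Definition scalars : {pred unitary_group} :=
  [pred g | [exists nu : 'I_12, val g == (zeta ^+ nu)%:M]].

Lemma zeta12 : zeta ^+ 12 = 1.
Proof. by ring: zeta4. Qed.

Lemma scalarsP (g : unitary_group) :
  reflect (exists n, val g = (zeta ^+ n)%:M) (g \in scalars).
Proof.
apply: (iffP existsP) => [[nu /eqP]|[n gn]]; first by exists nu.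
exists (Ordinal (ltn_pmod n (isT : 0 < 12)%N)).
by rewrite gn /= {1}(divn_eq n 12) exprD mulnC exprM zeta12 expr1n mul1r.
Qed.

Lemma scalars_mul : mulg_closed scalars.
Proof.
move=> g h /scalarsP[m gm] /scalarsP[n hn]; apply/scalarsP; exists (m + n)%N.
by rewrite /= gm hn -scalar_mxM exprD.
Qed.

Lemma scalars_one : 1%g \in scalars.
Proof. by apply/scalarsP; exists 0%N; rewrite expr0. Qed.

Lemma scalars_inv : invg_closed scalars.
Proof.
move=> g /scalarsP[n gn]; apply/scalarsP; exists (n * 11)%N.
have [ug _] := F_unitary_invE (valP g).
rewrite /= -[LHS]mulmx1.
have <- : val g *m (zeta ^+ (n * 11))%:M = 1%:M.
  by rewrite gn -scalar_mxM -exprD -mulnS mulnC exprM zeta12 expr1n.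
by rewrite mulKmx.
Qed.

Lemma scalars_conj (g h : unitary_group) :
  g \in scalars -> (g ^ h)%g \in scalars.
Proof.
move=> /scalarsP[n gn]; apply/scalarsP; exists n.
have [uh _] := F_unitary_invE (valP h).
by rewrite /= gn -scalar_mxC mulmxA mulVmx // mul1mx.
Qed.

HB.instance Definition _ := isMulClosed.Build unitary_group scalars scalars_mul.
HB.instance Definition _ := isMul1Closed.Build unitary_group scalars
  scalars_one.
HB.instance Definition _ := isInvClosed.Build unitary_group scalars scalars_inv.
HB.instance Definition _ :=
  isConjClosed.Build unitary_group scalars scalars_conj.

Definition Gamma : Type := quotient_group scalars.

HB.instance Definition _ := Group.on Gamma.
HB.instance Definition _ := EqQuotient.on Gamma.

Local Notation z := zeta.

Definition u_mx : 'M[C]_3 :=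
  mx3 [:: [:: z ^+ 3 + z ^+ 2 - z; 1 - z;      0];
          [:: z ^+ 3 + z ^+ 2 - 1; z - z ^+ 3; 0];
          [:: 0;                   0;          1]].

Definition v_mx : 'M[C]_3 :=
  mx3 [:: [:: z ^+ 3;                  0; 0];
          [:: z ^+ 3 + z ^+ 2 - z - 1; 1; 0];
          [:: 0;                       0; 1]].

Definition b_mx : 'M[C]_3 :=
  mx3 [:: [:: 1; 0; 0];
          [:: - 2 * z ^+ 3 - z ^+ 2 + 2 * z + 2; z ^+ 3 + z ^+ 2 - z - 1;
              - z ^+ 3 - z ^+ 2];
          [:: z ^+ 2 + z; - z ^+ 3 - 1; - z ^+ 3 + z + 1]].

Ltac F_unitary_tac :=
  apply/andP; split;
  [ apply: mx3_over => /=;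
    rewrite !(rpredB, rpredD, rpredN, rpred1, rpred0, rpredX, rpredM,
      rpred_nat, zeta_in) //
  | rewrite mx3_adjoint !(rmorphB, rmorphD, rmorphN, rmorphM, rmorphXn,
      rmorph1, rmorph0, rmorph_nat) /= zetaJ /F zetaV !mx3M; apply/eqP;
    congr (mx3 [:: [:: _; _; _]; [:: _; _; _]; [:: _; _; _]]); ring: zeta4 ].

Lemma u_unitary : u_mx \in F_unitary.
Proof. F_unitary_tac. Qed.

Lemma v_unitary : v_mx \in F_unitary.
Proof. F_unitary_tac. Qed.

Lemma b_unitary : b_mx \in F_unitary.
Proof. F_unitary_tac. Qed.

Definition gamma_u : Gamma := \pi_Gamma (Unitary u_unitary).
Definition gamma_v : Gamma := \pi_Gamma (Unitary v_unitary).
Definition gamma_b : Gamma := \pi_Gamma (Unitary b_unitary).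

Lemma uv_sqr : (u_mx *m v_mx) *m (u_mx *m v_mx) =
   mx3 [:: [:: z; 0; 0]; [:: 0; z; 0]; [:: 0; 0; 1]].
Proof.
by rewrite !mx3M;
congr (mx3 [:: [:: _; _; _]; [:: _; _; _]; [:: _; _; _]]); ring: zeta4.
Qed.

End Gamma.

(* Main.v *)
(* An element [g] of [Gamma] has height [y] when [|g_33|^2 = x + y sqrt 3].  The
   elements of height 0 form the group [K] generated by [u] and [v], of order 288,
   and those of height at most 1 form [K U K b K].  An explicit action of the latter
   on [3 x K x Z^2], where [(i, k, t)] stands for the coset [k b^i Pi] with a label
   [t], respects all products that stay in this set.  It extends to [Gamma] by a
   discrete Morse argument on the orbit of the line of [e_3]: every point other than
   the base point has a lower neighbour, and its neighbours that are not higher are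
   linked through lower ones; both facts follow from nonnegative combinations of
   Hermitian forms that are definite.  The group [Pi] fixes the coset of the base
   state and shifts its label, whence the index [3 * 288 = 864] and a homomorphism
   of [Pi] onto [Z^2].  It is injective on the abelianization because the generators
   satisfy a relation with exponents [(3, -2, 7)].  An element of finite order in
   [Pi] has label 0, hence fixes states, and has a positive eigenvector; moving the
   eigenvector close to [e_3] conjugates it to an element of height at most 2, and
   nontrivial elements of such heights fix no state. *)

(* The proof works without a presentation of Gamma: neither the lower bound on the index nor the
   homomorphism to Z^2 can then be had by checking relators. The extended action replaces the
   relators; all that it requires is a check of those products of two elements of height at most 1
   that again have height at most 1. Geometrically, F has signature (1, 2) with e_3 positive, so
   Gamma acts on the complex hyperbolic plane, and |g_33|^2 is cosh^2 of the distance between e_3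
   and its image. Under sqrt 3 -> - sqrt 3 the form becomes definite, which confines the conjugate
   of |g_33|^2 to [0, 1]. This is why a single integer y orders the distances and why the elements
   of height 0 can be found by a finite search. The upper bound on the index comes from a coset
   table whose entries are words in the generators of Pi. Carrying the exponent sums of these words
   through the table is what produces the labels, so one and the same table gives the index, the
   homomorphism and the obstruction to torsion. *)
From Stdlib Require Import ZArith Lia.
From HB Require Import structures.
Require Import Defs.
From mathcomp Require Import all_boot all_order all_algebra.
From mathcomp Require Import all_classical all_reals.
From mathcomp Require Import trigo complex cyclic separable cyclotomic.
From mathcomp Require Import zify ssrZ ring lra.

Set Implicit Arguments.
Unset Strict Implicit.
Unset Printing Implicit Defensive.

Import Order.TTheory GRing.Theory Num.Theory.

Local Open Scope classical_set_scope.
Local Open Scope quotient_scope.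
Local Open Scope group_scope.
Local Open Scope ring_scope.

(** * The ring [Z[zeta]] *)

(* [Z4 a0 a1 a2 a3] stands for [a0 + a1 zeta + a2 zeta^2 + a3 zeta^3]. *)
Inductive z4 : Set := Z4 of Z & Z & Z & Z.

Definition zadd x y :=
  let: Z4 a b c d := x in let: Z4 a' b' c' d' := y in
  Z4 (Z.add a a') (Z.add b b') (Z.add c c') (Z.add d d').
Definition zopp x := let: Z4 a b c d := x in Z4 (Z.opp a) (Z.opp b) (Z.opp c) (Z.opp d).
Definition zmul x y :=
  let: Z4 a b c d := x in let: Z4 a' b' c' d' := y in
  let d4 := Z.add (Z.mul b d') (Z.add (Z.mul c c') (Z.mul d b')) in
  let d5 := Z.add (Z.mul c d') (Z.mul d c') in
  Z4 (Z.sub (Z.sub (Z.mul a a') d4) (Z.mul d d'))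
     (Z.sub (Z.add (Z.mul a b') (Z.mul b a')) d5)
     (Z.add (Z.add (Z.mul a c') (Z.add (Z.mul b b') (Z.mul c a'))) d4)
     (Z.add (Z.add (Z.add (Z.mul a d') (Z.mul b c'))
                   (Z.add (Z.mul c b') (Z.mul d a'))) d5).
Definition zconj x :=
  let: Z4 a b c d := x in Z4 (Z.add a c) b (Z.opp c) (Z.opp (Z.add b d)).
(* the Galois automorphism [zeta |-> zeta^5], which maps [sqrt 3] to its opposite *)
Definition zsig x :=
  let: Z4 a b c d := x in Z4 (Z.add a c) (Z.opp b) (Z.opp c) (Z.add b d).
(** Nested conditionals let evaluation by value stop at the first difference, whereas [&&] would
    evaluate both arguments. *)
Definition zeqb x y :=
  let: Z4 a b c d := x in let: Z4 a' b' c' d' := y in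
  if Z.eqb a a' then if Z.eqb b b' then if Z.eqb c c' then Z.eqb d d'
  else false else false else false.
Definition z0 := Z4 0 0 0 0.
Definition z1 := Z4 1 0 0 0.
Definition zz := Z4 0 1 0 0.
Fixpoint zpow n := if n is n'.+1 then zmul zz (zpow n') else z1.
(* [x + y sqrt 3] *)
Definition zsq x y := Z4 x (2 * y) 0 (- y).

Lemma zeqbP : Equality.axiom zeqb.
Proof.
move=> [a b c d] [a' b' c' d']; apply: (iffP idP) => [|[-> -> -> ->]].
  rewrite /zeqb; case: Z.eqb_spec => // ->; case: Z.eqb_spec => // ->.
  by case: Z.eqb_spec => // -> /Z.eqb_eq->.
by rewrite /zeqb !Z.eqb_refl.
Qed.
HB.instance Definition _ := hasDecEq.Build z4 zeqbP.

Section Eval.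
Variable R : realType.
Local Notation C := R[i].
Local Notation z := (zeta R).

Definition zr (a : Z) : C := (int_of_Z a)%:~R.

Lemma zrD a b : zr (Z.add a b) = zr a + zr b.
Proof. by rewrite /zr (rmorphD int_of_Z) rmorphD. Qed.
Lemma zrM a b : zr (Z.mul a b) = zr a * zr b.
Proof. by rewrite /zr (rmorphM int_of_Z) rmorphM. Qed.
Lemma zrN a : zr (Z.opp a) = - zr a.
Proof. by rewrite /zr (rmorphN int_of_Z) rmorphN. Qed.
Lemma zrB a b : zr (Z.sub a b) = zr a - zr b.
Proof. by rewrite -zrN -zrD. Qed.
Lemma zr0 : zr 0 = 0. Proof. by []. Qed.
Lemma zr1 : zr 1 = 1. Proof. by []. Qed.
Lemma zr2 : zr 2 = 2. Proof. by []. Qed.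
Lemma zrJ a : (zr a)^* = zr a.
Proof. by rewrite /zr rmorph_int. Qed.
Definition zrE := (zrD, zrM, zrN, zrB, zr0, zr1, zr2).

Definition ev (x : z4) : C :=
  let: Z4 a b c d := x in zr a + zr b * z + zr c * z ^+ 2 + zr d * z ^+ 3.

Lemma evD x y : ev (zadd x y) = ev x + ev y.
Proof. by case: x => a b c d; case: y => a' b' c' d'; rewrite /= !zrE; ring. Qed.
Lemma evN x : ev (zopp x) = - ev x.
Proof. by case: x => a b c d; rewrite /= !zrE; ring. Qed.
Lemma evM x y : ev (zmul x y) = ev x * ev y.
Proof.
have h := zeta4 R.
by case: x => a b c d; case: y => a' b' c' d'; rewrite /= !zrE; ring: h.
Qed.
Lemma evJ x : ev (zconj x) = (ev x)^*.
Proof.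
case: x => a b c d; rewrite /= !(rmorphD, rmorphM, rmorphXn) /= !zrJ zetaJ.
by rewrite !zrE; have h := zeta4 R; ring: h.
Qed.
Lemma ev0 : ev z0 = 0. Proof. by rewrite /= !zrE; ring. Qed.
Lemma ev1 : ev z1 = 1. Proof. by rewrite /= !zrE; ring. Qed.
Lemma evz : ev zz = z. Proof. by rewrite /= !zrE; ring. Qed.
Lemma evX n : ev (zpow n) = z ^+ n.
Proof.
elim: n => [|n IH]; first by rewrite ev1.
by rewrite -[zpow _]/(zmul zz (zpow n)) evM IH evz exprS.
Qed.

Definition evE := (evD, evN, evM, evJ, ev0, ev1).

Lemma ZzetaE x : reflect (exists a, x = ev a) (x \in @Zzeta R).
Proof.
apply: (iffP (ZzetaP _)) => [[p ->]|[[a b c d] ->]].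
  elim/poly_ind: p => [|p n [a IH]].
    by exists z0; rewrite rmorph0 horner0 ev0.
  exists (zadd (zmul a zz) (Z4 (Z_of_int n) 0 0 0)).
  rewrite rmorphD rmorphM /= map_polyX map_polyC /= hornerD hornerM hornerX.
  by rewrite hornerC IH evD evM evz /= !zrE /zr Z_of_intK; ring.
exists ((int_of_Z a)%:P + (int_of_Z b)%:P * 'X + (int_of_Z c)%:P * 'X^2
        + (int_of_Z d)%:P * 'X^3).
by rewrite !(rmorphD, rmorphM, rmorphXn) /= !map_polyC !map_polyX !hornerE.
Qed.

(* [r = sqrt 3] *)
Definition rr : C := 2 * z - z ^+ 3.

Lemma rr2 : rr * rr = 3.
Proof. by have h := zeta4 R; rewrite /rr; ring: h. Qed.
Lemma evsq x y : ev (zsq x y) = zr x + zr y * rr.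
Proof. by rewrite /ev /zsq !zrE /rr; ring. Qed.

Lemma rr_gt0 : 0 < rr.
Proof.
have -> : rr = z + z^*.
  by rewrite zetaJ /rr; ring.
rewrite /zeta /expi.
have -> : (cos (2 * pi / 12 : R) +i* sin (2 * pi / 12))%C
     + ((cos (2 * pi / 12 : R) +i* sin (2 * pi / 12))%C)^* =
     (2 * cos (2 * pi / 12))%:C%C.
  by apply/eqP; rewrite eq_complex /=; apply/andP; split; apply/eqP; ring.
rewrite ltcR; apply: mulr_gt0 => //.
by have := pi_gt0 R => pi0; apply: cos_gt0_pihalf; apply/andP; split; lra.
Qed.

End Eval.

(** * Matrices over [Z[zeta]] and the group [Gamma] *)

Inductive mat : Set := Mat of z4 & z4 & z4 & z4 & z4 & z4 & z4 & z4 & z4.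

Definition mateqb M N :=
  let: Mat a b c d e f g h k := M in
  let: Mat a' b' c' d' e' f' g' h' k' := N in
  if zeqb a a' then if zeqb b b' then if zeqb c c' then if zeqb d d' then
  if zeqb e e' then if zeqb f f' then if zeqb g g' then if zeqb h h' then
  zeqb k k' else false else false else false else false else false else false
  else false else false.

Lemma mateqbP : Equality.axiom mateqb.
Proof.
move=> [a b c d e f g h k] [a' b' c' d' e' f' g' h' k'].
apply: (iffP idP) => [|[-> -> -> -> -> -> -> -> ->]].
  by rewrite /mateqb; do 8?[case: zeqbP => // ->]; case: zeqbP => // ->.
by rewrite /mateqb !(introT (zeqbP _ _) erefl).
Qed.
HB.instance Definition _ := hasDecEq.Build mat mateqbP.

Definition dot3 a b c a' b' c' := zadd (zadd (zmul a a') (zmul b b')) (zmul c c').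
Definition mmul M N :=
  let: Mat a b c d e f g h k := M in
  let: Mat a' b' c' d' e' f' g' h' k' := N in
  Mat (dot3 a b c a' d' g') (dot3 a b c b' e' h') (dot3 a b c c' f' k')
      (dot3 d e f a' d' g') (dot3 d e f b' e' h') (dot3 d e f c' f' k')
      (dot3 g h k a' d' g') (dot3 g h k b' e' h') (dot3 g h k c' f' k').
Definition mstar M :=
  let: Mat a b c d e f g h k := M in
  Mat (zconj a) (zconj d) (zconj g) (zconj b) (zconj e) (zconj h)
      (zconj c) (zconj f) (zconj k).
Definition mscale s M :=
  let: Mat a b c d e f g h k := M in
  Mat (zmul s a) (zmul s b) (zmul s c) (zmul s d) (zmul s e) (zmul s f)
      (zmul s g) (zmul s h) (zmul s k).
Definition m33 M := let: Mat _ _ _ _ _ _ _ _ k := M in k.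

Definition mid := Mat z1 z0 z0 z0 z1 z0 z0 z0 z1.
Definition Fm := Mat (zsq (-1) (-1)) z1 z0 z1 (zsq 1 (-1)) z0 z0 z0 z1.
Definition Fim :=
  Mat (zsq 1 (-1)) (zsq (-1) 0) z0 (zsq (-1) 0) (zsq (-1) (-1)) z0 z0 z0 z1.
Definition unim M := mmul (mmul (mstar M) Fm) M == Fm.
Definition minv M := mmul (mmul Fim (mstar M)) Fm.
Definition peq M N := has (fun n => M == mscale (zpow n) N) (iota 0 12).

Definition um := Mat (Z4 0 (-1) 1 1) (Z4 1 (-1) 0 0) z0
                     (Z4 (-1) 0 1 1) (Z4 0 1 0 (-1)) z0 z0 z0 z1.
Definition vm := Mat (Z4 0 0 0 1) z0 z0 (Z4 (-1) (-1) 1 1) z1 z0 z0 z0 z1.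
Definition bm := Mat z1 z0 z0
  (Z4 2 2 (-1) (-2)) (Z4 (-1) (-1) 1 1) (Z4 0 0 (-1) (-1))
  (Z4 0 1 1 0) (Z4 (-1) 0 0 (-1)) (Z4 1 1 0 (-1)).
Arguments zmul : simpl never.
Arguments zadd : simpl never.
Arguments zopp : simpl never.
Arguments zconj : simpl never.
Arguments zsq : simpl never.
Arguments ev : simpl never.

Section Eval.
Variable R : realType.
Local Notation C := R[i].
Local Notation z := (zeta R).
Local Notation ev := (@ev R).
Local Notation zr := (@zr R).

Lemma zr_inj : injective zr.
Proof.
move=> a b /eqP; rewrite /zr eqr_int => /eqP.
exact: (can_inj int_of_ZK).
Qed.

(** For nonzero [q] the 3-adic valuations of the two sides would have different parities. *)
Lemma sqrt3_irr (p q : Z) : Z.mul p p = Z.mul 3 (Z.mul q q) -> p = Z0 /\ q = Z0.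
Proof.
move=> h.
have [q0|q0] := eqVneq q Z0; first by subst q; nia.
have p0 : p != Z0 by apply/eqP => p0; subst p; move/eqP: q0; nia.
have h' : (Z.abs_nat p ^ 2 = 3 * Z.abs_nat q ^ 2)%N.
  rewrite -!mulnn. 
  have : Z.abs_nat (Z.mul p p) = Z.abs_nat (Z.mul 3 (Z.mul q q)) by rewrite h.
  by rewrite !Zabs2Nat.inj_mul.
have := congr1 (logn 3) h'.
rewrite lognM // ?expn_gt0; last by apply/orP; left; move/eqP: q0; lia.
rewrite !lognX (@logn_prime 3 3) // => E.
by have := congr1 odd E; rewrite oddD !oddM.
Qed.

Lemma zr_rr_eq0 p q : zr p + zr q * rr R = 0 -> p = Z0 /\ q = Z0.
Proof.
move=> h; apply: sqrt3_irr; apply: zr_inj.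
rewrite !zrE (_ : zr 3 = rr R * rr R); last by rewrite rr2 /zr.
have -> : zr p = - (zr q * rr R) by apply/eqP; rewrite -addr_eq0 h.
by ring.
Qed.

(** Adding and subtracting the complex conjugate gives [(2a + c) + b sqrt 3 = 0] and, after division
    by [zeta ^+ 3], [(b + 2d) + c sqrt 3 = 0]. *)
Lemma ev_eq0 x : ev x = 0 -> x = z0.
Proof.
case: x => a b c d h; have h4 := zeta4 R.
have z12 := zeta12 R.
have hc : ev (zconj (Z4 a b c d)) = 0 by rewrite evJ h rmorph0.
have z3 : z ^+ 3 != 0.
  by rewrite expf_eq0 /=; apply: contra_eq_neq z12 => ->; rewrite expr0n eq_sym oner_eq0.
have hP : zr (2 * a + c) + zr b * rr R = 0.
  transitivity (ev (Z4 a b c d) + ev (zconj (Z4 a b c d))).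
    by rewrite /ev /zconj /rr !zrE; ring: h4.
  by rewrite h hc addr0.
have hQ : zr (b + 2 * d) + zr c * rr R = 0.
  apply: (mulfI z3); rewrite mulr0.
  transitivity (ev (Z4 a b c d) - ev (zconj (Z4 a b c d))).
    by rewrite /ev /zconj /rr !zrE; ring: h4.
  by rewrite h hc subr0.
have [? ?] := zr_rr_eq0 hP; have [? ?] := zr_rr_eq0 hQ.
by rewrite /z0; congr Z4; lia.
Qed.

Lemma ev_inj : injective ev.
Proof.
move=> x y h; have := @ev_eq0 (zadd x (zopp y)).
rewrite evD evN h subrr => /(_ erefl).
case: x {h} => a b c d; case: y => a' b' c' d'; rewrite /zadd /zopp => -[*].
by congr Z4; lia.
Qed.

Definition evm M : 'M[C]_3 :=
  let: Mat a b c d e f g h k := M in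
  mx3 [:: [:: ev a; ev b; ev c]; [:: ev d; ev e; ev f]; [:: ev g; ev h; ev k]].

Lemma evm_mul M N : evm (mmul M N) = evm M *m evm N.
Proof.
case: M => a b c d e f g h k; case: N => a' b' c' d' e' f' g' h' k'.
by rewrite /evm /mmul /dot3 mx3M !evE.
Qed.
Lemma evm_star M : evm (mstar M) = ((evm M) ^t*)%sesqui.
Proof.
by case: M => a b c d e f g h k; rewrite /evm /mstar mx3_adjoint !evE.
Qed.
Lemma mx3_inj (K : pzRingType) (a b c d e f g h k a' b' c' d' e' f' g' h' k' : K) :
  mx3 [:: [:: a; b; c]; [:: d; e; f]; [:: g; h; k]] =
  mx3 [:: [:: a'; b'; c']; [:: d'; e'; f']; [:: g'; h'; k']] ->
  [/\ [/\ a = a', b = b' & c = c'], [/\ d = d', e = e' & f = f']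
   & [/\ g = g', h = h' & k = k']].
Proof.
move=> /matrixP E; have E' (i j : 'I_3) := E i j.
have i0 : (0 < 3)%N by []. have i1 : (1 < 3)%N by []. have i2 : (2 < 3)%N by [].
have := (E' (Ordinal i0) (Ordinal i0), E' (Ordinal i0) (Ordinal i1), E' (Ordinal i0) (Ordinal i2)).
have := (E' (Ordinal i1) (Ordinal i0), E' (Ordinal i1) (Ordinal i1), E' (Ordinal i1) (Ordinal i2)).
have := (E' (Ordinal i2) (Ordinal i0), E' (Ordinal i2) (Ordinal i1), E' (Ordinal i2) (Ordinal i2)).
by rewrite !mxE /= => -[[? ?] ?] [[? ?] ?] [[? ?] ?].
Qed.
Lemma evm_inj : injective evm.
Proof.
move=> [a b c d e f g h k] [a' b' c' d' e' f' g' h' k'] /mx3_inj.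
by move=> [[/ev_inj-> /ev_inj-> /ev_inj->] [/ev_inj-> /ev_inj-> /ev_inj->]
  [/ev_inj-> /ev_inj-> /ev_inj->]].
Qed.
Lemma evm_scale s M : evm (mscale s M) = (ev s)%:M *m evm M.
Proof.
case: M => a b c d e f g h k; rewrite /evm /mscale mx3_scalar mx3M !evE.
by rewrite !mul0r !add0r !addr0.
Qed.
Lemma evm_id : evm mid = 1%:M.
Proof. by rewrite /= mx3_scalar !evE. Qed.
Lemma evm_F : evm Fm = F R.
Proof.
rewrite /F zetaV /= !evE !evsq !zrE /rr.
by congr (mx3 [:: [:: _; _; _]; [:: _; _; _]; [:: _; _; _]]); ring.
Qed.

Lemma evm_over M : evm M \is a mxOver (@Zzeta R).
Proof.
case: M => a b c d e f g h k; apply: mx3_over.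
have E x : ev x \in @Zzeta R by apply/ZzetaE; exists x.
by rewrite /= !E.
Qed.

Lemma evm_surj (A : 'M[C]_3) : A \is a mxOver (@Zzeta R) -> exists M, A = evm M.
Proof.
move=> /mxOverP H.
have i0 : (0 < 3)%N by []. have i1 : (1 < 3)%N by []. have i2 : (2 < 3)%N by [].
have E i j := elimT (ZzetaE _) (H i j).
have [a ha] := E (Ordinal i0) (Ordinal i0).
have [b hb] := E (Ordinal i0) (Ordinal i1).
have [c hc] := E (Ordinal i0) (Ordinal i2).
have [d hd] := E (Ordinal i1) (Ordinal i0).
have [e he] := E (Ordinal i1) (Ordinal i1).
have [f hf] := E (Ordinal i1) (Ordinal i2).
have [g hg] := E (Ordinal i2) (Ordinal i0).
have [h hh] := E (Ordinal i2) (Ordinal i1).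
have [k hk] := E (Ordinal i2) (Ordinal i2).
exists (Mat a b c d e f g h k); apply/matrixP => i j; rewrite mxE.
by case: i => [[|[|[|i]]] p] //=; case: j => [[|[|[|j]]] q] //=;
  rewrite -?ha -?hb -?hc -?hd -?he -?hf -?hg -?hh -?hk;
  congr (A _ _); apply: val_inj.
Qed.

Lemma unimE M : unim M = (evm M \in @F_unitary R).
Proof.
rewrite inE evm_over -evm_F -evm_star -!evm_mul /=.
by rewrite /unim; apply/eqP/eqP => [->|h] //; apply: evm_inj.
Qed.

Lemma unim_mul M N : unim M -> unim N -> unim (mmul M N).
Proof. by rewrite !unimE evm_mul; apply: F_unitary_mul. Qed.

Lemma unim_inv M : unim M -> unim (minv M) /\ evm (minv M) = invmx (evm M).
Proof.
rewrite !unimE => uM; have [_ iM] := F_unitary_invE uM.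
suff E : evm (minv M) = invmx (evm M) by rewrite E F_unitary_inv.
rewrite iM /minv !evm_mul evm_star evm_F; congr (_ *m _ *m _).
rewrite /F_inv /= !evE !evsq !zrE /rr.
by congr (mx3 [:: [:: _; _; _]; [:: _; _; _]; [:: _; _; _]]); ring.
Qed.

Lemma mmulA M N P : mmul M (mmul N P) = mmul (mmul M N) P.
Proof. by apply: evm_inj; rewrite !evm_mul mulmxA. Qed.
Lemma mmul1 M : mmul M mid = M.
Proof. by apply: evm_inj; rewrite !evm_mul evm_id mulmx1. Qed.
Lemma m1mul M : mmul mid M = M.
Proof. by apply: evm_inj; rewrite !evm_mul evm_id mul1mx. Qed.
Lemma mmulV M : unim M -> mmul M (minv M) = mid.
Proof.
move=> uM; apply: evm_inj; rewrite evm_mul evm_id (unim_inv uM).2 mulmxV //.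
by move: uM; rewrite unimE => /F_unitary_invE[].
Qed.
Lemma mmVl M : unim M -> mmul (minv M) M = mid.
Proof.
move=> uM; apply: evm_inj; rewrite evm_mul evm_id (unim_inv uM).2 mulVmx //.
by move: uM; rewrite unimE => /F_unitary_invE[].
Qed.

Definition toU M : unitary_group R := insubd (1%g : unitary_group R) (evm M).
(* Sealed: comparing [toG M] with [toG N] by conversion would compute for minutes. *)
Fact toG_key : {f : mat -> Gamma R | forall M, f M = \pi_(Gamma R) (toU M)}.
Proof. by exists (fun M => \pi_(Gamma R) (toU M)). Qed.
Definition toG := sval toG_key.
Lemma toGE M : toG M = \pi_(Gamma R) (toU M).
Proof. exact: (svalP toG_key). Qed.

Lemma toU_val M : unim M -> val (toU M) = evm M.
Proof. by rewrite unimE => uM; rewrite insubdK. Qed.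

Lemma toU_mul M N : unim M -> unim N -> toU (mmul M N) = (toU M * toU N)%g.
Proof.
move=> uM uN; apply: val_inj; rewrite toU_val ?unim_mul // evm_mul.
by rewrite [RHS]/= -!toU_val.
Qed.
Lemma toU_id : toU mid = 1%g.
Proof. by apply: val_inj; rewrite toU_val // evm_id. Qed.

Lemma toU_surj (g : unitary_group R) : exists2 M, unim M & g = toU M.
Proof.
have gU := valP g; have [M gM] := evm_surj (proj1 (andP gU)).
have uM : unim M by rewrite unimE -gM.
by exists M => //; apply: val_inj; rewrite toU_val.
Qed.

Lemma toG_mul M N : unim M -> unim N -> toG (mmul M N) = (toG M * toG N)%g.
Proof. by move=> uM uN; rewrite !toGE toU_mul // -[RHS]pi_quotient_mul. Qed.
Lemma toG_id : toG mid = 1%g.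
Proof. by rewrite toGE toU_id -[RHS]/(quotient_one _) /quotient_one; unlock. Qed.
Lemma toG_inv M : unim M -> toG (minv M) = ((toG M)^-1)%g.
Proof.
move=> uM; have uV := (unim_inv uM).1; apply: (mulgI (toG M)).
by rewrite mulgV -toG_mul // mmulV // toG_id.
Qed.

Lemma toG_surj (g : Gamma R) : exists2 M, unim M & g = toG M.
Proof.
have [M uM E] := toU_surj (repr g); exists M => //.
by rewrite toGE -E reprK.
Qed.

Lemma toG_eq M N : unim M -> unim N -> toG M = toG N <-> peq M N.
Proof.
move=> uM uN.
have -> : toG M = toG N <-> ((toU N)^-1 * toU M)%g \in @scalars R.
  rewrite !toGE; split=> [/esym/eqP|h]; first by rewrite -coset_eqE.
  by apply/esym/eqP; rewrite coset_eqE.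
split=> [/existsP[nu /eqP E]|/hasP[n _ /eqP E]].
  apply/hasP; exists (val nu); first by rewrite mem_iota /= add0n.
  apply/eqP/evm_inj; rewrite evm_scale evX -E -(toU_val uM) -(toU_val uN).
  rewrite E -scalar_mxC -E.
  by rewrite -[RHS]/(val (toU N * ((toU N)^-1 * toU M))%g) mulVKg.
apply/scalarsP; exists n; rewrite [LHS]/= (toU_val uN) (toU_val uM) E.
rewrite evm_scale evX -scalar_mxC mulmxA mulVmx ?mul1mx //.
by move: uN; rewrite unimE => /F_unitary_invE[].
Qed.

Lemma zrm1 : zr (-1) = -1. Proof. exact: (zrN R 1). Qed.
Lemma zrm2 : zr (-2) = -2. Proof. exact: (zrN R 2). Qed.

Lemma uG : gamma_u R = toG um.
Proof.
rewrite toGE; congr \pi_(Gamma R); apply: val_inj; rewrite toU_val //.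
rewrite /u_mx /evm /um /= /ev !(zrm1, zrm2, zr0, zr1, zr2).
by congr (mx3 [:: [:: _; _; _]; [:: _; _; _]; [:: _; _; _]]); ring.
Qed.
Lemma vG : gamma_v R = toG vm.
Proof.
rewrite toGE; congr \pi_(Gamma R); apply: val_inj; rewrite toU_val //.
rewrite /v_mx /evm /vm /= /ev !(zrm1, zrm2, zr0, zr1, zr2).
by congr (mx3 [:: [:: _; _; _]; [:: _; _; _]; [:: _; _; _]]); ring.
Qed.
Lemma bG : gamma_b R = toG bm.
Proof.
rewrite toGE; congr \pi_(Gamma R); apply: val_inj; rewrite toU_val //.
rewrite /b_mx /evm /bm /= /ev !(zrm1, zrm2, zr0, zr1, zr2).
by congr (mx3 [:: [:: _; _; _]; [:: _; _; _]; [:: _; _; _]]); ring.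
Qed.

End Eval.

(** * Heights *)

Definition nsq x := zmul x (zconj x).
Definition nsqx x := let: Z4 p _ _ _ := nsq x in p.
Definition nsqy x := let: Z4 _ _ _ d := nsq x in Z.opp d.
(* [|m33 M|^2 = x + y sqrt 3] is mapped to [y], which determines it on [Gamma]. *)
Definition ht M := Z.to_nat (nsqy (m33 M)).

Lemma nsqE x : nsq x = zsq (nsqx x) (nsqy x).
Proof.
by case: x => a b c d; rewrite /nsqx /nsqy /nsq /zmul /zconj /zsq; congr Z4; lia.
Qed.

Lemma zsigM x y : zsig (zmul x y) = zmul (zsig x) (zsig y).
Proof.
by case: x => a b c d; case: y => a' b' c' d'; rewrite /zmul /zsig; congr Z4; lia.
Qed.
Lemma zsigD x y : zsig (zadd x y) = zadd (zsig x) (zsig y).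
Proof.
by case: x => a b c d; case: y => a' b' c' d'; rewrite /zadd /zsig; congr Z4; lia.
Qed.
Lemma zsigN x : zsig (zopp x) = zopp (zsig x).
Proof. by case: x => a b c d; rewrite /zopp /zsig; congr Z4; lia. Qed.
Lemma zsigJ x : zsig (zconj x) = zconj (zsig x).
Proof. by case: x => a b c d; rewrite /zconj /zsig; congr Z4; lia. Qed.
Lemma zsig_zsq p q : zsig (zsq p q) = zsq p (Z.opp q).
Proof. by rewrite /zsq /zsig; congr Z4; lia. Qed.

(* [row3 M * F^-1 * row3 M ^*], the third diagonal entry of [M F^-1 M^*] *)
Definition q3 x y k :=
  zadd (zadd (zmul (zadd (zmul x (zsq 1 (-1))) (zopp y)) (zconj x))
             (zmul (zadd (zopp x) (zmul y (zsq (-1) (-1)))) (zconj y)))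
       (nsq k).

Section Heights.
Variable R : realType.
Local Notation C := R[i].
Local Notation z := (zeta R).
Local Notation ev := (@ev R).
Local Notation zr := (@zr R).

Definition s3 : R := Num.sqrt (3%:R : R).
Definition zR (a : Z) : R := (int_of_Z a)%:~R.

Lemma s3_sqr : s3 * s3 = 3.
Proof. by rewrite -expr2 sqr_sqrtr. Qed.
Lemma s3_gt0 : 0 < s3.
Proof. by rewrite sqrtr_gt0. Qed.
Lemma s3_bounds : 19 / 11 < s3 < 26 / 15.
Proof. by have := s3_sqr; have := s3_gt0 => ? ?; apply/andP; split; nra. Qed.

Lemma zrC a : zr a = (zR a)%:C%C.
Proof. by rewrite /zr /zR rmorph_int. Qed.
Lemma rrC : rr R = s3%:C%C.
Proof.
have : (rr R - s3%:C%C) * (rr R + s3%:C%C) = 0.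
  transitivity (rr R * rr R - (s3 * s3)%:C%C); first by rewrite rmorphM; ring.
  by rewrite rr2 s3_sqr (rmorph_nat (real_complex R)) subrr.
move/eqP; rewrite mulf_eq0 subr_eq0 => /orP[/eqP//|].
rewrite addr_eq0 => /eqP h; have := rr_gt0 R.
by rewrite h oppr_gt0 -(rmorph0 (real_complex R)) ltcR ltNge ltW ?s3_gt0.
Qed.
Lemma zsqC p q : ev (zsq p q) = (zR p + zR q * s3)%:C%C.
Proof. by rewrite evsq !zrC rrC rmorphD rmorphM. Qed.

Lemma zR_le a b : Z.le a b -> zR a <= zR b.
Proof. by move=> h; rewrite /zR ler_int; lia. Qed.
Lemma zR_lt a b : Z.lt a b -> zR a + 1 <= zR b.
Proof. by move=> h; rewrite /zR -[1]/(1%:~R) -rmorphD ler_int; lia. Qed.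
Lemma zRM a b : zR (Z.mul a b) = zR a * zR b.
Proof. by rewrite /zR (rmorphM int_of_Z) rmorphM. Qed.
Lemma zR_inj : injective zR.
Proof. by move=> a b /eqP; rewrite eqr_int => /eqP; apply: (can_inj int_of_ZK). Qed.

Definition hv M : R := zR (nsqx (m33 M)) + zR (nsqy (m33 M)) * s3.
Lemma hvE M : ev (nsq (m33 M)) = (hv M)%:C%C.
Proof. by rewrite nsqE zsqC. Qed.

Lemma unim_q3 a b c d e f g h k :
  unim (Mat a b c d e f g h k) -> q3 g h k = z1.
Proof.
move=> /(mmulV R) E.
have {E} : m33 (mmul (Mat a b c d e f g h k) (minv (Mat a b c d e f g h k))) = z1.
  by rewrite E.
rewrite /minv (mmulA R) => <-; apply: (@ev_inj R).
rewrite /q3 /nsq /= /dot3 !evE !zsqC; ring.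
Qed.

(** By [unim_q3], |g_33|^2 is 1 plus a form in the other two entries of the row. That form is
    positive definite for [sqrt 3] and negative definite for [- sqrt 3]; the conjugate, being itself
    a norm, is also nonnegative. *)
Lemma unim_hvs M : unim M ->
  [/\ 1 <= hv M, 0 <= zR (nsqx (m33 M)) - zR (nsqy (m33 M)) * s3
    & zR (nsqx (m33 M)) - zR (nsqy (m33 M)) * s3 <= 1].
Proof.
have rp := rr_gt0 R; have rr2 := rr2 R; have rC := rrC.
have r1 : 1 < rr R.
  rewrite rC -(rmorph1 (real_complex R)) ltcR.
  by have /andP[? ?] := s3_bounds; lra.
(* One identity for both embeddings: for [t = sqrt 3] the factor [1 + t] is positive, for
   [t = - sqrt 3] it is negative. *)
have pos (t x y : C) : t * t = 3 -> 0 <= (1 + t) *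
    ((t - 1) * (x * x^*) + y * x^* + x * y^* + (1 + t) * (y * y^*)) \/ t^* != t.
  move=> t2; have [tJ|?] := eqVneq (t^*) t; [left|by right].
  rewrite (_ : (1 + t) * _ = x * x^* + (x + (1 + t) * y) * (x + (1 + t) * y)^*).
    by rewrite addr_ge0 // mul_conjC_ge0.
  by rewrite rmorphD rmorphM rmorphD rmorph1 /= tJ; ring: t2.
have rJ : (rr R)^* = rr R by apply/CrealP; rewrite gtr0_real.
case: M => a b c d e f g h k /unim_q3 E.
have E1 : ev (nsq k) = 1 + ((rr R - 1) * (ev g * (ev g)^*) + ev h * (ev g)^*
   + ev g * (ev h)^* + (1 + rr R) * (ev h * (ev h)^*)).
  have := congr1 ev E; rewrite /q3 !evE !evsq !zrE !zrm1 => /eqP.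
  rewrite -subr_eq0 => /eqP h0; apply/eqP; rewrite -subr_eq0 -h0; apply/eqP.
  by ring.
have E2 : ev (zsig (nsq k)) = 1 + ((- rr R - 1) * (ev (zsig g) * (ev (zsig g))^*)
   + ev (zsig h) * (ev (zsig g))^* + ev (zsig g) * (ev (zsig h))^*
   + (1 + - rr R) * (ev (zsig h) * (ev (zsig h))^*)).
  have := congr1 (fun x => ev (zsig x)) E.
  rewrite /q3 /nsq !(zsigD, zsigM, zsigJ, zsigN, zsig_zsq) !evE !evsq !zrE !zrm1 => /eqP.
  rewrite -subr_eq0 => /eqP h0; apply/eqP; rewrite -subr_eq0 -h0; apply/eqP.
  by ring.
have G1 : 0 <= ev (nsq k) - 1.
  rewrite E1 addrC addKr.
  have [|] := pos (rr R) (ev g) (ev h) rr2; last by rewrite rJ eqxx.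
  by rewrite pmulr_rge0 // addr_gt0.
have G2 : ev (zsig (nsq k)) - 1 <= 0.
  rewrite E2 addrC addKr.
  have [|] := pos (- rr R) (ev (zsig g)) (ev (zsig h)) (etrans (mulrNN _ _) rr2).
    by rewrite nmulr_rge0 // subr_lt0.
  by rewrite rmorphN /= rJ eqxx.
have G3 : 0 <= ev (zsig (nsq k)).
  by rewrite /nsq zsigM zsigJ evM evJ mul_conjC_ge0.
move: G1 G2 G3; rewrite /hv /= nsqE zsig_zsq !zsqC.
rewrite -(rmorph1 (real_complex R)) -!rmorphB -(rmorph0 (real_complex R)) !lecR.
rewrite (_ : zR (- nsqy k) = - zR (nsqy k)); last by rewrite /zR !rmorphN.
by move=> *; split; lra.
Qed.

End Heights.

Section HeightOrder.
Variable R : realType.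
Local Notation s3 := (s3 R).
Local Notation zR := (zR R).
Local Notation hv := (hv R).

Lemma zR0 : zR 0 = 0. Proof. by []. Qed.
Lemma zR1 : zR 1 = 1. Proof. by []. Qed.

(* If [p - q sqrt 3] is in [[0, 1]] and [p + q sqrt 3 >= 1] then [q] determines
   [p + q sqrt 3], monotonically. *)
Lemma conj_bounded_lt (p q p' q' : Z) :
  1 <= zR p + zR q * s3 -> 0 <= zR p - zR q * s3 -> zR p - zR q * s3 <= 1 ->
  1 <= zR p' + zR q' * s3 -> 0 <= zR p' - zR q' * s3 -> zR p' - zR q' * s3 <= 1 ->
  (zR p + zR q * s3 < zR p' + zR q' * s3) = Z.ltb q q'.
Proof.
have := @zR_lt R q q'; have := @zR_lt R q' q; have := @zR_lt R p p'.
have := @zR_le R q q'; have := @zR_le R q' q; have := @zR_le R p' p.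
have : zR p = zR q * s3 -> zR p = 0 /\ zR q = 0.
  move=> E; have [-> ->] : p = Z0 /\ q = Z0; last by [].
  apply: sqrt3_irr; apply: (@zR_inj R); rewrite !zRM E.
  by rewrite mulrACA s3_sqr mulrC.
have := s3_bounds R; have := s3_gt0 R.
move: (zR p) (zR q) (zR p') (zR q') s3 => P Q P' Q' s s0 sb irr Lp Lq Lq' gp gq' gq.
move=> A1 A2 A3 B1 B2 B3; move/andP: sb => [sl su].
have gap a b : a + 1 <= b -> a * s + s <= b * s.
  by move=> h; have := ler_wpM2r (ltW s0) h; rewrite mulrDl mul1r.
apply/idP/idP => [h|/Z.ltb_lt/gq/gap hq]; last first.
  by clear -A1 A2 A3 B1 B2 B3 sl su hq; lra.
apply/Z.ltb_lt; have [//|/Lq le_q] := Z.lt_ge_cases q q'; exfalso.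
have [/gq'/gap|/Lq' ge_q] := Z.lt_ge_cases q' q.
  by move=> hq; clear -A1 A2 A3 B1 B2 B3 sl su h hq; lra.
have E : Q' = Q by apply/eqP; rewrite eq_le le_q ge_q.
rewrite {}E in h B1 B2 B3.
have [/gp lt_p|/Lp le_p] := Z.lt_ge_cases p p'; last first.
  by clear -h le_p; lra.
(* Now [p < p'] are integers in an interval of length 1, hence its endpoints, and [p = q sqrt 3]. *)
have [| p0 q0] := irr; first by clear -A2 B3 lt_p; lra.
by rewrite p0 q0 in A1; clear -A1; lra.
Qed.

Lemma nsqy_ge0 M : unim M -> Z.le 0 (nsqy (m33 M)).
Proof.
move=> /(unim_hvs R)[h1 h2 h3].
have [/(@zR_lt R) h|//] := Z.lt_ge_cases (nsqy (m33 M)) 0.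
have := s3_gt0 R; move: h1 h2 h3 h; rewrite /hv zR0.
move: (zR _) (zR _) s3 => Q P s h1 h2 h3 h s0; exfalso.
have : (Q + 1) * s <= 0 by rewrite pmulr_lle0.
lra.
Qed.

Lemma hv_lt M N : unim M -> unim N -> (hv M < hv N) = (ht M < ht N)%N.
Proof.
move=> uM uN; have := nsqy_ge0 uM; have := nsqy_ge0 uN => pN pM.
have [A1 A2 A3] := unim_hvs R uM; have [B1 B2 B3] := unim_hvs R uN.
rewrite conj_bounded_lt // /ht.
by apply/idP/idP => [/Z.ltb_lt|?]; [lia|apply/Z.ltb_lt; lia].
Qed.

Lemma hv_le M N : unim M -> unim N -> (hv M <= hv N) = (ht M <= ht N)%N.
Proof. by move=> uM uN; rewrite leNgt hv_lt // -leqNgt. Qed.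

Lemma hv_ht0 M : unim M -> ht M = 0%N -> hv M = 1.
Proof.
move=> uM; have := nsqy_ge0 uM; have [A1 A2 A3] := unim_hvs R uM.
move: A1 A2 A3; rewrite /ht /hv => A1 A2 A3 p h.
have E : nsqy (m33 M) = Z0 by lia.
by move: A1 A2 A3; rewrite E zR0 => *; lra.
Qed.

(** The integer part x satisfies [x >= y sqrt 3 > 1], so it is at least 2: the values of |g_33|^2
    have a gap above 1. *)
Lemma hv_ht_gt0 M : unim M -> (0 < ht M)%N -> 2 + s3 <= hv M.
Proof.
move=> uM; have := nsqy_ge0 uM; have [A1 A2 A3] := unim_hvs R uM.
move: A1 A2 A3; rewrite /ht /hv => A1 A2 A3 p h.
have /andP[sl su] := s3_bounds R.
have /(@zR_lt R) : Z.lt 0 (nsqy (m33 M)) by lia.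
rewrite zR0 => q1.
have /(@zR_lt R) : Z.lt 1 (nsqx (m33 M)).
  have [//|/(@zR_le R)] := Z.lt_ge_cases 1 (nsqx (m33 M)).
  rewrite zR1 => ?; exfalso; nra.
rewrite zR1 => p1; nra.
Qed.

(** The 9 is the bound of [gram_bound]; from height 3 on, |g_33|^2 is at least [2 y sqrt 3], which
    exceeds 10. *)
Lemma hv_lt9 M : unim M -> hv M < 9 -> (ht M <= 2)%N.
Proof.
move=> uM; have := nsqy_ge0 uM; have [A1 A2 A3] := unim_hvs R uM.
move: A1 A2 A3; rewrite /ht /hv => A1 A2 A3 p h.
have /andP[sl su] := s3_bounds R.
have [?|/(@zR_le R)] := Z.lt_ge_cases (nsqy (m33 M)) 3; first by lia.
rewrite (_ : zR 3 = 3) // => /(ler_wpM2r (ltW (s3_gt0 R))) ?; exfalso; lra.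
Qed.

End HeightOrder.

(** * Hermitian forms and definiteness certificates *)

Arguments Z.leb : simpl never.

Definition madd M N :=
  let: Mat a b c d e f g h k := M in
  let: Mat a' b' c' d' e' f' g' h' k' := N in
  Mat (zadd a a') (zadd b b') (zadd c c') (zadd d d') (zadd e e') (zadd f f')
      (zadd g g') (zadd h h') (zadd k k').
Definition outer a b c :=
  Mat (zmul a (zconj a)) (zmul a (zconj b)) (zmul a (zconj c))
      (zmul b (zconj a)) (zmul b (zconj b)) (zmul b (zconj c))
      (zmul c (zconj a)) (zmul c (zconj b)) (zmul c (zconj c)).
Definition outer3 M := let: Mat _ _ c _ _ f _ _ k := M in outer c f k.

(* decides [0 < x] for [x] in [Z[sqrt 3]] and returns [false] for other [x] *)
Definition zpos x :=
  let: Z4 p b c d := x in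
  let q := Z.opp d in
  [&& Z.eqb c 0, Z.eqb b (Z.mul 2 q) &
    [|| Z.ltb 0 p && Z.leb 0 q,
        [&& Z.ltb 0 p, Z.ltb q 0 & Z.ltb (Z.mul 3 (Z.mul q q)) (Z.mul p p)] |
        [&& Z.leb p 0, Z.ltb 0 q & Z.ltb (Z.mul p p) (Z.mul 3 (Z.mul q q))]]].

(** Sylvester's criterion by fraction-free elimination with pivot [a]: [D], [G] and [H] are the
    entries of the reduced 2 x 2 matrix, and the last quantity is [a] times the determinant. *)
Definition pdef N :=
  let: Mat a b c d e f g h k := N in
  let D := zadd (zmul a e) (zopp (zmul d b)) in
  let G := zadd (zmul a f) (zopp (zmul d c)) in
  let H := zadd (zmul a k) (zopp (zmul g c)) in
  [&& d == zconj b, g == zconj c, h == zconj f, zpos a, zpos D &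
    zpos (zadd (zmul D H) (zopp (zmul G (zconj G))))].

Definition mzero := mscale z0 mid.
Definition comb (ls : seq Z) (Gs : seq mat) : mat :=
  foldr (fun lG => madd (mscale (zsq lG.1 0) lG.2)) mzero (zip ls Gs).
(** Forms with a negative definite nonnegative combination cannot all be nonnegative at a nonzero
    vector. *)
Definition neg_certificate ls Gs :=
  all (Z.leb 0) ls && pdef (mscale (zsq (-1) 0) (comb ls Gs)).

Section Forms.
Variable R : realType.
Local Notation C := R[i].
Local Notation ev := (@ev R).
Local Notation s3 := (s3 R).
Local Notation zR := (zR R).

Definition vec := (C * C * C)%type.
Implicit Types x y : vec.

Definition polar H x y : C :=
  let: Mat a b c d e f g h k := H in
  let: (x1, x2, x3) := x in let: (y1, y2, y3) := y in
  x1 * (ev a * y1^* + ev b * y2^* + ev c * y3^*) +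
  x2 * (ev d * y1^* + ev e * y2^* + ev f * y3^*) +
  x3 * (ev g * y1^* + ev h * y2^* + ev k * y3^*).
Definition hform H x : C := polar H x x.

Definition vmul x M : vec :=
  let: Mat a b c d e f g h k := M in let: (x1, x2, x3) := x in
  (x1 * ev a + x2 * ev d + x3 * ev g, x1 * ev b + x2 * ev e + x3 * ev h,
   x1 * ev c + x2 * ev f + x3 * ev k).

Definition row3 M : vec :=
  let: Mat _ _ _ _ _ _ g h k := M in (ev g, ev h, ev k).

Lemma hform_add H K x : hform (madd H K) x = hform H x + hform K x.
Proof.
case: H => a b c d e f g h k; case: K => a' b' c' d' e' f' g' h' k'.
by case: x => [[x1 x2] x3]; rewrite /= !evE; ring.
Qed.
Lemma hform_scale s H x : hform (mscale s H) x = ev s * hform H x.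
Proof.
case: H => a b c d e f g h k.
by case: x => [[x1 x2] x3]; rewrite /= !evE; ring.
Qed.
Lemma hform_outer a b c x :
  let: (x1, x2, x3) := x in let y := x1 * ev a + x2 * ev b + x3 * ev c in
  hform (outer a b c) x = y * y^*.
Proof.
case: x => [[x1 x2] x3] /=.
by rewrite !evE !(rmorphD, rmorphM) /=; ring.
Qed.
Lemma hform_outer3 M x : hform (outer3 M) x = (vmul x M).2 * (vmul x M).2^*.
Proof.
case: M => a b c d e f g h k; case: x => [[x1 x2] x3].
by rewrite /outer3 (hform_outer c f k (x1, x2, x3)).
Qed.
Lemma vmulA x M N : vmul (vmul x M) N = vmul x (mmul M N).
Proof.
case: M => a b c d e f g h k; case: N => a' b' c' d' e' f' g' h' k'.
by case: x => [[x1 x2] x3]; rewrite /= /dot3 !evE; congr (_, _, _); ring.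
Qed.
Lemma vmul_row3 M N : vmul (row3 M) N = row3 (mmul M N).
Proof.
case: M => a b c d e f g h k; case: N => a' b' c' d' e' f' g' h' k'.
by rewrite /= /dot3 !evE.
Qed.
Lemma polar_vmul H x y M :
  polar H (vmul x M) (vmul y M) = polar (mmul (mmul M H) (mstar M)) x y.
Proof.
case: M => a b c d e f g h k; case: H => a' b' c' d' e' f' g' h' k'.
case: x => [[x1 x2] x3]; case: y => [[y1 y2] y3].
by rewrite /= /dot3 !evE !(rmorphD, rmorphM) /=; ring.
Qed.
Lemma hform_vmul H x M : hform H (vmul x M) = hform (mmul (mmul M H) (mstar M)) x.
Proof. exact: polar_vmul. Qed.
Lemma unim_Fim M : unim M -> mmul (mmul M Fim) (mstar M) = Fim.
Proof.
move=> /(mmulV R) E.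
have FF : mmul Fm Fim = mid by apply/eqP; vm_compute.
rewrite -[LHS](mmul1 R) -FF (mmulA R) -[RHS](m1mul R) -E /minv.
by rewrite !(mmulA R).
Qed.
Lemma hform_Fim x M : unim M -> hform Fim (vmul x M) = hform Fim x.
Proof. by move=> /unim_Fim E; rewrite hform_vmul E. Qed.

Lemma zpos_gt0 (x : z4) : zpos x -> 0 < ev x.
Proof.
case: x => p b c d; rewrite /zpos; set q := Z.opp d.
move=> /and3P[/Z.eqb_eq-> /Z.eqb_eq-> h].
rewrite -[Z4 _ _ _ d]/(Z4 p (2 * q) 0 d) (_ : d = Z.opp q); last by rewrite /q; lia.
rewrite -/(zsq p q) zsqC -(rmorph0 (real_complex R)) ltcR.
have s0 := s3_gt0 R; have s2 := s3_sqr R.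
have lt a c' : Z.ltb a c' -> zR a < zR c'.
  by move=> /Z.ltb_lt/(@zR_lt R); apply: lt_le_trans; rewrite ltrDl.
have le a c' : Z.leb a c' -> zR a <= zR c' by move=> /Z.leb_le/(@zR_le R).
case/or3P: h.
- move=> /andP[/lt p0 /le q0]; rewrite zR0 in p0; rewrite zR0 in q0.
  by rewrite ltr_wpDr // mulr_ge0 // ltW.
- move=> /and3P[/lt p0 /lt q0 /lt h]; rewrite zR0 in p0; rewrite zR0 in q0.
  rewrite !zRM (_ : zR 3 = 3) // -s2 in h.
  have h' : (- zR q * s3) ^+ 2 < zR p ^+ 2 by rewrite !expr2; lra.
  by rewrite ltr_pXn2r ?nnegrE ?mulr_ge0 ?oppr_ge0 // in h'; lra.
- move=> /and3P[/le p0 /lt q0 /lt h]; rewrite zR0 in p0; rewrite zR0 in q0.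
  rewrite !zRM (_ : zR 3 = 3) // -s2 in h.
  have h' : (- zR p) ^+ 2 < (zR q * s3) ^+ 2 by rewrite !expr2; lra.
  by rewrite ltr_pXn2r ?nnegrE ?mulr_ge0 ?oppr_ge0 // in h'; lra.
Qed.

Lemma zpos_real (x : z4) : zpos x -> (ev x)^* = ev x.
Proof. by move=> /zpos_gt0 h; apply/CrealP; rewrite gtr0_real. Qed.

Lemma pdef_gt0 N x : pdef N -> x.2 != 0 -> 0 < hform N x.
Proof.
case: N => a b c d e f g h k; case: x => [[x1 x2] x3] /=.
set D := zadd _ _; set G := zadd (zmul a f) _; set H := zadd (zmul a k) _.
move=> /and5P[/eqP dE /eqP gE /eqP hE a0 /andP[D0 P0]] x3n.
have aJ := zpos_real a0; have DJ := zpos_real D0.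
have {}a0 := zpos_gt0 a0; have {}D0 := zpos_gt0 D0; have {}P0 := zpos_gt0 P0.
have HJ : ev H = ev a * ev k - (ev c)^* * ev c by rewrite /H gE !evE.
have GJ : ev G = ev a * ev f - (ev b)^* * ev c by rewrite /G dE !evE.
have DE : ev D = ev a * ev e - (ev b)^* * ev b by rewrite /D dE !evE.
clearbody D G H.
have {}P0 : 0 < ev D * ev H - ev G * (ev G)^* by move: P0; rewrite !evE.
rewrite -(pmulr_rgt0 _ a0) -(pmulr_rgt0 _ D0).
pose p := ev a * x1^* + ev b * x2^* + ev c * x3^*.
pose t := ev D * x2^* + ev G * x3^*.
(* Two completed squares and the last pivot times |x3|^2, which is positive as [x3] does not
   vanish. *)
rewrite (_ : ev D * _ = ev D * (p * p^*) + t * t^*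
   + (ev D * ev H - ev G * (ev G)^*) * (x3 * x3^*)).
  apply: ltr_wpDl; last by rewrite mulr_gt0 // mul_conjC_gt0.
  apply: addr_ge0; last exact: mul_conjC_ge0.
  by rewrite mulr_ge0 ?mul_conjC_ge0 // ltW.
rewrite /p /t !(rmorphD, rmorphM, rmorphN, rmorphB) /= !conjCK aJ DJ HJ GJ.
rewrite !(rmorphD, rmorphM, rmorphN, rmorphB) /= !conjCK aJ dE gE hE !evJ.
by rewrite DE; ring.
Qed.

Lemma hform_mzero x : hform mzero x = 0.
Proof. by rewrite /mzero hform_scale ev0 mul0r. Qed.

Lemma hform_comb_ge0 ls Gs x : all (Z.leb 0) ls ->
  {in Gs, forall G, 0 <= hform G x} -> 0 <= hform (comb ls Gs) x.
Proof.
rewrite /comb; elim: ls Gs => [|l ls IH] [|G Gs]; rewrite ?hform_mzero //.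
move=> /andP[/Z.leb_le l0 ls0] GP; rewrite [foldr _ _ _]/= hform_add hform_scale.
apply: addr_ge0.
  rewrite mulr_ge0 ?GP ?mem_head // zsqC -(rmorph0 (real_complex R)) lecR.
  by rewrite zR0 mul0r addr0 -zR0 zR_le.
by apply: IH => // G' G'P; apply: GP; rewrite inE G'P orbT.
Qed.

Lemma neg_certificateP ls Gs x : neg_certificate ls Gs -> x.2 != 0 ->
  {in Gs, forall G, 0 <= hform G x} -> False.
Proof.
move=> /andP[l0 pd] x0 /(hform_comb_ge0 l0) h; have := pdef_gt0 pd x0.
rewrite hform_scale zsqC (_ : zR (-1) + zR 0 * s3 = -1); last first.
  by rewrite zR0 mul0r addr0.
by rewrite rmorphN rmorph1 mulN1r oppr_gt0 => /lt_geF; rewrite h.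
Qed.

End Forms.

(** * Close neighbours of the base point *)

Definition jm := Mat zz z0 z0 z0 zz z0 z0 z0 z1.
Definition jVm := Mat (zpow 11) z0 z0 z0 (zpow 11) z0 z0 z0 z1.

(** Breadth-first search. Each unit of fuel treats one element, so 300 suffices for a group of order
    288. *)
Fixpoint mclosure (gens : seq mat) fuel (todo seen : seq mat) :=
  if fuel is n.+1 then
    if todo is x :: todo' then
      let new := undup [seq y <- [seq mmul g x | g <- gens] | y \notin seen] in
      mclosure gens n (todo' ++ new) (seen ++ new)
    else seen
  else seen.

(* the group generated by [u] and [v], which has order 288 *)
Fact Kl_key : {K | K = mclosure [:: um; vm] 300 [:: mid] [:: mid]}.
Proof. by eexists. Qed.
Definition Kl := sval Kl_key.
Lemma KlE : Kl = mclosure [:: um; vm] 300 [:: mid] [:: mid].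
Proof. exact: (svalP Kl_key). Qed.

(* [<< u, v >>] acts on the complex directions through the octahedral group.
   The functionals [uo] and [wo] are those of two opposite vertices; the four
   other vertices are the images of the first one under [v ^ m * octm], and
   their functionals are [(uo + 'i ^ m wo) / sqrt 2] up to a phase. *)
Definition octm := Mat (Z4 0 0 0 1) (Z4 0 1 (-1) 0) z0 z0 z1 z0 z0 z0 z1.
Definition octms :=
  [:: octm; mmul vm octm; mmul (mmul vm vm) octm; mmul (mmul vm (mmul vm vm)) octm].
Definition uform := outer z0 (Z4 0 0 (-1) (-1)) z0.
Definition wform := outer (Z4 (-1) (-1) 1 0) (Z4 (-1) (-1) 0 1) z0.
Definition eform := outer z0 z0 z1.
Definition mlin (ls : seq (z4 * mat)) :=
  foldr (fun lG => madd (mscale lG.1 lG.2)) mzero ls.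
(** Write X, Y, E, h for the squared absolute values of [uo x], [wo x], x_3 and the third entry of
    [x b]. This form is [X - (2 + sqrt 3) Y], as in [octahedron_vertex], and [chord_form] is the
    first bound of [hub_bounds], the difference of its two sides. *)
Definition vertex_form := mlin [:: (z1, uform); (zsq (-2) (-1), wform)].
Definition chord_form := mlin
  [:: (zsq 8 0, uform); (zsq 16 8, eform); (zsq (-8) 0, outer3 bm);
      (zsq (-10) (-5), eform); (zsq (-6) (-3), uform)].

Definition is_block M :=
  let: Mat a b c d e f g h k := M in
  [&& c == z0, f == z0, g == z0, h == z0 & k == z1].

Lemma Kl_size : size Kl = 288. Proof. by rewrite KlE; vm_compute. Qed.
Lemma Kl_block : all is_block Kl. Proof. by rewrite KlE; vm_compute. Qed.
Lemma Kl_unim : all unim Kl. Proof. by rewrite KlE; vm_compute. Qed.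
Lemma Kl_id : mid \in Kl. Proof. by rewrite KlE; vm_compute. Qed.
Definition closed_under (K gs : seq mat) :=
  all (fun k => all (fun g => mmul k g \in K) gs) K.
Lemma Kl_closed : closed_under Kl (jm :: jVm :: um :: vm :: octms).
Proof. by rewrite KlE; vm_compute. Qed.

Lemma ex_max (R : realType) (T : eqType) (f : T -> R) (s : seq T) : s != [::] ->
  exists2 x, x \in s & {in s, forall y, f y <= f x}.
Proof.
elim: s => [//|a [|b s] IH] _; first by exists a; rewrite ?mem_head // => y; rewrite inE => /eqP->.
have [//|x xs xP] := IH; have [le_ax|/ltW le_xa] := leP (f a) (f x).
  by exists x => [|y]; rewrite inE ?xs ?orbT // => /predU1P[->|/xP].
exists a => [|y]; rewrite ?mem_head // inE => /predU1P[->//|/xP le_yx].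
exact: le_trans le_xa.
Qed.

Lemma sq_le_sq (R : realType) (a b : R) : a <= b -> - a <= b -> a * a <= b * b.
Proof.
move=> h1 h2; rewrite -subr_ge0 (_ : _ - _ = (b - a) * (b + a)); last by ring.
by apply: mulr_ge0; lra.
Qed.

(** Here X = |u|^2, Y = |w|^2 and [P + i Q] is twice the product of u with the conjugate of w.
    Adding the bounds on P^2 and Q^2 gives [X^2 - 4 X Y + Y^2 >= 0], whose roots X / Y are [2 + s]
    and [2 - s]; as [Y <= X], only the upper range remains. *)
Lemma octahedron_vertex (R : realType) (s X Y P Q : R) :
  s * s = 3 -> 19 / 11 < s -> s < 26 / 15 -> 0 <= X -> 0 <= Y ->
  P <= X - Y -> - P <= X - Y -> Q <= X - Y -> - Q <= X - Y ->
  P * P + Q * Q = 4 * (X * Y) -> (2 + s) * Y <= X.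
Proof.
move=> s2 sl su X0 Y0 P1 P2 Q1 Q2 PQ.
have P3 := sq_le_sq P1 P2; have Q3 := sq_le_sq Q1 Q2.
have K : 0 <= X * X - 4 * (X * Y) + Y * Y by lra.
rewrite leNgt; apply/negP => lt_X; have YX : Y <= X by lra.
have s20 : 0 < 2 + s by lra.
have Yp : 0 < Y.
  by rewrite -(pmulr_rgt0 _ s20); apply: le_lt_trans lt_X.
have h1 : 0 < s * Y - (X - 2 * Y) by lra.
have h2 : 0 < s * Y + (X - 2 * Y).
  have : 0 < (s - 1) * Y by apply: mulr_gt0; lra.
  by move=> *; lra.
have := mulr_gt0 h1 h2; rewrite (_ : (s * Y - _) * _ = s * s * (Y * Y) - (X - 2 * Y) * (X - 2 * Y)).
  by rewrite s2 => *; lra.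
by ring.
Qed.

(* The two linear inequalities say that the argument of [w] differs from [pi] by
   at most [pi / 12]; this bounds [- w1] below by a multiple of [sqrt (X E)],
   which is concave in [X] and thus above its chord. *)
Lemma hub_bounds (R : realType) (s X Y E w1 w2 : R) :
  s * s = 3 -> 19 / 11 < s -> s < 26 / 15 -> 0 <= X -> 0 <= Y -> 0 < E ->
  (1 + s) * E / 2 <= X + Y -> X + Y <= (1 + s) * E -> (2 + s) * Y <= X ->
  w1 * w1 + w2 * w2 = X * ((2 + s) * E) ->
  w1 <= s / 2 * w1 - w2 / 2 -> w1 <= s / 2 * w1 + w2 / 2 ->
  let h := X + (2 + s) * E + 2 * w1 in
  (2 + s) * (5 * E + 3 * X) <= 8 * X + 8 * (2 + s) * E - 8 * h /\
  h <= 49 / 50 * E.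
Proof.
move=> s2 sl su X0 Y0 E0 T1 T2 XY wn wa wb.
have Yl : Y <= (2 - s) * X.
  have : (2 - s) * ((2 + s) * Y) <= (2 - s) * X by apply: ler_wpM2l => //; lra.
  rewrite (_ : (2 - s) * _ = (4 - s * s) * Y); last by ring.
  by rewrite s2 => *; lra.
(* This margin between X and E is what turns the chord bound into the factor 49/50. *)
have Xl : 53 / 50 * E <= X.
  have : (3 - s) * X <= (14 / 11) * X by apply: ler_wpM2r => //; lra.
  have : (30 / 11) * E <= (1 + s) * E by apply: ler_wpM2r; lra.
  by move=> *; lra.
have Xu : X <= 25 / 9 * E.
  have : (1 + s) * E <= (41 / 15) * E by apply: ler_wpM2r; lra.
  by move=> *; lra.
pose A := - w1; have wA : w1 = - A by rewrite opprK.
(* [2 - sqrt 3] is the tangent of [pi / 12]. *)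
have A1 : w2 <= (2 - s) * A by rewrite /A; lra.
have A2 : - w2 <= (2 - s) * A by rewrite /A; lra.
have s20 : 0 < 2 - s by lra.
have A0 : 0 <= A by rewrite -(pmulr_rge0 _ s20); lra.
have A3 := sq_le_sq A1 A2.
have A4 : (2 + s) ^+ 2 * (X * E) <= (2 * A) ^+ 2.
  have : (2 + s) * (w1 * w1 + w2 * w2) <=
         (2 + s) * (A * A + (2 - s) * A * ((2 - s) * A)).
    by apply: ler_wpM2l; [lra|rewrite wA mulrNN; lra].
  rewrite wn (_ : (2 + s) * (A * A + _) =
     (2 + s + (2 - s) * (4 - s * s)) * (A * A)); last by ring.
  rewrite s2 (_ : (2 + s) * _ = (2 + s) ^+ 2 * (X * E)); last by ring.
  by rewrite (_ : (2 * A) ^+ 2 = 4 * (A * A)); [move=> *; lra|ring].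
(* The chord meets the graph of [sqrt (X E)] at X = E and X = 25/9 E, where the root is rational;
   [Xl] and [Xu] place X between them. *)
have A5 : ((5 * E + 3 * X) / 8) ^+ 2 <= X * E.
  have : 0 <= (X - E) * (25 * E - 9 * X) by apply: mulr_ge0; lra.
  rewrite (_ : (_ / 8) ^+ 2 = (25 * (E * E) + 30 * (X * E) + 9 * (X * X)) / 64).
    by move=> *; lra.
  by field.
have A6 : (2 + s) * ((5 * E + 3 * X) / 8) <= 2 * A.
  rewrite -ler_sqr ?nnegrE; try by apply: mulr_ge0; lra.
  by apply: le_trans A4; rewrite exprMn ler_wpM2l // sqr_ge0.
split; first by rewrite wA; lra.
have : (X - E) * (3 / 8 * (41 / 11)) <= (X - E) * (3 / 8 * (2 + s)).
  by apply: ler_wpM2l; lra.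
by rewrite wA => *; lra.
Qed.

Section Hub.
Variable R : realType.
Local Notation C := R[i].
Local Notation z := (zeta R).
Local Notation ev := (@ev R).
Local Notation s3 := (s3 R).
Local Notation vec := (vec R).
Implicit Types x : vec.

Definition nC (w : C) : R := let: (a +i* b)%C := w in a * a + b * b.

Lemma nCE (w : C) : w * w^* = (nC w)%:C%C.
Proof.
by case: w => a b; apply/eqP; rewrite eq_complex /=; apply/andP; split;
  apply/eqP; ring.
Qed.
Lemma nC_ge0 (w : C) : 0 <= nC w.
Proof. by case: w => a b; rewrite /= addr_ge0 // -expr2 sqr_ge0. Qed.
Lemma nC_gt0 (w : C) : w != 0 -> 0 < nC w.
Proof.
move=> w0; rewrite -ltcR -nCE.
by rewrite (rmorph0 (real_complex R)) mul_conjC_gt0.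
Qed.
Lemma nCM (v w : C) : nC (v * w) = nC v * nC w.
Proof. by case: v => a b; case: w => c d /=; ring. Qed.

Lemma zetaE : z = ((s3 / 2) +i* (1 / 2))%C.
Proof.
have two : (2 : C) != 0 by rewrite pnatr_eq0.
apply: (mulfI two); transitivity (rr R + z ^+ 3); first by rewrite /rr; ring.
rewrite rrC zeta3; apply/eqP; rewrite eq_complex /=; apply/andP; split;
  by apply/eqP; field.
Qed.

(** [uo] is what the first two coordinates contribute to the third entry of [x b], and [cc] is the
    last entry of [b]. [wo] completes [uo] to a diagonalization of the definite part of [Fim], see
    [nC_uo_wo]. *)
Definition uo x : C := x.1.2 * ev (Z4 0 0 (-1) (-1)).
Definition wo x : C := x.1.1 * ev (Z4 (-1) (-1) 1 0) + x.1.2 * ev (Z4 (-1) (-1) 0 1).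
Definition cc : C := ev (Z4 1 1 0 (-1)).

Definition evs := (zrm1, zrm2, zr0, zr1, zr2).

Lemma nC_uo_wo x :
  (1 + rr R) * (x.2 * x.2^* - hform Fim x) = uo x * (uo x)^* + wo x * (wo x)^*.
Proof.
case: x => [[x1 x2] x3]; rewrite /uo /wo /=.
rewrite !evsq !ev0 !ev1 /ev !evs /rr.
rewrite !(rmorphD, rmorphM, rmorphN, rmorphXn, rmorph1, rmorph0) /= !zetaJ.
have h := zeta4 R; ring: h.
Qed.

Lemma mirror m x : (m < 4)%N ->
  2 * uo (vmul x (nth mid octms m)) = (1 + z ^+ 3) * (uo x + z ^+ (3 * m) * wo x).
Proof.
have h := zeta4 R; case: x => [[x1 x2] x3].
case: m => [|[|[|[|//]]]] _; vm_compute nth; rewrite /uo /wo /=;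
  rewrite /ev !evs; ring: h.
Qed.

Lemma nC_zeta : nC z = 1.
Proof. by have s2 := s3_sqr R; rewrite zetaE /= mulf_div s2; field. Qed.

Lemma vmul_bm x : (vmul x bm).2 = uo x + x.2 * cc.
Proof. by case: x => [[x1 x2] x3]; rewrite /uo /cc /= ev0 mulr0 add0r. Qed.
Lemma vmul_diag s x : vmul x (Mat s z0 z0 z0 s z0 z0 z0 z1) =
  (ev s * x.1.1, ev s * x.1.2, x.2).
Proof. by case: x => [[x1 x2] x3]; rewrite /= ev0 ev1; congr (_, _, _); ring. Qed.
Lemma uo_jm x : uo (vmul x jm) = z * uo x.
Proof. by rewrite /jm vmul_diag evz /uo mulrA. Qed.
Lemma uo_jVm x : uo (vmul x jVm) = z^-1 * uo x.
Proof.
rewrite /jVm vmul_diag evX /uo mulrA; congr (_ * _ * _).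
have z12 := zeta12 R; have zU : z \is a GRing.unit.
  by rewrite unitfE; apply: contra_eq_neq z12 => ->; rewrite expr0n eq_sym oner_eq0.
by apply: (mulrI zU); rewrite divrr // -exprS.
Qed.
Lemma vmul_jm2 x : (vmul x jm).2 = x.2.
Proof. by rewrite /jm vmul_diag. Qed.
Lemma vmul_jVm2 x : (vmul x jVm).2 = x.2.
Proof. by rewrite /jVm vmul_diag. Qed.
Lemma vmul_Kl2 x k : k \in Kl -> (vmul x k).2 = x.2.
Proof.
move=> /(allP Kl_block); case: k => a b c d e f g h k.
case: x => [[x1 x2] x3] /= /and5P[/eqP-> /eqP-> _ _ /eqP->].
by rewrite ev0 ev1; ring.
Qed.

Lemma nC_cc : nC cc = 2 + s3.
Proof.
apply: (@complexI R); rewrite -nCE /cc -evJ -evM.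
by rewrite -[zmul _ _]/(zsq 2 1) zsqC zR1 mul1r.
Qed.

Lemma nCD (v w : C) : nC (v + w) = nC v + nC w + 2 * complex.Re (v * w^*).
Proof. by case: v => a b; case: w => c d /=; ring. Qed.

Lemma zeta3i : z ^+ 3 = (0 +i* 1)%C. Proof. exact: zeta3. Qed.

Lemma nC_mirror m x : (m < 4)%N ->
  2 * nC (uo (vmul x (nth mid octms m))) = nC (uo x + z ^+ (3 * m) * wo x).
Proof.
have n2 : nC 2 = 4.
  apply: (@complexI R); rewrite -nCE rmorph_nat (rmorph_nat (real_complex R)).
  by rewrite -natrM.
have n1i : nC (1 + z ^+ 3) = 2 by rewrite zeta3i /=; ring.
move=> m4; have := congr1 nC (mirror x m4); rewrite !nCM n2 n1i.
move: (nC _) (nC (_ + _)) => A B E; lra.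
Qed.

Lemma vertex_bound x :
  (forall m, (m < 4)%N -> nC (uo (vmul x (nth mid octms m))) <= nC (uo x)) ->
  (2 + s3) * nC (wo x) <= nC (uo x).
Proof.
move=> L; have [sl su] := andP (s3_bounds R).
have L' m : (m < 4)%N -> nC (uo x + z ^+ (3 * m) * wo x) <= 2 * nC (uo x).
  by move=> m4; rewrite -nC_mirror // ler_wpM2l // L.
have := L' 0%N isT; have := L' 1%N isT; have := L' 2%N isT; have := L' 3%N isT.
rewrite !exprM zeta3i; have := nC_ge0 (uo x); have := nC_ge0 (wo x).
case: (uo x) => a b; case: (wo x) => c d.
rewrite !exprS expr0 /= !(mul0r, mulr0, mul1r, mulr1, add0r, addr0, subr0, sub0r).
rewrite !(mulN1r, mulrN1, opprK, oppr0).
move=> Y0 X0 h3 h2 h1 h0.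
by apply: (@octahedron_vertex R s3 _ _ (2 * (a * c + b * d)) (2 * (b * c - a * d))
  (s3_sqr R) sl su) => //; lra.
Qed.

Lemma hform_mlin0 x : hform (mlin [::]) x = 0.
Proof. exact: hform_mzero. Qed.
Lemma hform_mlin s G ls x :
  hform (mlin ((s, G) :: ls)) x = ev s * hform G x + hform (mlin ls) x.
Proof. by rewrite -[LHS]/(hform (madd (mscale s G) (mlin ls)) x) hform_add hform_scale. Qed.
Lemma hform_uform x : hform uform x = (nC (uo x))%:C%C.
Proof.
case: x => [[x1 x2] x3]; rewrite /uform (hform_outer _ _ _ (x1, x2, x3)) ev0.
by rewrite !mulr0 add0r addr0 nCE.
Qed.
Lemma hform_wform x : hform wform x = (nC (wo x))%:C%C.
Proof.
case: x => [[x1 x2] x3]; rewrite /wform (hform_outer _ _ _ (x1, x2, x3)) ev0.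
by rewrite !mulr0 addr0 nCE.
Qed.
Lemma hform_eform x : hform eform x = (nC x.2)%:C%C.
Proof.
case: x => [[x1 x2] x3]; rewrite /eform (hform_outer _ _ _ (x1, x2, x3)) ev0 ev1.
by rewrite !mulr0 !add0r mulr1 nCE.
Qed.
Lemma hform_outer3E M x : hform (outer3 M) x = (nC (vmul x M).2)%:C%C.
Proof. by rewrite hform_outer3 nCE. Qed.
Definition hformE :=
  (hform_mlin, hform_mlin0, hform_uform, hform_wform, hform_eform, hform_outer3E).

Lemma zR_lits : ((zR R 2 = 2) * (zR R (-2) = -2) * (zR R (-1) = -1) *
  (zR R 8 = 8) * (zR R 16 = 16) * (zR R (-8) = -8) * (zR R (-10) = -10) *
  (zR R (-5) = -5) * (zR R (-6) = -6) * (zR R (-3) = -3) *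
  (zR R 0 = 0) * (zR R 1 = 1))%type.
Proof. by []. Qed.

(** Choose k with |uo (x k)| maximal and, among those, with the third entry of [x k b] minimal in
    absolute value. Maximality over [octms] gives [vertex_form]. Minimality against [j] and its
    inverse, which turn [uo] by a twelfth of a full turn and fix x_3, puts the phase within
    [pi / 12] of the best one. The hypothesis [|x_3|^2 >= 2 q] keeps x away from e_3; it holds for
    third rows of positive height and for distant eigenvectors alike. *)
Lemma hub_exists x : x.2 != 0 -> 0 <= hform Fim x ->
  0 <= x.2 * x.2^* - 2 * hform Fim x ->
  exists2 k, k \in Kl & let y := vmul x k in
    [/\ y.2 = x.2, 0 <= hform vertex_form y, 0 <= hform chord_form y
      & nC (vmul y bm).2 <= 49 / 50 * nC x.2].
Proof.
move=> x0 q0 q1; have Kl0 : Kl != [::] by rewrite -size_eq0 Kl_size.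
have [k0 Kk0 Xmax] := ex_max (fun k => nC (uo (vmul x k))) Kl0.
(* The ties of the first criterion; [j] and its inverse stay among them. *)
pose best := [seq k <- Kl | nC (uo (vmul x k)) == nC (uo (vmul x k0))].
have kb : k0 \in best by rewrite mem_filter eqxx.
have best0 : best != [::] by apply/eqP => E; rewrite E in kb.
have [k] := ex_max (fun k => - nC (vmul (vmul x k) bm).2) best0.
rewrite mem_filter => /andP[/eqP Xk Kk] hmin; exists k => //.
set y := vmul x k; have y2 : y.2 = x.2 by rewrite vmul_Kl2.
have y0 : y.2 != 0 by rewrite y2.
have clos g : g \in jm :: jVm :: um :: vm :: octms -> mmul k g \in Kl.
  by move: g; apply/allP; move: k Kk {Xk hmin y y2 y0}; apply/allP/Kl_closed.
have Xy g : g \in jm :: jVm :: um :: vm :: octms -> nC (uo (vmul y g)) <= nC (uo y).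
  by move=> /clos Kg; rewrite vmulA Xk Xmax.
have hy g : g \in jm :: jVm :: um :: vm :: octms -> nC (uo (vmul y g)) = nC (uo y) ->
    nC (vmul y bm).2 <= nC (vmul (vmul y g) bm).2.
  move=> /clos Kg Xg; have gb : mmul k g \in best.
    by rewrite mem_filter Kg -vmulA Xg Xk eqxx.
  by have := hmin _ gb; rewrite lerN2 -vmulA.
have XY : (2 + s3) * nC (wo y) <= nC (uo y).
  apply: vertex_bound => m m4; apply: Xy.
  by rewrite -[_ :: _]/([:: jm; jVm; um; vm] ++ octms) mem_cat mem_nth ?orbT.
have [sl su] := andP (s3_bounds R).
have q2 : hform Fim y = hform Fim x by rewrite hform_Fim // (allP Kl_unim).
rewrite -q2 -y2 in q0 q1 x0 *.
have rC : 1 + rr R = (1 + s3)%:C%C by rewrite rrC rmorphD rmorph1.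
have r0 : 0 < 1 + rr R by rewrite rC -(rmorph0 (real_complex R)) ltcR; lra.
have T := nC_uo_wo y; rewrite !nCE rC -rmorphD in T.
have T1 : nC (uo y) + nC (wo y) <= (1 + s3) * nC y.2.
  rewrite -lecR -T (rmorphM (real_complex R)) /= -rC -nCE ler_pM2l //.
  by rewrite -subr_ge0 opprB addrC addrNK.
have T2 : (1 + s3) * nC y.2 / 2 <= nC (uo y) + nC (wo y).
  rewrite ler_pdivrMr // -lecR !(rmorphM (real_complex R)) /= -T -rC -nCE.
  rewrite (rmorph_nat (real_complex R)) -mulrA ler_pM2l // -subr_ge0.
  by rewrite (_ : _ - _ = y.2 * y.2^* - 2 * hform Fim y) //; ring.
have E0 := nC_gt0 x0.
pose w := uo y * (y.2 * cc)^*.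
have nw : nC w = nC (uo y) * ((2 + s3) * nC y.2).
  rewrite nCM; congr (_ * _); apply: (@complexI R).
  by rewrite -nCE conjCK mulrC nCE nCM nC_cc mulrC.
have h0 : nC (vmul y bm).2 = nC (uo y) + (2 + s3) * nC y.2 + 2 * complex.Re w.
  by rewrite vmul_bm nCD nCM nC_cc [nC y.2 * _]mulrC.
have h1 : nC (vmul (vmul y jm) bm).2 =
    nC (uo y) + (2 + s3) * nC y.2 + 2 * complex.Re (z * w).
  rewrite vmul_bm vmul_jm2 uo_jm nCD !nCM nC_zeta nC_cc mul1r [nC y.2 * _]mulrC.
  by congr (_ + 2 * complex.Re _); rewrite /w mulrA.
have nV : nC z^-1 = 1.
  rewrite zetaV -zetaJ zetaE /= mulf_div; have s2 := s3_sqr R.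
  by rewrite mulrNN mulf_div s2; field.
have h2 : nC (vmul (vmul y jVm) bm).2 =
    nC (uo y) + (2 + s3) * nC y.2 + 2 * complex.Re (z^-1 * w).
  rewrite vmul_bm vmul_jVm2 uo_jVm nCD !nCM nV nC_cc mul1r [nC y.2 * _]mulrC.
  by congr (_ + 2 * complex.Re _); exact: esym (mulrA _ _ _).
have Xj : nC (uo (vmul y jm)) = nC (uo y) by rewrite uo_jm nCM nC_zeta mul1r.
have XjV : nC (uo (vmul y jVm)) = nC (uo y) by rewrite uo_jVm nCM nV mul1r.
have k1 := hy jm (mem_head _ _) Xj.
have k2 : nC (vmul y bm).2 <= nC (vmul (vmul y jVm) bm).2.
  by apply: hy XjV; rewrite in_cons mem_head orbT.
rewrite h0 h1 in k1; rewrite h0 h2 in k2.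
have [] := @hub_bounds R s3 (nC (uo y)) (nC (wo y)) (nC y.2) (complex.Re w)
  (complex.Im w) (s3_sqr R) sl su (nC_ge0 _) (nC_ge0 _) E0 T2 T1 XY.
- by rewrite -nw; case: (w) => a b.
- by move: k1; rewrite zetaE; case: (w) => a b /=; lra.
- by move: k2; rewrite zetaV -zetaJ zetaE; case: (w) => a b /=; lra.
rewrite -h0 => ch hub; split=> //.
- rewrite /vertex_form !hformE ev1 !zsqC -(rmorph1 (real_complex R)).
  rewrite -!(rmorphM (real_complex R)) -(rmorph0 (real_complex R)).
  by rewrite -!(rmorphD (real_complex R)) lecR !zR_lits; lra.
- rewrite /chord_form !hformE !zsqC.
  rewrite -!(rmorphM (real_complex R)) -(rmorph0 (real_complex R)).
  by rewrite -!(rmorphD (real_complex R)) lecR !zR_lits; lra.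
Qed.

End Hub.

(** * Links between neighbours *)

Delimit Scope Z_scope with BZ.

(* [has] with early exit under call by value *)
Fixpoint lazy_has (T : Type) (p : T -> bool) s :=
  if s is x :: s' then if p x then true else lazy_has p s' else false.
Lemma lazy_hasE (T : Type) (a : pred T) s : lazy_has a s = has a s.
Proof. by elim: s => //= x s ->; case: (a x). Qed.

Definition mopp M := mscale (zsq (-1) 0) M.
(** Nonnegative at third rows of positive height: there [Fim] takes the value 1 and |x_3|^2 is at
    least [2 + sqrt 3], the inverse of [2 - sqrt 3]. *)
Definition near_form := mlin [:: (zsq 2 (-1), eform); (zsq (-1) 0, Fim)].
Definition lower_form M := madd eform (mopp (outer3 M)).
Definition higher_form M := madd (outer3 M) (mopp eform).

Definition adj M N := (ht (mmul (minv M) N) <= 1)%N.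
Definition hub_forms := [:: Fim; near_form; vertex_form; chord_form].
(* Multipliers for [hub_forms] and [lower_form M], found numerically. *)
Definition multipliers : seq (seq Z) := [:: [:: 0; 0; 1; 1; 5]; [:: 3; 0; 1; 0; 3]]%BZ.
(** In order: the four [hub_forms], [lower_form M], and [higher_form] of three candidate links. *)
Definition link_multipliers : seq Z := [:: 0; 3; 2; 1; 9; 6; 6; 3]%BZ.
Definition hub_neighbours :=
  [seq mmul (nth mid Kl i) bm | i <- [:: 1; 3; 4; 7; 8; 9; 15; 19; 28; 72]%N].

Definition lower_excluded M :=
  lazy_has (fun ls => neg_certificate ls (rcons hub_forms (lower_form M))) multipliers.
Definition linked_certificate nbrs M :=
  let ts := [seq t <- nbrs | adj M t] in
  lazy_has (fun t1 => lazy_has (fun t2 => lazy_has (fun t3 =>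
    neg_certificate link_multipliers
      (hub_forms ++ lower_form M :: [:: higher_form t1; higher_form t2; higher_form t3]))
    ts) ts) ts.

Definition link_check nbrs k := let M := mmul k bm in
  if adj M bm then true else if lower_excluded M then true
  else linked_certificate nbrs M.

Lemma hub_neighboursP :
  all (fun M => (adj M bm) && has (fun k => M == mmul k bm) Kl) hub_neighbours.
Proof. by rewrite /hub_neighbours KlE; vm_compute. Qed.
Lemma link_checkP : all (link_check hub_neighbours) Kl.
Proof. by rewrite /hub_neighbours KlE; vm_compute. Qed.

Section Link.
Variable R : realType.
Local Notation C := R[i].
Local Notation vec := (vec R).
Local Notation nC := (@nC R).
Local Notation s3 := (s3 R).

Lemma hform_mopp G (x : vec) : hform (mopp G) x = - hform G x.
Proof.
by rewrite /mopp hform_scale zsqC !zR_lits mul0r addr0 rmorphN rmorph1 mulN1r.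
Qed.

Lemma hform_lower M (x : vec) :
  (0 <= hform (lower_form M) x) = (nC (vmul x M).2 <= nC x.2).
Proof.
by rewrite /lower_form hform_add hform_mopp hform_eform hform_outer3E subr_ge0 lecR.
Qed.
Lemma hform_higher M (x : vec) :
  (0 <= hform (higher_form M) x) = (nC x.2 <= nC (vmul x M).2).
Proof.
by rewrite /higher_form hform_add hform_mopp hform_eform hform_outer3E subr_ge0 lecR.
Qed.

(** A certificate either excludes that [k b] is not farther than the base point, or excludes that
    three common neighbours of [k b] and [b] are all at least as far as the base point; in the
    second case one of them is strictly closer. *)
Lemma hub_link (y : vec) k : k \in Kl -> y.2 != 0 ->
  {in hub_forms, forall G, 0 <= hform G y} ->
  nC (vmul y (mmul k bm)).2 <= nC y.2 ->
  adj (mmul k bm) bm \/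
  exists M, [/\ M \in hub_neighbours, adj (mmul k bm) M
              & nC (vmul y M).2 < nC y.2].
Proof.
move=> Kk y0 hubP low; have := allP link_checkP k Kk; rewrite /link_check.
case: ifP => [a _|_]; first by left.
rewrite /lower_excluded lazy_hasE; case: ifP => [/hasP[ls _ c] _|_].
  case: (neg_certificateP c y0) => G; rewrite mem_rcons inE => /predU1P[->|/hubP//].
  by rewrite hform_lower.
set M := mmul k bm in low *; rewrite /linked_certificate !lazy_hasE => linked; right.
move: linked => /hasP[t1 m1]; rewrite lazy_hasE => /hasP[t2 m2].
rewrite lazy_hasE => /hasP[t3 m3 c].
have E t : t \in [seq t <- hub_neighbours | adj M t] ->
    t \in hub_neighbours /\ adj M t by rewrite mem_filter => /andP[].
have [n1 a1] := E _ m1; have [n2 a2] := E _ m2; have [n3 a3] := E _ m3.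
have [h1|h1] := ltP (nC (vmul y t1).2) (nC y.2); first by exists t1.
have [h2|h2] := ltP (nC (vmul y t2).2) (nC y.2); first by exists t2.
have [h3|h3] := ltP (nC (vmul y t3).2) (nC y.2); first by exists t3.
case: (neg_certificateP c y0) => G; rewrite mem_cat => /orP[/hubP//|].
rewrite in_cons => /predU1P[->|]; first by rewrite hform_lower.
rewrite in_cons => /predU1P[->|]; first by rewrite hform_higher.
rewrite in_cons => /predU1P[->|]; first by rewrite hform_higher.
by rewrite in_cons => /predU1P[->|//]; rewrite hform_higher.
Qed.

End Link.

(** * Elements of height 0 *)

(** The sesquilinear form of F^-1 on two rows; the rows of a unitary matrix have Gram matrix
    F^-1. *)
Definition row_form x y k x' y' k' :=
  zadd (zadd (zmul (zadd (zmul x (zsq 1 (-1))) (zopp y)) (zconj x'))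
             (zmul (zadd (zopp x) (zmul y (zsq (-1) (-1)))) (zconj y')))
       (zmul k (zconj k')).

Definition zbox : seq z4 :=
  let l := [:: -2; -1; 0; 1; 2]%BZ in
  flatten [seq flatten [seq flatten [seq [seq Z4 a b c d | d <- l] | c <- l] | b <- l] | a <- l].
Definition zsmall := [seq x <- zbox | Z.leb (nsqx x) 4].
Definition zsmall_pairs q :=
  flatten [seq [seq (x, y) | y <- zsmall & row_form x y z0 x y z0 == q] | x <- zsmall].

Definition block_check (Ks : seq mat) rows1 rows2 :=
  all (fun r1 => all (fun r2 =>
    if row_form r1.1 r1.2 z0 r2.1 r2.2 z0 == zsq (-1) 0 then
      Mat r1.1 r1.2 z0 r2.1 r2.2 z0 z0 z0 z1 \in Ks else true) rows2) rows1.
Lemma block_checkP :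
  block_check Kl (zsmall_pairs (zsq 1 (-1))) (zsmall_pairs (zsq (-1) (-1))).
Proof. by rewrite KlE; vm_compute. Qed.

Definition unit_check :=
  all (fun x => if nsq x == z1 then has (fun n => zmul (zpow n) x == z1) (iota 0 12)
    else true) zbox.
Lemma unit_checkP : unit_check.
Proof. by vm_compute. Qed.

(** [nsqx] is [a^2 + a c + c^2 + b^2 + b d + d^2], and [4 (a^2 + a c + c^2) = 3 a^2 + (a + 2 c)^2],
    so each coefficient has square at most 16/3. *)
Lemma zsmallP x : Z.le (nsqx x) 4 -> x \in zsmall.
Proof.
move=> le4; rewrite mem_filter (introT (Z.leb_spec0 _ _) le4) /=.
case: x le4 => a b c d; rewrite /nsqx /nsq /zmul /zconj => le4.
have E : Z.le (a * a + a * c + c * c + (b * b + b * d + d * d)) 4 by lia.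
have m t : Z.le (t * t) 5 -> t \in [:: -2; -1; 0; 1; 2]%BZ.
  move=> ?; have [? ?] : (Z.le (-2) t /\ Z.le t 2) by nia.
  have : (t = -2 \/ t = -1 \/ t = 0 \/ t = 1 \/ t = 2)%BZ by lia.
  by case=> [->|[->|[->|[->|->]]]].
have [ma mb mc md] : [/\ a \in [:: -2; -1; 0; 1; 2]%BZ, b \in [:: -2; -1; 0; 1; 2]%BZ,
    c \in [:: -2; -1; 0; 1; 2]%BZ & d \in [:: -2; -1; 0; 1; 2]%BZ].
  have [? ?] := (Z.square_nonneg (a + 2 * c), Z.square_nonneg (2 * a + c)).
  have [? ?] := (Z.square_nonneg (b + 2 * d), Z.square_nonneg (2 * b + d)).
  have [? ?] := (Z.square_nonneg a, Z.square_nonneg b).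
  have [? ?] := (Z.square_nonneg c, Z.square_nonneg d).
  by split; apply: m; lia.
apply/flatten_mapP; exists a => //; apply/flatten_mapP; exists b => //.
by apply/flatten_mapP; exists c => //; apply: map_f.
Qed.

Opaque zbox.

Section Stabilizer.
Variable R : realType.
Local Notation C := R[i].
Local Notation z := (zeta R).
Local Notation ev := (@ev R).
Local Notation s3 := (s3 R).
Local Notation zR := (zR R).

Lemma unim_rows a b c d e f g h k :
  unim (Mat a b c d e f g h k) ->
  [/\ row_form a b c a b c = zsq 1 (-1), row_form d e f d e f = zsq (-1) (-1),
      row_form a b c d e f = zsq (-1) 0, row_form a b c g h k = z0
    & row_form d e f g h k = z0].
Proof.
move=> /(unim_Fim R) E; rewrite /Fim in E.
have := congr1 (fun M => let: Mat x _ _ _ _ _ _ _ _ := M in x) E.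
have := congr1 (fun M => let: Mat _ x _ _ _ _ _ _ _ := M in x) E.
have := congr1 (fun M => let: Mat _ _ x _ _ _ _ _ _ := M in x) E.
have := congr1 (fun M => let: Mat _ _ _ _ x _ _ _ _ := M in x) E.
have := congr1 (fun M => let: Mat _ _ _ _ _ x _ _ _ := M in x) E.
rewrite /= => E6 E5 E3 E2 E1.
split; [rewrite -E1|rewrite -E5|rewrite -E2|rewrite -E3|rewrite -E6];
  by apply: (@ev_inj R); rewrite /row_form /dot3 !evE !zsqC; ring.
Qed.

(** Each difference of the two sides is a norm, for either sign of [t]. *)
Lemma row_form_le t (x y V : C) : t * t = 3 -> t^* = t ->
  (t - 1) * (x * x^*) + (y * x^* + x * y^*) + (1 + t) * (y * y^*) = V ->
  x * x^* <= (1 + t) * V /\ y * y^* <= (t - 1) * V.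
Proof.
move=> t2 tJ <-; split; rewrite -subr_ge0.
  rewrite (_ : _ - _ = (x + (1 + t) * y) * (x + (1 + t) * y)^*) ?mul_conjC_ge0 //.
  by rewrite !(rmorphD, rmorphM, rmorph1) /= tJ; ring: t2.
rewrite (_ : _ - _ = ((t - 1) * x + y) * ((t - 1) * x + y)^*) ?mul_conjC_ge0 //.
by rewrite !(rmorphD, rmorphM, rmorphB, rmorphN, rmorph1) /= tJ; ring: t2.
Qed.

Lemma ev_nsq x : ev (nsq x) = ev x * (ev x)^*.
Proof. by rewrite /nsq !evE. Qed.
Lemma ev_nsq_trace x :
  ev x * (ev x)^* + ev (zsig x) * (ev (zsig x))^* = (2 * zR (nsqx x))%:C%C.
Proof.
rewrite -!ev_nsq -[nsq (zsig x)]/(zmul (zsig x) (zconj (zsig x))) -zsigJ -zsigM.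
rewrite -/(nsq x) nsqE zsig_zsq !zsqC -(rmorphD (real_complex R)).
by congr (_%:C)%C; rewrite (_ : zR (- nsqy x) = - zR (nsqy x));
  [ring|rewrite /zR !rmorphN].
Qed.

Lemma rrJ : (rr R)^* = rr R.
Proof. by apply/CrealP; rewrite gtr0_real // rr_gt0. Qed.

Lemma nonneg_form_eq0 t (x y : C) : t * t = 3 -> t^* = t -> 1 + t != 0 ->
  (t - 1) * (x * x^*) + (y * x^* + x * y^*) + (1 + t) * (y * y^*) = 0 ->
  x = 0 /\ y = 0.
Proof.
move=> t2 tJ t0 /(row_form_le t2 tJ)[]; rewrite !mulr0.
have E (w : C) : w * w^* <= 0 -> w = 0.
  move=> h; apply/eqP; rewrite -mul_conjC_eq0; apply/eqP.
  by apply: le_anti; rewrite h mul_conjC_ge0.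
by move=> /E-> /E->.
Qed.

Lemma row_formE x y k : ev (row_form x y k x y k) =
  - ((rr R - 1) * (ev x * (ev x)^*) + (ev y * (ev x)^* + ev x * (ev y)^*)
     + (1 + rr R) * (ev y * (ev y)^*)) + ev k * (ev k)^*.
Proof. by rewrite /row_form !evE !evsq !zrE !zrm1; ring. Qed.
Lemma row_formE' x y k : ev (zsig (row_form x y k x y k)) =
  - ((- rr R - 1) * (ev (zsig x) * (ev (zsig x))^*)
     + (ev (zsig y) * (ev (zsig x))^* + ev (zsig x) * (ev (zsig y))^*)
     + (1 - rr R) * (ev (zsig y) * (ev (zsig y))^*)) + ev (zsig k) * (ev (zsig k))^*.
Proof.
rewrite /row_form !(zsigD, zsigM, zsigN, zsigJ, zsig_zsq) !evE !evsq !zrE !zrm1.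
by ring.
Qed.

(** The sum of the bounds [row_form_le] for the two embeddings: [sqrt 3] cancels and [2 * nsqx]
    appears as a trace. *)
Lemma row_small x y p q : row_form x y z0 x y z0 = zsq p q ->
  2 * zR (nsqx x) <= - (2 * zR p) - 6 * zR q /\
  2 * zR (nsqx y) <= 2 * zR p - 6 * zR q.
Proof.
move=> E; have t2 := rr2 R; have tJ := rrJ.
have := congr1 ev E; rewrite row_formE ev0 mul0r addr0 => /(canRL opprK) E1.
have := congr1 (fun x => ev (zsig x)) E.
rewrite row_formE' ev0 mul0r addr0 => /(canRL opprK) E2.
have t2' : - rr R * - rr R = 3 by rewrite mulrNN.
have tJ' : (- rr R)^* = - rr R by rewrite rmorphN /= tJ.
have [A1 A2] := row_form_le t2 tJ E1; have [B1 B2] := row_form_le t2' tJ' E2.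
have := lerD A1 B1; have := lerD A2 B2; rewrite !ev_nsq_trace.
rewrite zsig_zsq !zsqC rrC (_ : zR (- q) = - zR q); last by rewrite /zR !rmorphN.
have s2 := s3_sqr R; rewrite -(rmorph1 (real_complex R)).
pose rC := real_complex R.
rewrite -!(rmorphN rC, rmorphD rC, rmorphM rC) !lecR.
move: (zR p) (zR q) (zR (nsqx x)) (zR (nsqx y)) s3 s2.
move=> P Q X Y s s2 h2 h1.
have sQ : s * s * Q = 3 * Q by rewrite s2.
by split; lra.
Qed.

Lemma unim_scale n M : n \in iota 0 12 -> unim M -> unim (mscale (zpow n) M).
Proof.
move=> n12 uM; have -> : mscale (zpow n) M = mmul (mscale (zpow n) mid) M.
  by apply: (@evm_inj R); rewrite evm_mul !evm_scale evm_id mulmx1.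
apply: unim_mul => //; move: n n12; apply/allP.
by vm_compute.
Qed.

(** Height 0 means |k| = 1, so the definite form kills g and h, and orthogonality of the rows kills
    c and f. The entry k is an algebraic integer of norm 1 and hence a power of [zeta], which is
    scaled away. The rows of the remaining 2 x 2 block are bounded in both embeddings, and the
    finitely many candidates have been compared with [Kl]. *)
Lemma ht0_Kl M : unim M -> ht M = 0%N -> exists2 k, k \in Kl & peq M k.
Proof.
case: M => a b c d e f g h k uM hM.
have k1 : nsq k = z1.
  apply: (@ev_inj R); rewrite -[k]/(m33 (Mat a b c d e f g h k)) hvE.
  by rewrite (hv_ht0 _ uM) ?ev1 ?rmorph1.
have k0 : ev k * (ev k)^* = 1 by rewrite -ev_nsq k1 ev1.
have [E1 E2 E3 E4 E5] := unim_rows uM.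
have [g0 h0] : g = z0 /\ h = z0.
  have := unim_q3 R uM; rewrite -[q3 _ _ _]/(row_form g h k g h k).
  move=> /(congr1 ev); rewrite row_formE k0 ev1; set W := (X in - X + 1) => E.
  have W0 : W = 0 by apply/eqP; rewrite -oppr_eq0 -(inj_eq (addIr 1)) E add0r.
  have [|x0 y0] := nonneg_form_eq0 (rr2 R) rrJ _ W0.
    by rewrite gt_eqF // addr_gt0 // rr_gt0.
  by split; apply: (@ev_inj R); rewrite ev0.
subst g h.
have kJ0 : (ev k)^* != 0 by apply: contra_eq_neq k0 => ->; rewrite mulr0 eq_sym oner_eq0.
have c0 : c = z0.
  apply: (@ev_inj R); apply: (mulIf kJ0); rewrite ev0 mul0r.
  have := congr1 ev E4; rewrite /row_form !evE !rmorph0 => E; rewrite -[RHS]E.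
  by ring.
have f0 : f = z0.
  apply: (@ev_inj R); apply: (mulIf kJ0); rewrite ev0 mul0r.
  have := congr1 ev E5; rewrite /row_form !evE !rmorph0 => E; rewrite -[RHS]E.
  by ring.
subst c f.
have le4 n : 2 * zR n <= 8 -> Z.le n 4.
  move=> h; have : zR n <= zR 4 by rewrite (_ : zR 4 = 4) //; lra.
  by rewrite /zR ler_int; lia.
have small x y p q : row_form x y z0 x y z0 = zsq p q ->
    - (2 * zR p) - 6 * zR q <= 8 -> 2 * zR p - 6 * zR q <= 8 ->
    (x, y) \in zsmall_pairs (zsq p q).
  move=> E h1 h2; have [e1 e2] := row_small E.
  have sx : x \in zsmall by apply/zsmallP/le4/(le_trans e1).
  have sy : y \in zsmall by apply/zsmallP/le4/(le_trans e2).
  by apply/flatten_mapP; exists x => //; apply: map_f; rewrite mem_filter E eqxx.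
have [n n12 kn] : exists2 n, n \in iota 0 12 & zmul (zpow n) k = z1.
  have kb : k \in zbox.
    have : k \in zsmall by apply: zsmallP; rewrite /nsqx k1 /=; lia.
    by rewrite mem_filter => /andP[].
  have := unit_checkP; rewrite /unit_check => /allP/(_ k kb).
  by rewrite k1 eqxx => /hasP[n n12 /eqP kn]; exists n.
set N := mscale (zpow n) (Mat a b z0 d e z0 z0 z0 k).
have uN : unim N by apply: unim_scale.
have NE : N = Mat (zmul (zpow n) a) (zmul (zpow n) b) z0
                  (zmul (zpow n) d) (zmul (zpow n) e) z0 z0 z0 z1.
  have z00 x : zmul x z0 = z0 by apply: (@ev_inj R); rewrite !evE mulr0.
  by rewrite /N /mscale !z00 kn.
rewrite NE in uN; have [F1 F2 F3 _ _] := unim_rows uN.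
have KN : N \in Kl.
  have p1 : (zmul (zpow n) a, zmul (zpow n) b) \in zsmall_pairs (zsq 1 (-1)).
    by apply: small F1 _ _; rewrite !zR_lits; lra.
  have p2 : (zmul (zpow n) d, zmul (zpow n) e) \in zsmall_pairs (zsq (-1) (-1)).
    by apply: small F2 _ _; rewrite !zR_lits; lra.
  have := block_checkP; rewrite /block_check => /allP/(_ _ p1)/allP/(_ _ p2).
  by rewrite F3 eqxx -NE.
(* The inverse of [zeta ^+ n], reduced modulo 12 since n may be 0. *)
exists N => //; apply/hasP; exists ((12 - n) %% 12)%N; first by rewrite mem_iota ltn_mod.
apply/eqP/(@evm_inj R); rewrite /N !evm_scale !evX mulmxA -scalar_mxM -exprD.
suff -> : zeta R ^+ ((12 - n) %% 12 + n) = 1 by rewrite mul1mx.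
have n12' : (n < 12)%N by move: n12; rewrite mem_iota.
by move: n n12' {n12 kn N uN NE F1 F2 F3 KN}; do 12?[case=> [_|]] => //;
  rewrite ?expr0 ?zeta12.
Qed.

End Stabilizer.

(** * Descent and extension of partial actions *)

Lemma hub_neighbours_unim : all unim hub_neighbours.
Proof. by rewrite /hub_neighbours KlE; vm_compute. Qed.

Section Descent.
Variable R : realType.
Local Notation C := R[i].
Local Notation ev := (@ev R).
Local Notation s3 := (s3 R).
Local Notation nC := (@nC R).
Local Notation hv := (hv R).

Lemma nsq_mul x y : nsq (zmul x y) = zmul (nsq x) (nsq y).
Proof. by apply: (@ev_inj R); rewrite /nsq !evE rmorphM; ring. Qed.

Lemma ht_peq M N : peq M N -> ht M = ht N.
Proof.
case/hasP=> n n12 /eqP ->; rewrite /ht; congr (Z.to_nat _).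
have -> : m33 (mscale (zpow n) N) = zmul (zpow n) (m33 N) by case: (N).
have E : nsq (zmul (zpow n) (m33 N)) = nsq (m33 N).
  rewrite nsq_mul; have -> : nsq (zpow n) = z1.
    by apply/eqP; move: n n12; apply/allP; vm_compute.
  by apply: (@ev_inj R); rewrite evM ev1 mul1r.
by rewrite /nsqy E.
Qed.

Lemma ht_inv M : unim M -> ht (minv M) = ht M.
Proof.
move=> uM; have E : m33 (minv M) = zconj (m33 M).
  case: M {uM} => a b c d e f g h k; apply: (@ev_inj R).
  by rewrite /minv /mmul /mstar /Fim /Fm /= /dot3 !evE; ring.
rewrite /ht E /nsqy (_ : nsq (zconj _) = nsq (m33 M)) //.
by apply: (@ev_inj R); rewrite /nsq !evE conjCK mulrC.
Qed.

Lemma nC_row3 M : nC (row3 R M).2 = hv M.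
Proof.
by apply: (@complexI R); rewrite -nCE -hvE; case: M => *; rewrite /nsq !evE.
Qed.

Lemma nC_vmul_row3 M N : nC (vmul (row3 R M) N).2 = hv (mmul M N).
Proof. by rewrite vmul_row3 nC_row3. Qed.

Lemma hform_Fim_row3 M : unim M -> hform Fim (row3 R M) = 1.
Proof.
case: M => a b c d e f g h k /(unim_q3 R)/(congr1 ev); rewrite ev1 => <-.
by rewrite /q3 /nsq /row3 /hform /polar /Fim !evE !evsq !zrE !zrm1; ring.
Qed.

(* Some neighbour of the base point is closer to [M^-1 0], and every neighbour that
   is not farther than the base point is linked to it by strictly closer ones. *)
Lemma descent M : unim M -> (0 < ht M)%N ->
  exists2 k, k \in Kl & (ht (mmul (mmul M k) bm) < ht M)%N /\
  {in Kl, forall k', (ht (mmul (mmul M k) (mmul k' bm)) <= ht M)%N ->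
     adj (mmul k' bm) bm \/
     exists N, [/\ N \in hub_neighbours, adj (mmul k' bm) N
                 & (ht (mmul (mmul M k) N) < ht M)%N]}.
Proof.
move=> uM hM; pose x := row3 R M.
have [sl su] := andP (s3_bounds R).
have hE : 2 + s3 <= nC x.2 by rewrite nC_row3 hv_ht_gt0.
have x0 : x.2 != 0.
  by apply/eqP => E; move: hE; rewrite E /= !mul0r addr0 => ?; lra.
have q1 : hform Fim x = 1 by rewrite hform_Fim_row3.
have [||k Kk] := @hub_exists R x x0.
- by rewrite q1.
- rewrite q1 mulr1 nCE -(rmorph_nat (real_complex R)) subr_ge0 lecR.
  by apply: le_trans hE; lra.
have uk : unim k by rewrite (allP Kl_unim).
set y := vmul x k => -[y2 v0 c0 hub].
have yE : y = row3 R (mmul M k) by rewrite /y vmul_row3.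
have uMk : unim (mmul M k) by apply: (unim_mul R).
have hMk : hv (mmul M k) = hv M by rewrite -nC_row3 -yE y2 nC_row3.
have ub : unim bm by vm_compute.
exists k => //; split.
  rewrite -(hv_lt R) ?(unim_mul R) // -!nC_row3 -vmul_row3 -yE.
  by apply: (le_lt_trans hub); lra.
have y0 : y.2 != 0 by rewrite y2.
have hubP : {in hub_forms, forall G, 0 <= hform G y}.
  have q1y : hform Fim y = 1 by rewrite yE hform_Fim_row3.
  move=> G; rewrite !in_cons => /or4P[/eqP->|/eqP->|/eqP->|/predU1P[->|//]] //.
    by rewrite q1y.
  rewrite /near_form !hformE q1y !zsqC !zR_lits y2 mulr1 addr0.
  rewrite -!(rmorphM (real_complex R)) -!(rmorphD (real_complex R)).
  rewrite -(rmorph0 (real_complex R)) lecR mul0r addr0 mulN1r.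
  have : (2 - s3) * (2 + s3) <= (2 - s3) * nC x.2 by apply: ler_wpM2l => //; lra.
  rewrite (_ : (2 - s3) * (2 + s3) = 4 - s3 * s3); last by ring.
  by rewrite s3_sqr => ?; lra.
move=> k' Kk' hk'.
have uk' : unim k' by rewrite (allP Kl_unim).
have [|a|[N [nN aN hN]]] := @hub_link R y k' Kk' y0 hubP.
- by rewrite yE nC_vmul_row3 nC_row3 hMk (hv_le R) ?(unim_mul R) // ?(unim_mul R).
- by left.
right; exists N; split=> //.
have uN : unim N by apply: (allP hub_neighbours_unim).
by move: hN; rewrite yE nC_vmul_row3 nC_row3 hMk (hv_lt R) // (unim_mul R).
Qed.

End Descent.

(* [phi] is a partial homomorphism, defined on the elements of height at most 1.
   It extends because the lower neighbours of [g] are all linked to one of them,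
   [c], through lower ones: [Phi g] is defined as [Phi (g c) phi (c^-1)], by
   recursion on the height, and is independent of the choice of [c]. *)
Section Morse.
Variables (G : groupType) (T : Type) (ht : G -> nat) (phi : G -> T -> T).
Variable V : T -> Prop.
Hypothesis ht_inv : forall g, ht g^-1%g = ht g.
Hypothesis phiV : forall s x, (ht s <= 1)%N -> V x -> V (phi s x).
Hypothesis phi1 : forall x, V x -> phi 1%g x = x.
Hypothesis phiM : forall s t x, (ht s <= 1)%N -> (ht t <= 1)%N ->
  (ht (s * t)%g <= 1)%N -> V x -> phi (s * t)%g x = phi s (phi t x).
Hypothesis ht1 : ht 1%g = 0%N.
Hypothesis linked : forall g, (0 < ht g)%N ->
  exists c, [/\ (ht c <= 1)%N, (ht (g * c)%g < ht g)%N &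
    forall s, (ht s <= 1)%N -> (ht (g * s)%g <= ht g)%N ->
    (ht (s^-1 * c)%g <= 1)%N \/
    exists t, [/\ (ht t <= 1)%N, (ht (s^-1 * t)%g <= 1)%N,
                  (ht (t^-1 * c)%g <= 1)%N & (ht (g * t)%g < ht g)%N]].

Let apex g := if pselect (0 < ht g)%N is left h then proj1_sig (cid (linked h)) else 1%g.

Fixpoint extension_fuel n g : T -> T :=
  if n is n'.+1 then
    if (0 < ht g)%N then
      fun x => extension_fuel n' (g * apex g)%g (phi (apex g)^-1%g x)
    else phi g
  else phi g.
Definition extension g := extension_fuel (ht g) g.

Let apexP g : (0 < ht g)%N -> [/\ (ht (apex g) <= 1)%N, (ht (g * apex g)%g < ht g)%N &
    forall s, (ht s <= 1)%N -> (ht (g * s)%g <= ht g)%N ->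
    (ht (s^-1 * apex g)%g <= 1)%N \/
    exists t, [/\ (ht t <= 1)%N, (ht (s^-1 * t)%g <= 1)%N,
                  (ht (t^-1 * apex g)%g <= 1)%N & (ht (g * t)%g < ht g)%N]].
Proof.
by move=> h; rewrite /apex; case: pselect => // h'; apply: (proj2_sig (cid (linked h'))).
Qed.

Let fuel_irrelevance n m g : (ht g <= n)%N -> (ht g <= m)%N ->
  extension_fuel n g = extension_fuel m g.
Proof.
elim: n m g => [|n IH] [|m] g //=; rewrite ?leqn0; do ?[by move=> _ /eqP ->];
  do ?[by move=> /eqP ->].
move=> gn gm; case: ifP => // g0; have [_ lt _] := apexP g0.
by rewrite (IH m) // -ltnS (leq_trans lt).
Qed.

Lemma extension_fuelE n g : (ht g <= n)%N -> extension_fuel n g = extension g.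
Proof. by move=> ?; apply: fuel_irrelevance. Qed.

Lemma extension0 g : ht g = 0%N -> extension g = phi g.
Proof. by rewrite /extension => ->. Qed.
Lemma extension_gt0 g x : (0 < ht g)%N ->
  extension g x = extension (g * apex g)%g (phi (apex g)^-1%g x).
Proof.
move=> g0; rewrite {1}/extension; case E: (ht g) (g0) => [//|n] _ /=.
rewrite g0 extension_fuelE //; have [_ lt _] := apexP g0.
by rewrite -ltnS -E.
Qed.

Let phiVK s x : (ht s <= 1)%N -> V x -> phi s (phi s^-1%g x) = x.
Proof.
by move=> s1 Vx; rewrite -phiM ?ht_inv ?mulgV ?ht1 // phi1.
Qed.

Let htVM s t : ht (s^-1 * t)%g = ht (t^-1 * s)%g.
Proof. by rewrite -ht_inv invgM invgK. Qed.

(** Induction on a bound for both heights. If one of g and g s is strictly lower, [lower] compares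
    them through the apex of the higher one; if they are equally high, through a common strictly
    lower neighbour. *)
Lemma extension_adj n g s x : (ht g <= n)%N -> (ht (g * s)%g <= n)%N ->
  (ht s <= 1)%N -> V x -> extension (g * s)%g x = extension g (phi s x).
Proof.
elim/ltn_ind: n g s x => n IH g s x gn gsn s1 Vx.
have lower g' s' x' : (ht g' <= n)%N -> (ht (g' * s')%g < ht g')%N ->
    (ht s' <= 1)%N -> V x' -> extension (g' * s')%g x' = extension g' (phi s' x').
  move=> g'n lt s'1 Vx'; have g'0 : (0 < ht g')%N by apply: leq_ltn_trans lt.
  have [c1 ltc link] := apexP g'0; set c := apex g' in c1 ltc link *.
  have IH' h t y : (ht h < ht g')%N -> (ht (h * t)%g < ht g')%N -> (ht t <= 1)%N -> V y ->
      extension (h * t)%g y = extension h (phi t y).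
    case: (ht g') g'n => // m mn; rewrite !ltnS.
    by move=> *; apply: (IH m).
  rewrite [RHS]extension_gt0 // -/c.
  (* Both [g' t] and [g' c] are lower than [g'] and they are adjacent, so the induction hypothesis
     relates them. *)
  have E t : (ht (t^-1 * c)%g <= 1)%N -> (ht t <= 1)%N -> (ht (g' * t)%g < ht g')%N ->
      forall y, V y -> extension (g' * t)%g y =
      extension (g' * c)%g (phi c^-1%g (phi t y)).
    move=> tc t1 lt_t y Vy; have tE : (g' * t = g' * c * (c^-1 * t))%g.
      by rewrite mulgA mulgK.
    rewrite {1}tE IH' -?tE // 1?htVM // phiM ?ht_inv //.
    by rewrite htVM.
  have [sc|[t [t1 st tc lt_t]]] := link s' s'1 (ltnW lt); first exact: E.
  have sE : (g' * s' = g' * t * (t^-1 * s'))%g by rewrite mulgA mulgK.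
  rewrite {1}sE IH' -?sE // 1?htVM // E //; last by apply: phiV; rewrite // htVM.
  rewrite phiM ?ht_inv // 1?htVM // phiVK //; exact: phiV.
have [lt|gt|eq] := ltngtP (ht (g * s)%g) (ht g).
- exact: lower.
- have := lower (g * s)%g s^-1%g (phi s x) gsn; rewrite mulgK => -> //.
  + rewrite -phiM ?ht_inv ?mulVg ?ht1 // phi1 //.
  + by rewrite ht_inv.
  + exact: phiV.
have [g0|g0] := posnP (ht g).
  by rewrite !extension0 ?eq //; rewrite phiM // ?eq ?g0 //.
have [c1 ltc link] := apexP g0; set c := apex g in c1 ltc link.
(* [g t] is lower than g and than g s, so [lower] applies twice. *)
have mid t : (ht t <= 1)%N -> (ht (s^-1 * t)%g <= 1)%N -> (ht (g * t)%g < ht g)%N ->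
    extension (g * s)%g x = extension g (phi s x).
  move=> t1 st lt_t; have gtE : (g * t = g * s * (s^-1 * t))%g by rewrite mulgA mulgK.
  have Vy : V (phi (t^-1 * s)%g x) by apply: phiV; rewrite // htVM.
  have e1 := lower g t _ gn lt_t t1 Vy.
  have lt_t' : (ht (g * s * (s^-1 * t))%g < ht (g * s)%g)%N by rewrite -gtE eq.
  have e2 := lower (g * s)%g _ _ gsn lt_t' st Vy.
  have ts1 : (ht (t^-1 * s)%g <= 1)%N by rewrite htVM.
  have st1 : (s^-1 * t * (t^-1 * s) = 1)%g by rewrite mulgA mulgK mulVg.
  have tt1 : (t * (t^-1 * s) = s)%g by rewrite mulgA mulgV mul1g.
  rewrite -gtE e1 in e2; rewrite -phiM ?tt1 // in e2.
  by rewrite -phiM ?st1 ?ht1 // phi1 // in e2.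
have [sc|[t [t1 st _ lt_t]]] := link s s1 (eq_leq eq).
  exact: (mid c).
exact: (mid t).
Qed.

Lemma extensionE s x : (ht s <= 1)%N -> V x -> extension s x = phi s x.
Proof.
move=> s1 Vx; have := @extension_adj 1 1%g s x; rewrite ht1 mul1g.
move=> -> //; rewrite extension0 // phi1 //; exact: phiV.
Qed.

Lemma extension_valid g x : V x -> V (extension g x).
Proof.
have [n] := ubnP (ht g); elim: n g x => // n IH g x; rewrite ltnS => gn Vx.
have [g0|g0] := posnP (ht g); first by rewrite extension0 //; apply: phiV; rewrite ?g0.
have [c1 lt _] := apexP g0; rewrite extension_gt0 //; apply: IH.
  exact: leq_trans lt gn.
by apply: phiV; rewrite // ht_inv.
Qed.

(** Induction on the height of h, written as [(h c) c^-1] with c its apex; multiplication on the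
    right by an element of height at most 1 is [extension_adj]. *)
Lemma extension_mul g h x : V x -> extension (g * h)%g x = extension g (extension h x).
Proof.
have [n] := ubnP (ht h); elim: n h x => // n IH h x; rewrite ltnS => hn Vx.
have adjE g' s y : (ht s <= 1)%N -> V y ->
    extension (g' * s)%g y = extension g' (phi s y).
  by move=> *; apply: (@extension_adj (maxn (ht g') (ht (g' * s)%g)));
    rewrite ?leq_maxl ?leq_maxr.
have [h0|h0] := posnP (ht h).
  have h1 : (ht h <= 1)%N by rewrite h0.
  by rewrite adjE // [extension h x]extensionE.
have [c1 lt _] := apexP h0; set c := apex h in c1 lt.
have Vy : V (phi c^-1%g x) by apply: phiV; rewrite // ht_inv.
have hE : (h = h * c * c^-1)%g by rewrite mulgK.
have e : extension h x = extension (h * c)%g (phi c^-1%g x).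
  by rewrite {1}hE adjE // ht_inv.
rewrite {1}hE mulgA adjE ?ht_inv // IH //; last exact: leq_trans lt hn.
by rewrite e.
Qed.

End Morse.

(** * The action on labelled cosets *)

Fixpoint mpow M n := if n is n'.+1 then mmul M (mpow M n') else mid.
Definition mprod (s : seq mat) := foldr mmul mid s.

Definition uVm := minv um.
Definition vVm := minv vm.
Definition bVm := minv bm.
Definition a1m := mprod [:: vm; um; vVm; mpow jm 4; bm; um; vm; mpow jm 2].
Definition a2m := mprod [:: mpow vm 2; um; bm; um; vVm; um; mpow vm 2; jm].
Definition a3m :=
  mprod [:: uVm; mpow vm 2; um; mpow jm 9; bm; vVm; um; vVm; mpow jm 8].

(* A straight-line program in the generators: each step multiplies two earlier
   entries or inverts one; the exponent sums of the entries are tracked. *)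
Variant slp_step := Mu of nat & nat | Iv of nat.
Definition expo := (Z * Z * Z)%type.
Definition eadd (x y : expo) : expo :=
  (Z.add x.1.1 y.1.1, Z.add x.1.2 y.1.2, Z.add x.2 y.2).
Definition eopp (x : expo) : expo := (Z.opp x.1.1, Z.opp x.1.2, Z.opp x.2).
Definition slp_entry := (mat * expo)%type.
Definition slp0 : slp_entry := (mid, (0, 0, 0)%BZ).
Definition slp_mul (x y : slp_entry) : slp_entry := (mmul x.1 y.1, eadd x.2 y.2).
Definition slp_inv (x : slp_entry) : slp_entry := (minv x.1, eopp x.2).
Definition slp_eval (s : seq slp_entry) st :=
  match st with
  | Mu i j => slp_mul (nth slp0 s i) (nth slp0 s j)
  | Iv i => slp_inv (nth slp0 s i)
  end.
Definition slp_init : seq slp_entry :=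
  let g1 := (a1m, (1, 0, 0)%BZ) in let g2 := (a2m, (0, 1, 0)%BZ) in
  let g3 := (a3m, (0, 0, 1)%BZ) in
  [:: slp0; g1; slp_inv g1; g2; slp_inv g2; g3; slp_inv g3].
Definition slp_run steps := foldl (fun s st => rcons s (slp_eval s st)) slp_init steps.

(** The indices 0 to 6 are those of [slp_init], so the first step defines entry 7. *)
Definition slp_steps : seq slp_step :=
  [::
      Mu 1 3; Mu 1 4; Mu 1 5; Mu 1 6; Mu 2 2; Mu 2 4; Iv 12; Mu 2 6; Mu 3 2; Mu 3 3;
      Mu 3 13; Mu 4 1; Mu 4 4; Mu 5 1; Mu 5 4; Mu 5 5; Mu 6 6; Mu 6 12; Mu 7 3; Mu 9 2;
      Mu 9 5; Mu 10 2; Mu 10 12; Mu 11 6; Mu 12 4; Mu 13 3; Mu 13 4; Mu 13 5; Mu 14 6;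
      Mu 15 6; Mu 16 2; Mu 16 3; Mu 16 12; Mu 17 5; Mu 18 5; Mu 19 2; Mu 19 4; Mu 20 3;
      Mu 20 4; Mu 20 6; Mu 22 1; Mu 22 5; Mu 23 6; Mu 24 4; Mu 25 12; Mu 26 6; Mu 27 1;
      Mu 27 5; Mu 28 3; Mu 29 4; Mu 30 6; Mu 33 2; Mu 33 4; Mu 34 5; Mu 35 6; Mu 36 6;
      Mu 38 3; Mu 40 2; Mu 41 2; Mu 42 6; Mu 44 3; Mu 46 12; Mu 47 6; Mu 48 1; Mu 51 1;
      Mu 51 6; Mu 53 6; Mu 54 1; Mu 55 3; Mu 57 6; Mu 59 2; Mu 60 5; Mu 61 2; Mu 61 3;
      Mu 62 6; Mu 64 6; Mu 65 5; Mu 65 6; Mu 68 4; Mu 69 12; Mu 70 1; Mu 70 3; Mu 70 4;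
      Mu 70 5; Mu 70 6; Mu 71 5; Mu 71 6; Mu 72 6; Mu 73 12; Mu 74 1; Mu 74 6; Mu 76 3;
      Mu 76 4; Mu 76 13; Mu 77 13; Mu 78 1; Mu 79 6; Mu 80 3; Mu 82 6; Mu 83 1;
      Mu 84 2; Mu 86 4; Mu 87 3; Mu 87 4; Mu 88 3; Mu 90 5; Mu 91 12; Mu 92 5;
      Mu 93 12; Mu 94 6; Mu 95 4; Mu 96 4; Mu 97 12; Mu 98 3; Mu 98 13; Mu 100 5;
      Mu 102 6; Mu 103 6; Mu 104 3; Iv 125; Mu 3 125; Mu 5 126; Iv 128; Mu 1 128;
      Iv 130; Mu 4 130; Mu 12 125; Iv 133; Mu 12 129; Mu 12 130; Mu 15 125; Mu 16 130;
      Mu 21 130; Mu 22 129; Mu 23 125; Mu 32 126; Mu 36 129; Mu 36 133; Mu 38 130;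
      Mu 39 130; Mu 45 131; Mu 52 134; Mu 58 125; Mu 63 126; Mu 66 129; Mu 67 128;
      Mu 75 126; Mu 84 126; Mu 87 131; Mu 89 131; Mu 91 133; Mu 101 130; Mu 104 130;
      Mu 105 6; Mu 106 6; Mu 107 134; Mu 109 126; Mu 111 3; Mu 112 129; Mu 113 4;
      Mu 114 134; Mu 119 4; Mu 120 130; Mu 121 5; Mu 122 2; Mu 124 6; Mu 125 2;
      Mu 125 5; Mu 125 128; Mu 127 128; Mu 127 130; Mu 129 12; Mu 131 3; Mu 131 12;
      Mu 131 13; Mu 131 134; Iv 182; Mu 36 183; Mu 89 182; Mu 133 4; Mu 135 6;
      Mu 135 126; Mu 137 4; Mu 138 5; Mu 140 126; Mu 140 134; Mu 141 4; Mu 142 1;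
      Mu 143 12; Mu 144 182; Mu 144 183; Mu 146 3; Mu 147 133; Mu 148 4; Mu 149 4;
      Mu 150 1; Mu 151 12; Mu 152 183; Mu 153 1; Mu 157 5; Mu 157 128; Mu 160 2;
      Mu 160 133; Mu 161 183; Mu 162 131; Mu 162 182; Mu 163 5; Mu 164 126; Mu 169 5;
      Mu 170 4; Mu 171 129; Mu 173 134; Mu 174 5; Mu 178 4; Mu 178 130; Mu 179 126;
      Mu 179 134; Mu 180 182; Mu 185 129; Mu 186 130; Mu 187 125; Mu 189 130;
      Mu 192 5; Mu 193 4; Mu 194 4; Mu 196 130; Mu 196 134; Mu 198 2; Mu 199 4;
      Mu 201 130; Mu 202 4; Mu 203 4; Mu 204 13; Mu 210 130; Mu 211 6; Mu 212 182;
      Mu 214 6; Mu 215 1; Mu 219 1; Mu 220 4; Mu 227 4; Mu 230 4; Mu 235 130;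
      Mu 239 4; Mu 241 134; Mu 242 130; Mu 245 6; Mu 233 45; Mu 37 61; Mu 206 8;
      Mu 255 4; Mu 208 4; Mu 213 116; Mu 195 4; Mu 177 59; Mu 40 8; Mu 197 29;
      Mu 89 115; Mu 224 29; Mu 243 31; Mu 40 110; Mu 263 4; Mu 176 23; Mu 232 19;
      Mu 157 31; Mu 191 4; Mu 184 81; Mu 123 31; Mu 253 31; Mu 247 19; Mu 36 31;
      Mu 185 45; Mu 156 49; Mu 218 158; Mu 233 31; Mu 90 116; Mu 208 49; Mu 190 8;
      Mu 217 43; Mu 184 59; Mu 197 117; Mu 110 4; Mu 112 56; Mu 260 87; Mu 244 4;
      Mu 258 4; Mu 181 50; Mu 40 108; Mu 198 50; Mu 216 19; Mu 64 132; Mu 197 49;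
      Mu 155 43; Mu 196 59; Mu 237 4; Mu 229 8; Mu 225 130; Mu 176 118; Mu 197 115]%N.

(* indices in [Kl] of representatives of the cosets of [<[v]>] *)
Definition coset_reps : seq nat :=
  [::
      0; 1; 3; 5; 8; 10; 12; 14; 16; 18; 22; 24; 25; 27; 31; 33; 34; 36; 40;
      44; 46; 47; 53; 55; 56; 59; 60; 62; 72; 74; 75; 79; 81; 86; 88; 91; 92;
      95; 99; 100; 106; 111; 113; 116; 117; 120; 131; 133; 139; 141; 144; 145;
      148; 159; 161; 166; 167; 170; 186; 188; 194; 197; 208; 209; 210; 213;
      219; 233; 234; 238; 252; 253]%N.

(* [b k x_i = k' x_j pi] for the [k] in [coset_reps], where [x_i = b ^ i]: row [i]
   lists [j], the index of [k'] in [Kl] and the index of [pi] in the program. *)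
Definition b_table : seq (seq (nat * nat * nat)) :=
  [::
   [::
      (1, 0, 0); (0, 235, 130); (1, 95, 138); (2, 227, 169); (2, 191, 0);
      (2, 21, 70); (2, 244, 198); (1, 258, 145); (2, 84, 232); (1, 97, 177);
      (1, 93, 3); (0, 95, 4); (1, 106, 185); (2, 111, 36); (0, 143, 183);
      (1, 18, 218); (1, 285, 160); (0, 254, 134); (1, 59, 89); (2, 226, 207);
      (2, 183, 215); (1, 85, 87); (0, 189, 128); (1, 148, 105); (1, 269, 40);
      (0, 144, 6); (2, 22, 3); (0, 277, 1); (0, 207, 126); (2, 39, 16);
      (2, 232, 189); (1, 184, 223); (0, 214, 13); (2, 215, 15); (1, 46, 70);
      (0, 22, 3); (1, 212, 16); (2, 42, 214); (0, 113, 182); (2, 85, 157);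
      (1, 174, 17); (1, 136, 131); (2, 127, 39); (2, 184, 196); (2, 163, 144);
      (2, 64, 131); (1, 251, 208); (0, 102, 12); (2, 202, 171); (2, 179, 112);
      (1, 255, 82); (0, 27, 5); (1, 117, 209); (2, 219, 197); (1, 68, 175);
      (0, 161, 129); (1, 8, 125); (1, 199, 181); (2, 273, 234); (1, 123, 222);
      (2, 50, 38); (1, 197, 225); (1, 118, 179); (0, 49, 2); (0, 188, 125);
      (1, 260, 38); (2, 119, 165); (0, 40, 131); (1, 27, 156); (1, 176, 127);
      (0, 26, 133); (1, 253, 64)];
   [::
      (2, 0, 0); (0, 176, 130); (2, 153, 228); (2, 169, 169); (0, 191, 0);
      (0, 86, 61); (2, 174, 198); (1, 86, 138); (1, 70, 89); (1, 222, 264);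
      (0, 130, 19); (0, 128, 4); (0, 227, 159); (2, 285, 287); (0, 134, 136);
      (0, 246, 132); (2, 14, 70); (1, 195, 269); (2, 168, 146); (1, 243, 299);
      (1, 98, 81); (0, 173, 126); (2, 83, 246); (0, 177, 81); (0, 30, 76);
      (0, 233, 117); (1, 247, 3); (2, 94, 255); (0, 262, 43); (1, 122, 258);
      (0, 16, 188); (0, 118, 221); (0, 266, 115); (1, 201, 293); (1, 19, 220);
      (0, 53, 220); (0, 58, 31); (2, 260, 76); (0, 52, 226); (1, 115, 274);
      (2, 156, 273); (0, 242, 154); (2, 47, 257); (1, 43, 272); (1, 259, 297);
      (2, 80, 281); (1, 223, 292); (1, 12, 4); (0, 182, 139); (2, 104, 289);
      (0, 90, 108); (0, 190, 85); (1, 282, 294); (2, 140, 268); (2, 131, 99);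
      (0, 84, 249); (1, 29, 275); (2, 160, 263); (0, 273, 56); (0, 4, 246);
      (2, 76, 260); (2, 197, 305); (2, 107, 266); (0, 85, 50); (1, 256, 265);
      (2, 167, 271); (0, 119, 238); (2, 263, 277); (2, 109, 166);
      (0, 209, 168); (0, 21, 166); (2, 253, 295)];
   [::
      (0, 0, 0); (0, 198, 130); (1, 268, 145); (2, 209, 169); (1, 191, 0);
      (1, 279, 160); (2, 213, 198); (2, 200, 228); (2, 246, 146);
      (1, 193, 284); (2, 78, 3); (0, 63, 4); (0, 98, 236); (0, 171, 172);
      (1, 66, 278); (1, 155, 303); (0, 109, 61); (1, 5, 61); (2, 99, 232);
      (0, 146, 167); (2, 190, 298); (0, 193, 43); (2, 155, 290);
      (1, 181, 279); (0, 180, 251); (1, 271, 283); (0, 157, 19);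
      (2, 165, 270); (1, 171, 87); (2, 128, 4); (1, 83, 250); (2, 201, 285);
      (1, 111, 301); (2, 89, 300); (1, 7, 239); (1, 216, 237); (1, 20, 110);
      (0, 196, 59); (0, 195, 252); (2, 133, 236); (2, 259, 296); (0, 145, 8);
      (0, 101, 45); (0, 236, 158); (2, 32, 254); (2, 268, 291); (2, 7, 239);
      (1, 266, 202); (1, 62, 259); (2, 49, 282); (2, 146, 276); (0, 224, 116);
      (1, 264, 304); (2, 206, 256); (0, 117, 205); (0, 221, 248);
      (2, 234, 286); (1, 114, 288); (1, 273, 267); (0, 15, 239); (2, 1, 250);
      (0, 197, 240); (2, 24, 237); (0, 35, 110); (1, 194, 261); (0, 153, 200);
      (1, 119, 280); (2, 20, 110); (1, 213, 262); (0, 264, 231); (1, 67, 302);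
      (0, 253, 118)]]%N.

(* The product of the first two entries is the third one, while their exponent sums
   differ by [(3, -2, 7)]. *)
Definition slp_relator := (3, 109, 181)%N.
(* chosen to vanish on the exponents [(3, -2, 7)] of the relator *)
Definition theta (x : expo) : Z * Z :=
  (Z.add (Z.mul 2 x.1.1) (Z.mul 3 x.1.2), Z.sub x.1.1 (Z.add (Z.mul 2 x.1.2) x.2)).

(* [(i, k, t)] stands for the coset [k b^i Pi] with the label [t]. *)
Definition state := (nat * mat * (Z * Z))%type.
Definition b_entry := (mat * (nat * mat * nat))%type.
Definition vpows := [:: mid; vm; mmul vm vm; mmul vm (mmul vm vm)].
(** As [b] commutes with [v], the entry of k determines that of [w k] for each power w of [v]. *)
Definition b_entries_of (K : seq mat) : seq (seq b_entry) :=
  [seq flatten [seq [seq (mmul w (nth mid K te.1),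
                          (te.2.1.1, mmul w (nth mid K te.2.1.2), te.2.2))
                     | w <- vpows] | te <- zip coset_reps row] | row <- b_table].
Fixpoint b_find (row : seq b_entry) k :=
  if row is (k', e) :: row' then if mateqb k k' then Some e else b_find row' k
  else None.
Definition padd (t d : Z * Z) := (Z.add t.1 d.1, Z.add t.2 d.2).
Definition act_b_of (B : seq (seq b_entry)) (L : seq (Z * Z)) (p : state) : state :=
  let: (i, k, t) := p in
  if b_find (nth [::] B i) k is Some (j, k', n) then (j, k', padd t (nth (0, 0)%BZ L n))
  else p.
Definition act_k m (p : state) : state := let: (i, k, t) := p in (i, mmul m k, t).
Definition labels_of (S : seq slp_entry) := [seq theta x.2 | x <- S].
Definition xm i := mpow bm i.

Fact btab_key : {B | B = b_entries_of Kl}. Proof. by eexists. Qed.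
Definition btab := sval btab_key.
Lemma btabE : btab = b_entries_of Kl. Proof. exact: (svalP btab_key). Qed.
Fact slp_key : {S | S = slp_run slp_steps}. Proof. by eexists. Qed.
Definition slp := sval slp_key.
Lemma slpE : slp = slp_run slp_steps. Proof. exact: (svalP slp_key). Qed.
Definition act_b := act_b_of btab (labels_of slp).

(** Label 0 suffices for the finite checks because the action commutes with all shifts of labels. *)
Definition origins (K : seq mat) : seq state :=
  flatten [seq [seq (i, k, (0, 0)%BZ) | k <- K] | i <- [:: 0; 1; 2]%N].

Definition left_reps (K : seq mat) := [seq nth mid K i | i <- coset_reps].
Definition table_check K B (S : seq slp_entry) :=
  all (fun i => all (fun k =>
    if b_find (nth [::] B i) k is Some (j, k', n) then
      [&& (j < 3)%N, k' \in K, (n < size S)%N &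
        peq (mmul bm (mmul k (xm i)))
            (mmul (mmul k' (xm j)) (nth slp0 S n).1)]
    else false) (left_reps K)) [:: 0; 1; 2]%N.
Definition translate (w : mat) (e : option (nat * mat * nat)) :=
  if e is Some (j, k, n) then Some (j, mmul w k, n) else None.
Definition translation_check K B :=
  all (fun i => all (fun k => all (fun w =>
    b_find (nth [::] B i) (mmul w k) == translate w (b_find (nth [::] B i) k))
    vpows) (left_reps K)) [:: 0; 1; 2]%N.
Definition left_cosets_check (K D : seq mat) := all (fun k => k \in D) K.
Definition commute_check K B L :=
  all (fun p => act_b_of B L (act_k vm p) == act_k vm (act_b_of B L p)) (origins K).
(* Representatives of the double cosets [<[v]> m <[v]>] for which [b m b] has height
   at most 2; it suffices to check these because [b] commutes with [v]. *)
Definition double_reps (K : seq mat) :=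
  [seq nth mid K i | i <- [:: 0; 1; 3; 8; 14; 18; 47]%N].
Definition double_cosets K :=
  [seq mmul (mmul w.1 m) w.2 | m <- double_reps K,
    w <- [seq (w1, w2) | w1 <- vpows, w2 <- vpows]].
Definition double_check (K : seq mat) (D : seq mat) :=
  all (fun m => if (ht (mmul bm (mmul m bm)) <= 2)%N then m \in D else true) K.
(** Compares the composite action of [b m b] with that of a normal form, k or [k b k']. In height 1
    the coset [k b K] is recognized first, by [N] having height 0, before k' is sought. *)
Definition relation_check K B L :=
  let O := origins K in
  all (fun m => let M := mmul bm (mmul m bm) in
    let bmb p := act_b_of B L (act_k m (act_b_of B L p)) in
    match ht M with
    | 0 => lazy_has (fun k =>
        if peq M k then all (fun p => bmb p == act_k k p) O else false) K
    | 1 => lazy_has (fun k => let N := mmul (minv (mmul k bm)) M in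
        if ht N is 0 then lazy_has (fun k' => if peq M (mmul k (mmul bm k')) then
          all (fun p => bmb p == act_k k (act_b_of B L (act_k k' p))) O
          else false) K else false) K
    | _ => true
    end) (double_reps K).
(** The intersection of K with [b K b^-1] lies in the group generated by [v]; this measures how far
    [k b k'] is from determining k and k'. *)
Definition stabilizer_check (K : seq mat) :=
  all (fun m => if ht (mmul bVm (mmul m bm)) == 0%N then m \in vpows else true) K.
(** The component in K is ignored, so that the relation is insensitive to factors from K on either
    side. *)
Definition fixes (p q : state) := (p.1.1 == q.1.1) && (p.2 == q.2).
Definition torsion_check1 K B L :=
  all (fun p => ~~ fixes p (act_b_of B L p)) (origins K).
Definition torsion_check2 K B L := let O := origins K in
  all (fun m => if ht (mmul bm (mmul m bm)) == 2%N then
    all (fun p => ~~ fixes p (act_b_of B L (act_k m (act_b_of B L p)))) O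
    else true) (double_reps K).

Definition base_state : state := (0%N, mid, (0, 0)%BZ).
(* Each generator is a product [l b r] with [l] and [r] in [Kl]. *)
Definition generator1 := (mprod [:: vm; um; vVm; mpow jm 4], a1m,
  mprod [:: um; vm; mpow jm 2], (2, 1)%BZ).
Definition generator2 := (mprod [:: mpow vm 2; um], a2m,
  mprod [:: um; vVm; um; mpow vm 2; jm], (3, -2)%BZ).
Definition generator3 := (mprod [:: uVm; mpow vm 2; um; mpow jm 9], a3m,
  mprod [:: vVm; um; vVm; mpow jm 8], (0, -1)%BZ).
Definition generator_check (K : seq mat) B L (e : mat * mat * mat * (Z * Z)) :=
  let: (l, a, r, t) := e in
  [&& l \in K, r \in K, unim a, peq a (mmul l (mmul bm r))
    & act_k l (act_b_of B L (act_k r base_state)) == (0%N, mid, t)].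
Definition cosets_check B L :=
  all (fun i => act_b_of B L (i, mid, (0, 0)%BZ) == (i.+1, mid, (0, 0)%BZ)) [:: 0; 1]%N.
Definition relator_check (S : seq slp_entry) :=
  let: (i, j, k) := slp_relator in
  let x := slp_mul (nth slp0 S i) (nth slp0 S j) in let y := nth slp0 S k in
  peq x.1 y.1 && (x.2 == eadd y.2 (3, -2, 7)%BZ).
Definition left_checks K B :=
  [&& translation_check K B,
      left_cosets_check K [seq mmul w k | k <- left_reps K, w <- vpows]
    & all (fun w => (w \in K) && (mmul bm w == mmul w bm)) vpows].
Definition double_checks K :=
  [&& stabilizer_check K, double_check K (double_cosets K)
    & all (fun m => m \in K) (double_reps K)].
Definition generator_checks K B S :=
  let check := generator_check K B (labels_of S) in
  [&& check generator1, check generator2, check generator3 & relator_check S].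
Definition checks K B S :=
  let L := labels_of S in
  [&& [&& table_check K B S, commute_check K B L & relation_check K B L],
      [&& torsion_check1 K B L, torsion_check2 K B L & cosets_check B L],
      left_checks K B, double_checks K & generator_checks K B S].
(* The finite checks are evaluated together, in order to compute [Kl] only once. *)
Lemma checksP : checks Kl btab slp.
Proof. by rewrite btabE slpE KlE; vm_compute. Qed.

Lemma table_checkP : table_check Kl btab slp.
Proof. by have /and5P[/and3P[]] := checksP. Qed.
Lemma commute_checkP : commute_check Kl btab (labels_of slp).
Proof. by have /and5P[/and3P[]] := checksP. Qed.
Lemma relation_checkP : relation_check Kl btab (labels_of slp).
Proof. by have /and5P[/and3P[]] := checksP. Qed.
Lemma torsion_check1P : torsion_check1 Kl btab (labels_of slp).
Proof. by have /and5P[_ /and3P[]] := checksP. Qed.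
Lemma torsion_check2P : torsion_check2 Kl btab (labels_of slp).
Proof. by have /and5P[_ /and3P[]] := checksP. Qed.
Lemma translation_checkP : translation_check Kl btab.
Proof. by have /and5P[_ _ /and3P[]] := checksP. Qed.
Lemma left_cosets_checkP :
  left_cosets_check Kl [seq mmul w k | k <- left_reps Kl, w <- vpows].
Proof. by have /and5P[_ _ /and3P[]] := checksP. Qed.
Lemma vpows_checkP :
  all (fun w => (w \in Kl) && (mmul bm w == mmul w bm)) vpows.
Proof. by have /and5P[_ _ /and3P[]] := checksP. Qed.
Lemma stabilizer_checkP : stabilizer_check Kl.
Proof. by have /and5P[_ _ _ /and3P[]] := checksP. Qed.
Lemma double_checkP : double_check Kl (double_cosets Kl).
Proof. by have /and5P[_ _ _ /and3P[]] := checksP. Qed.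
Lemma double_repsP : all (fun m => m \in Kl) (double_reps Kl).
Proof. by have /and5P[_ _ _ /and3P[]] := checksP. Qed.
Lemma cosets_checkP : cosets_check btab (labels_of slp).
Proof. by have /and5P[_ /and3P[]] := checksP. Qed.
Lemma generators_checkP : let check := generator_check Kl btab (labels_of slp) in
  [/\ check generator1, check generator2 & check generator3].
Proof. by have /and5P[_ _ _ _ /and4P[]] := checksP. Qed.
Lemma relator_checkP : relator_check slp.
Proof. by have /and5P[_ _ _ _ /and4P[]] := checksP. Qed.

(** * The group K inside Gamma and the action of b *)

Section Action.
Variable R : realType.
Local Notation C := R[i].
Local Notation ev := (@ev R).
Local Notation Gamma := (Gamma R).
Local Notation toG := (toG R).
Local Open Scope group_scope.

Lemma bm_unim : unim bm. Proof. by vm_compute. Qed.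
Lemma vm_unim : unim vm. Proof. by vm_compute. Qed.
Lemma uKl k : k \in Kl -> unim k. Proof. exact: (allP Kl_unim). Qed.

Lemma block_mul M N : is_block M -> is_block N -> is_block (mmul M N).
Proof.
case: M => a b c d e f g h k; case: N => a' b' c' d' e' f' g' h' k'.
move=> /and5P[/eqP-> /eqP-> /eqP-> /eqP-> /eqP->].
move=> /and5P[/eqP-> /eqP-> /eqP-> /eqP-> /eqP->].
by apply/and5P; split; apply/eqP/(@ev_inj R); rewrite /dot3 !evE; ring.
Qed.
Lemma block_inv M : is_block M -> is_block (minv M).
Proof.
case: M => a b c d e f g h k.
move=> /and5P[/eqP-> /eqP-> /eqP-> /eqP-> /eqP->].
apply/and5P; split; apply/eqP/(@ev_inj R);
  by rewrite /dot3 !evE ?rmorph0 ?rmorph1; ring.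
Qed.
Lemma mscale1 M : mscale z1 M = M.
Proof. by apply: (@evm_inj R); rewrite evm_scale ev1 mul1mx. Qed.

(** The last entry 1 forces the scalar to be 1, so K embeds into Gamma. *)
Lemma block_peq M N : is_block M -> is_block N -> peq M N -> M = N.
Proof.
move=> bM bN /hasP[n _ /eqP E].
have zn : zpow n = z1.
  have h3 K : is_block K -> m33 K = z1.
    by case: K => a b c d e f g h k /and5P[_ _ _ _ /eqP].
  have : m33 M = zmul (zpow n) (m33 N) by rewrite E; case: (N).
  rewrite !h3 // => E1; apply: (@ev_inj R); rewrite E1 evM ev1 mulr1 //.
by rewrite E zn mscale1.
Qed.

(** Gives closure of [Kl] under products and inverses without multiplying all pairs. *)
Lemma block_Kl M : unim M -> is_block M -> M \in Kl.
Proof.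
move=> uM bM; have h0 : ht M = 0%N.
  by case: M bM {uM} => a b c d e f g h k /and5P[_ _ _ _ /eqP->]; vm_compute.
have [k Kk pk] := ht0_Kl R uM h0.
by rewrite (block_peq bM _ pk) // (allP Kl_block).
Qed.
Lemma Kl_mul k k' : k \in Kl -> k' \in Kl -> mmul k k' \in Kl.
Proof.
move=> Kk Kk'; apply: block_Kl; first by rewrite (unim_mul R) ?uKl.
by apply: block_mul; apply: (allP Kl_block).
Qed.
Lemma Kl_inv k : k \in Kl -> minv k \in Kl.
Proof.
move=> Kk; apply: block_Kl; first by have [] := unim_inv R (uKl Kk).
by apply: block_inv; apply: (allP Kl_block).
Qed.
Lemma toG_Kl_inj k k' : k \in Kl -> k' \in Kl -> toG k = toG k' -> k = k'.
Proof.
move=> Kk Kk' /(toG_eq R (uKl Kk) (uKl Kk')); apply: block_peq;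
  exact: (allP Kl_block).
Qed.

Definition gM (g : Gamma) : mat := s2val (cid2 (toG_surj g)).
Lemma gM_unim g : unim (gM g). Proof. exact: (s2valP (cid2 (toG_surj g))). Qed.
Lemma gMK g : toG (gM g) = g. Proof. by rewrite -(s2valP' (cid2 (toG_surj g))). Qed.
Definition hG g := ht (gM g).

Lemma hG_toG M : unim M -> hG (toG M) = ht M.
Proof.
move=> uM; apply: (ht_peq R); apply: (proj1 (toG_eq R (gM_unim _) uM)).
exact: gMK.
Qed.
Lemma hGV g : hG g^-1 = hG g.
Proof.
by rewrite -{1}(gMK g) -toG_inv ?hG_toG ?ht_inv ?gM_unim //;
  have [] := unim_inv R (gM_unim g).
Qed.
Lemma ht_mulKl M k : k \in Kl -> ht (mmul M k) = ht M.
Proof.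
move=> /(allP Kl_block); case: M => a b c d e f g h i; case: k => a' b' c' d' e' f' g' h' i'.
move=> /and5P[/eqP-> /eqP-> _ _ /eqP->]; rewrite /ht; congr (Z.to_nat (nsqy _)).
by apply: (@ev_inj R); rewrite /= /dot3 !evE; ring.
Qed.
Lemma hG_mulKl g k : k \in Kl -> hG (g * toG k) = hG g.
Proof.
move=> Kk; rewrite -{1}(gMK g) -toG_mul ?gM_unim ?uKl // hG_toG.
  by rewrite ht_mulKl.
by rewrite (unim_mul R) ?gM_unim ?uKl.
Qed.
Lemma hG_Klmul g k : k \in Kl -> hG (toG k * g) = hG g.
Proof.
move=> Kk; rewrite -hGV invgM -toG_inv ?uKl // hG_mulKl ?Kl_inv //.
exact: hGV.
Qed.
Lemma hG_Kl k : k \in Kl -> hG (toG k) = 0%N.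
Proof. by move=> Kk; rewrite -[toG k]mulg1 hG_Klmul // -toG_id hG_toG. Qed.
Lemma hG_b : hG (toG bm) = 1%N.
Proof. by rewrite hG_toG ?bm_unim. Qed.

Definition valid (p : state) : bool := (p.1.1 < 3)%N && (p.1.2 \in Kl).
Definition pshift d (p : state) : state := (p.1, padd p.2 d).

Lemma paddA x y w : padd (padd x y) w = padd x (padd y w).
Proof. by rewrite /padd /= !Z.add_assoc. Qed.
Lemma paddC x y : padd x y = padd y x.
Proof. by rewrite /padd Z.add_comm (Z.add_comm x.2). Qed.
Lemma padd0 x : padd (0, 0)%BZ x = x. Proof. by case: x. Qed.

Lemma act_k_shift k d p : act_k k (pshift d p) = pshift d (act_k k p).
Proof. by case: p => [[i m] t]. Qed.
Lemma act_b_shift d p : act_b (pshift d p) = pshift d (act_b p).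
Proof.
case: p => [[i m] t]; rewrite /act_b /act_b_of /pshift /=.
case: b_find => [[[j k'] n]|] //=.
by rewrite !paddA [padd d _]paddC.
Qed.
Lemma act_kM k k' p : act_k (mmul k k') p = act_k k (act_k k' p).
Proof. by case: p => [[i m] t]; rewrite /= (mmulA R). Qed.
Lemma act_k1 p : act_k mid p = p.
Proof. by case: p => [[i m] t]; rewrite /act_k (m1mul R). Qed.
Lemma act_k_valid k p : k \in Kl -> valid p -> valid (act_k k p).
Proof.
by case: p => [[i m] t] Kk /andP[i3 Km]; rewrite /valid i3 Kl_mul.
Qed.

Lemma mem012 i : (i < 3)%N -> i \in [:: 0; 1; 2]%N.
Proof. by case: i => [|[|[|]]]. Qed.
Lemma origin_mem i k : (i < 3)%N -> k \in Kl -> (i, k, (0, 0)%BZ) \in origins Kl.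
Proof.
by move=> i3 Kk; apply/flatten_mapP; exists i; [exact: mem012|exact: map_f].
Qed.
Lemma valid_origin p : valid p -> exists2 q, q \in origins Kl & p = pshift p.2 q.
Proof.
case: p => [[i k] t] /andP[i3 Kk]; exists (i, k, (0, 0)%BZ); first exact: origin_mem.
by rewrite /pshift padd0.
Qed.

Lemma peq_mull M A B : peq A B -> peq (mmul M A) (mmul M B).
Proof.
move=> /hasP[n n12 /eqP->]; apply/hasP; exists n => //; apply/eqP.
by apply: (@evm_inj R); rewrite !(evm_mul, evm_scale) mulmxA scalar_mxC mulmxA.
Qed.

Lemma table_find i k : (i < 3)%N -> k \in Kl -> exists j k' n,
  [/\ b_find (nth [::] btab i) k = Some (j, k', n), (j < 3)%N, k' \in Kl,
      (n < size slp)%N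
    & peq (mmul bm (mmul k (xm i))) (mmul (mmul k' (xm j)) (nth slp0 slp n).1)].
Proof.
move=> /mem012 i3 Kk; have /allpairsP[[r w] [Kr Vw ->]] := allP left_cosets_checkP k Kk.
have /andP[Kw /eqP bw] := allP vpows_checkP w Vw.
have /eqP := allP (allP (allP translation_checkP i i3) r Kr) w Vw.
have := allP (allP table_checkP i i3) r Kr; rewrite [(r, w).1]/= [(r, w).2]/=.
case: b_find => [[[j k'] n]|//] /and4P[j3 Kk' ns pe] ->.
exists j, (mmul w k'), n; split=> //; first exact: Kl_mul.
have := peq_mull w pe; rewrite !(mmulA R) bw.
by [].
Qed.

Lemma act_b_valid p : valid p -> valid (act_b p).
Proof.
case: p => [[i k] t] /andP[i3 Kk]; have [j [k' [n [E j3 Kk' _ _]]]] := table_find i3 Kk.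
by rewrite /act_b /act_b_of E /valid /= j3.
Qed.

Lemma act_bv p : valid p -> act_b (act_k vm p) = act_k vm (act_b p).
Proof.
move=> /valid_origin[q qO ->]; rewrite !(act_k_shift, act_b_shift); congr pshift.
by have := commute_checkP; rewrite /commute_check => /allP/(_ q qO)/eqP.
Qed.

End Action.

(** * The partial homomorphism on elements of height at most 1 *)

Section Development.
Variable R : realType.
Local Notation Gamma := (Gamma R).
Local Notation toG := (toG R).
Local Notation hG := (@hG R).
Local Open Scope group_scope.
Implicit Types (g s t : Gamma) (f : state -> state) (p : state).

(** A relation and not a function, since the factorization [k b k'] is not unique; [acts_fun] shows
    that the choice does not matter on valid states. *)
Definition acts g f :=
  (exists k, [/\ k \in Kl, g = toG k & f =1 act_k k]) \/
  (exists k k', [/\ k \in Kl, k' \in Kl, g = toG k * toG bm * toG k'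
                  & f =1 fun p => act_k k (act_b (act_k k' p))]).

Lemma toG_Kl k k' : k \in Kl -> k' \in Kl -> toG (mmul k k') = toG k * toG k'.
Proof. by move=> Kk Kk'; rewrite toG_mul ?uKl. Qed.
Lemma toG_KlV k : k \in Kl -> toG (minv k) = (toG k)^-1.
Proof. by move=> Kk; rewrite toG_inv ?uKl. Qed.

Lemma acts_ht g f : acts g f -> (hG g <= 1)%N.
Proof.
case=> [[k [Kk -> _]]|[k [k' [Kk Kk' -> _]]]]; first by rewrite hG_Kl.
by rewrite hG_mulKl // hG_Klmul // hG_b.
Qed.

Lemma acts_valid g f p : acts g f -> valid p -> valid (f p).
Proof.
case=> [[k [Kk _ ->]]|[k [k' [Kk Kk' _ ->]]]] vp; first exact: act_k_valid.
by rewrite act_k_valid ?(act_b_valid R) ?act_k_valid.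
Qed.

Lemma vpow_comm w : w \in vpows ->
  [/\ w \in Kl, toG bm * toG w = toG w * toG bm
    & forall p, valid p -> act_b (act_k w p) = act_k w (act_b p)].
Proof.
have Kv : vm \in Kl by rewrite block_Kl.
have vb : toG bm * toG vm = toG vm * toG bm.
  by rewrite -!toG_mul //; congr toG; apply/eqP; vm_compute.
have v1 : [/\ mid \in Kl, toG bm * toG mid = toG mid * toG bm
    & forall p, valid p -> act_b (act_k mid p) = act_k mid (act_b p)].
  by split=> [||p _]; rewrite ?Kl_id ?toG_id ?mulg1 ?mul1g // !(act_k1 R).
have step w' : [/\ w' \in Kl, toG bm * toG w' = toG w' * toG bm
    & forall p, valid p -> act_b (act_k w' p) = act_k w' (act_b p)] ->
   [/\ mmul vm w' \in Kl, toG bm * toG (mmul vm w') = toG (mmul vm w') * toG bm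
    & forall p, valid p -> act_b (act_k (mmul vm w') p) = act_k (mmul vm w') (act_b p)].
  move=> [Kw wb wp]; split=> [||p vp]; first by rewrite (Kl_mul R).
    by rewrite toG_Kl // mulgA vb -mulgA wb mulgA.
  by rewrite !(act_kM R) act_bv ?wp // act_k_valid.
have vE : vm = mmul vm mid by rewrite (mmul1 R).
have v2 : [/\ vm \in Kl, toG bm * toG vm = toG vm * toG bm
    & forall p, valid p -> act_b (act_k vm p) = act_k vm (act_b p)].
  by rewrite vE; apply: step.
rewrite !in_cons => /or4P[/eqP->|/eqP->|/eqP->|/predU1P[->|//]] //.
  exact: step.
by apply/step/step.
Qed.

(** The height separates the two kinds of elements. Two factorizations [k b k'] differ by some m in
    K with [b^-1 m b] in K; by [stabilizer_check] it is a power of [v], which commutes with [b] both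
    in Gamma and on states. *)
Lemma acts_fun g f f' p : acts g f -> acts g f' -> valid p -> f p = f' p.
Proof.
have nK k k1 k2 : k \in Kl -> k1 \in Kl -> k2 \in Kl ->
    toG k <> toG k1 * toG bm * toG k2.
  move=> Kk K1 K2 /(congr1 hG).
  by rewrite hG_Kl // hG_mulKl // hG_Klmul // hG_b.
case=> [[k [Kk gk E]]|[k [k' [Kk Kk' gk E]]]];
  case=> [[k1 [K1 gk1 E1]]|[k1 [k1' [K1 K1' gk1 E1]]]] vp; rewrite E E1.
- by rewrite (toG_Kl_inj (R:=R) Kk K1) // -gk.
- by case: (nK k k1 k1') => //; rewrite -gk.
- by case: (nK k1 k k') => //; rewrite -gk1.
pose m := mmul (minv k1) k; pose m' := mmul k1' (minv k').
have Km : m \in Kl by rewrite (Kl_mul R) ?(Kl_inv R).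
have Km' : m' \in Kl by rewrite (Kl_mul R) ?(Kl_inv R).
have mb : (toG bm)^-1 * toG m * toG bm = toG m'.
  rewrite /m /m' (toG_Kl (Kl_inv R K1) Kk) (toG_Kl K1' (Kl_inv R Kk')).
  rewrite (toG_KlV K1) (toG_KlV Kk').
  have -> : toG k = toG k1 * toG bm * toG k1' * (toG k')^-1 * (toG bm)^-1.
    by rewrite -gk1 gk !mulgK.
  by rewrite !mulgA !mulgVK mulVg mul1g.
have hm : ht (mmul bVm (mmul m bm)) = 0%N.
  have ubV : unim bVm by exact: (proj1 (unim_inv R bm_unim)).
  have umb := unim_mul R (uKl Km) bm_unim.
  rewrite -(hG_toG R (unim_mul R ubV umb)) (toG_mul R ubV umb).
  rewrite (toG_mul R (uKl Km) bm_unim) (toG_inv R bm_unim) mulgA mb.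
  exact: (hG_Kl R Km').
have := stabilizer_checkP; rewrite /stabilizer_check => /allP/(_ m Km).
rewrite hm eqxx => mv; have [_ bw wp] := vpow_comm mv.
have m'E : m' = m.
  have E2 : toG m' = toG m by rewrite -mb -mulgA -bw mulKg.
  exact: (toG_Kl_inj Km' Km E2).
have kE : k = mmul k1 m by rewrite /m (mmulA R) (mmulV R) ?uKl // (m1mul R).
have k1'E : k1' = mmul m k'.
  by rewrite -m'E /m' -(mmulA R) (mmVl R) ?uKl // (mmul1 R).
clearbody m m'; rewrite {1}kE k1'E !(act_kM R) wp //.
exact: act_k_valid.
Qed.

Lemma acts_mulKl g f k : k \in Kl -> acts g f ->
  acts (toG k * g) (fun p => act_k k (f p)).
Proof.
move=> Kk [[k1 [K1 -> E]]|[k1 [k2 [K1 K2 -> E]]]].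
  left; exists (mmul k k1); split; rewrite ?(Kl_mul R) ?toG_Kl // => p.
  by rewrite E (act_kM R).
right; exists (mmul k k1), k2; split; rewrite ?(Kl_mul R) ?toG_Kl ?mulgA // => p.
by rewrite E (act_kM R).
Qed.
Lemma acts_Klmul g f k : k \in Kl -> acts g f ->
  acts (g * toG k) (fun p => f (act_k k p)).
Proof.
move=> Kk [[k1 [K1 -> E]]|[k1 [k2 [K1 K2 -> E]]]].
  left; exists (mmul k1 k); split; rewrite ?(Kl_mul R) ?toG_Kl // => p.
  by rewrite E (act_kM R).
right; exists k1, (mmul k2 k); split; rewrite ?(Kl_mul R) ?toG_Kl ?mulgA // => p.
by rewrite E (act_kM R).
Qed.

Lemma double_bmb w m w' : w \in vpows -> m \in Kl -> w' \in vpows ->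
  toG bm * toG (mmul (mmul w m) w') * toG bm =
    toG w * (toG bm * toG m * toG bm) * toG w' /\
  forall p, valid p -> act_b (act_k (mmul (mmul w m) w') (act_b p)) =
    act_k w (act_b (act_k m (act_b (act_k w' p)))).
Proof.
move=> /vpow_comm[Kw bw actw] Km /vpow_comm[Kw' bw' actw']; split.
  rewrite (toG_Kl (Kl_mul R Kw Km) Kw') (toG_Kl Kw Km) !mulgA bw.
  by rewrite -[RHS]mulgA bw' !mulgA.
move=> p vp; have vm := act_k_valid R Km (act_b_valid R (act_k_valid R Kw' vp)).
by rewrite -(actw _ vm) (actw' _ vp) !(act_kM R).
Qed.

Lemma double_decomposition m : m \in Kl ->
  (hG (toG bm * toG m * toG bm)%g <= 2)%N -> exists m' w w',
  [/\ m' \in double_reps Kl, m' \in Kl, w \in vpows, w' \in vpows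
    & m = mmul (mmul w m') w'].
Proof.
move=> Km; have umb := unim_mul R (uKl Km) bm_unim.
rewrite -mulgA -(toG_mul R (uKl Km) bm_unim) -(toG_mul R bm_unim umb).
rewrite (hG_toG R (unim_mul R bm_unim umb)) => h2.
have := allP double_checkP m Km; rewrite h2.
move=> /allpairsP[p [Dp /allpairsP[q [W1 W2 qE]] ->]].
exists p.1, q.1, q.2; split=> //; first exact: (allP double_repsP).
by rewrite qE.
Qed.

Lemma acts_bmb_rep m : m \in double_reps Kl -> m \in Kl ->
  (hG (toG bm * toG m * toG bm)%g <= 1)%N ->
  exists2 f, acts (toG bm * toG m * toG bm) f
    & forall p, valid p -> f p = act_b (act_k m (act_b p)).
Proof.
move=> Dm Km; have umb := unim_mul R (uKl Km) bm_unim.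
have uM := unim_mul R bm_unim umb.
have ME : toG bm * toG m * toG bm = toG (mmul bm (mmul m bm)).
  by rewrite (toG_mul R bm_unim umb) (toG_mul R (uKl Km) bm_unim) mulgA.
rewrite ME (hG_toG R uM) => h1.
have := relation_checkP; rewrite /relation_check => /allP/(_ m Dm).
set M := mmul bm (mmul m bm) in uM ME h1 *; clearbody M.
rewrite -/act_b; case: (ht M) h1 => [_|[_|//]]; rewrite lazy_hasE => /hasP[k Kk].
  case: ifP => // pk /allP bP; exists (act_k k).
    by left; exists k; split; rewrite // (proj2 (toG_eq R uM (uKl Kk)) pk).
  move=> p /valid_origin[q qO ->]; rewrite !(act_k_shift, act_b_shift).
  by rewrite (eqP (bP q qO)).
case: (ht _) => //; rewrite lazy_hasE => /hasP[k' Kk'].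
case: ifP => // pk /allP bP; have ubk' := unim_mul R bm_unim (uKl Kk').
exists (fun p => act_k k (act_b (act_k k' p))).
  right; exists k, k'; split=> //.
  rewrite (proj2 (toG_eq R uM (unim_mul R (uKl Kk) ubk')) pk).
  by rewrite (toG_mul R (uKl Kk) ubk') (toG_mul R bm_unim (uKl Kk')) mulgA.
move=> p /valid_origin[q qO ->]; rewrite !(act_k_shift, act_b_shift).
by rewrite (eqP (bP q qO)).
Qed.

Lemma acts_bmb m : m \in Kl -> (hG (toG bm * toG m * toG bm)%g <= 1)%N ->
  exists2 f, acts (toG bm * toG m * toG bm) f
    & forall p, valid p -> f p = act_b (act_k m (act_b p)).
Proof.
move=> Km h1; have [m' [w [w' [Dm' Km' Ww Ww' mE]]]] := double_decomposition Km (leqW h1).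
have [Kw _ _] := vpow_comm Ww; have [Kw' _ _] := vpow_comm Ww'.
have [gE pE] := double_bmb Ww Km' Ww'.
rewrite mE gE (hG_mulKl _ Kw') (hG_Klmul _ Kw) in h1 *.
have [f af fE] := acts_bmb_rep Dm' Km' h1.
exists (fun p => act_k w (f (act_k w' p))).
  exact: (acts_Klmul Kw' (acts_mulKl Kw af)).
by move=> p vp; rewrite (fE _ (act_k_valid R Kw' vp)) pE.
Qed.

(** The only case with content is [(k b k') (k1 b k1')], where the factor [b (k' k1) b] is covered
    by [acts_bmb]. *)
Lemma acts_mul s t f f' f'' p : acts s f -> acts t f' -> acts (s * t) f'' ->
  valid p -> f'' p = f (f' p).
Proof.
case=> [[k [Kk -> E]]|[k [k' [Kk Kk' -> E]]]] at_ ast vp.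
  by rewrite E (acts_fun ast (acts_mulKl Kk at_) vp).
case: at_ ast => [[k1 [K1 -> E1]]|[k1 [k1' [K1 K1' -> E1]]]] ast.
  have as_ : acts (toG k * toG bm * toG k') f by right; exists k, k'.
  by rewrite E1 (acts_fun ast (acts_Klmul K1 as_) vp).
have Km : mmul k' k1 \in Kl by rewrite (Kl_mul R).
have gE : toG k * toG bm * toG k' * (toG k1 * toG bm * toG k1') =
    toG k * (toG bm * toG (mmul k' k1) * toG bm) * toG k1'.
  by rewrite toG_Kl // !mulgA.
have hm : (hG (toG bm * toG (mmul k' k1) * toG bm)%g <= 1)%N.
  by have := acts_ht ast; rewrite gE hG_mulKl // hG_Klmul.
have [f0 a0 f0E] := acts_bmb Km hm.
rewrite gE in ast; have a1 := acts_Klmul K1' (acts_mulKl Kk a0).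
rewrite (acts_fun ast a1 vp) f0E ?act_k_valid // E E1 (act_kM R) //.
Qed.

End Development.

(** * The action of Gamma *)

Section Representation.
Variable R : realType.
Local Notation Gamma := (Gamma R).
Local Notation toG := (toG R).
Local Notation hG := (@hG R).
Local Open Scope group_scope.
Implicit Types (g s t : Gamma) (p : state).

Lemma adjE M N : unim M -> unim N ->
  adj M N = (hG ((toG M)^-1 * toG N)%g <= 1)%N.
Proof.
move=> uM uN; have [uV _] := unim_inv R uM.
by rewrite -toG_inv // -toG_mul // hG_toG // (unim_mul R).
Qed.

(** The cube of [b] is scalar. The form [b 1 b] makes [acts_bmb] applicable. *)
Lemma toGb_inv : (toG bm)^-1 = toG bm * toG mid * toG bm.
Proof.
apply: (mulgI (toG bm)); rewrite mulgV toG_id mulg1.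
have bb : unim (mmul bm bm) by exact: (unim_mul R bm_unim bm_unim).
have b3 : unim (mmul bm (mmul bm bm)) by exact: (unim_mul R bm_unim bb).
rewrite -(toG_mul R bm_unim bm_unim) -(toG_mul R bm_unim bb) -toG_id.
apply: (proj2 (toG_eq R (uKl Kl_id) b3)).
by vm_compute.
Qed.

Lemma acts_bV : exists f, @acts R (toG bm)^-1 f.
Proof.
have h : (hG (toG bm * toG mid * toG bm)%g <= 1)%N.
  by rewrite -toGb_inv hGV hG_b.
have [f af _] := acts_bmb Kl_id h.
by exists f; rewrite toGb_inv.
Qed.

(** For g of height 1, [descent] makes some [g k b] of height 0, hence an element of K, and the
    inverse of [b] acts by [acts_bV]. *)
Lemma acts_total g : (hG g <= 1)%N -> exists f, acts g f.
Proof.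
have at0 h : hG h = 0%N -> exists2 k, k \in Kl & h = toG k.
  move=> h0; have [k Kk pk] := ht0_Kl R (gM_unim h) h0; exists k => //.
  by rewrite -[LHS]gMK; apply: (proj2 (toG_eq R (gM_unim h) (uKl Kk))).
case: (posnP (hG g)) => [/at0[k Kk ->] _|g0 g1].
  by exists (act_k k); left; exists k.
have [k Kk [lt _]] := descent R (gM_unim g) g0.
have uMk : unim (mmul (gM g) k) by exact: (unim_mul R (gM_unim g) (uKl Kk)).
have E : g * toG k * toG bm = toG (mmul (mmul (gM g) k) bm).
  rewrite (toG_mul R uMk bm_unim) (toG_mul R (gM_unim g) (uKl Kk)).
  by rewrite gMK.
have h0 : hG (g * toG k * toG bm)%g = 0%N.
  rewrite E (hG_toG R (unim_mul R uMk bm_unim)).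
  by apply/eqP; rewrite -leqn0 -ltnS; apply: leq_trans lt g1.
have [k1 K1 gE] := at0 _ h0.
have [f af] := acts_bV.
exists (fun p => act_k k1 (f (act_k (minv k) p))).
have -> : g = toG k1 * ((toG bm)^-1 * toG (minv k)).
  by rewrite -gE (toG_KlV R Kk) !mulgA !mulgK.
exact: (acts_mulKl K1 (acts_Klmul (Kl_inv R Kk) af)).
Qed.

Definition local_action g : state -> state :=
  if pselect (exists f, acts g f) is left h then proj1_sig (cid h) else id.

Lemma local_actionP g : (hG g <= 1)%N -> acts g (local_action g).
Proof.
move=> /acts_total h; rewrite /local_action; case: pselect => // h'.
exact: (proj2_sig (cid h')).
Qed.

(** The apex is [k b] with k from [descent]. In a competitor [s = k1 b k2] the factor [k2] affects
    no height, and [k' = k^-1 k1] brings the rest into the form treated there. *)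
Lemma linked g : (0 < hG g)%N ->
  exists c, [/\ (hG c <= 1)%N, (hG (g * c)%g < hG g)%N &
    forall s, (hG s <= 1)%N -> (hG (g * s)%g <= hG g)%N ->
    (hG (s^-1 * c)%g <= 1)%N \/
    exists t, [/\ (hG t <= 1)%N, (hG (s^-1 * t)%g <= 1)%N,
                  (hG (t^-1 * c)%g <= 1)%N & (hG (g * t)%g < hG g)%N]].
Proof.
move=> g0; have ug := gM_unim g; have ub := bm_unim.
have [k Kk [lt link]] := descent R ug g0; have uk := uKl Kk.
have ugk := unim_mul R ug uk.
have hE N : unim N -> hG (g * (toG k * toG N))%g = ht (mmul (mmul (gM g) k) N).
  move=> uN; rewrite -(hG_toG R (unim_mul R ugk uN)) (toG_mul R ugk uN).
  by rewrite (toG_mul R ug uk) gMK mulgA.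
have hb : hG (toG k * toG bm)%g = 1%N by rewrite (hG_Klmul _ Kk) hG_b.
exists (toG k * toG bm); rewrite hb; split=> //; first by rewrite (hE _ ub).
move=> s s1 gs; have [f [[k1 [K1 sE _]]|[k1 [k2 [K1 K2 sE _]]]]] := acts_total s1.
  left; rewrite sE -(toG_KlV R K1) (hG_Klmul _ (Kl_inv R K1)).
  by rewrite hb.
pose k' := mmul (minv k) k1.
have Kk' : k' \in Kl := Kl_mul R (Kl_inv R Kk) K1.
have uk'b : unim (mmul k' bm) := unim_mul R (uKl Kk') ub.
have s'E : s = toG k * toG (mmul k' bm) * toG k2.
  rewrite sE (toG_mul R (uKl Kk') ub) (toG_Kl R (Kl_inv R Kk) K1).
  by rewrite (toG_KlV R Kk) !mulgA mulgV mul1g.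
have sV X : hG (s^-1 * (toG k * X))%g = hG ((toG (mmul k' bm))^-1 * X)%g.
  rewrite s'E !invgM -(toG_KlV R K2) -mulgA (hG_Klmul _ (Kl_inv R K2)).
  by rewrite -!mulgA mulKg.
have hs : (ht (mmul (mmul (gM g) k) (mmul k' bm)) <= hG g)%N.
  by rewrite -(hE _ uk'b) -(hG_mulKl _ K2) -mulgA -s'E.
have [a|[N [nN aN hN]]] := link k' Kk' hs.
  by left; rewrite sV -(adjE uk'b ub).
have uN : unim N := allP hub_neighbours_unim _ nN.
have /andP[aNb /hasP[k3 K3 /eqP NE]] := allP hub_neighboursP _ nN.
right; exists (toG k * toG N); split.
- rewrite (hG_Klmul _ Kk) NE (toG_mul R (uKl K3) ub) (hG_Klmul _ K3).
  by rewrite hG_b.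
- by rewrite sV -(adjE uk'b uN).
- by rewrite invgM -mulgA mulKg -(adjE uN ub).
- by rewrite (hE _ uN).
Qed.

Let h1 : hG 1%g = 0%N. Proof. by rewrite -toG_id (hG_Kl R Kl_id). Qed.

Let act_valid s p : (hG s <= 1)%N -> valid p -> valid (local_action s p).
Proof. by move=> s1; apply: (acts_valid (local_actionP s1)). Qed.

Let act1 p : valid p -> local_action 1 p = p.
Proof.
move=> vp; have a1 : acts (1 : Gamma) (act_k mid).
  by left; exists mid; split; rewrite ?toG_id //; exact: Kl_id.
rewrite (acts_fun (local_actionP _) a1 vp) ?h1 //.
exact: (act_k1 R).
Qed.

Let actM s t p : (hG s <= 1)%N -> (hG t <= 1)%N -> (hG (s * t)%g <= 1)%N ->
  valid p -> local_action (s * t) p = local_action s (local_action t p).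
Proof.
move=> s1 t1 st1 vp.
exact: (acts_mul (local_actionP s1) (local_actionP t1) (local_actionP st1) vp).
Qed.

Definition action : Gamma -> state -> state := extension local_action linked.

Lemma action_valid g p : valid p -> valid (action g p).
Proof. exact: (extension_valid (@hGV R) act_valid linked). Qed.
Lemma actionM g h p : valid p -> action (g * h) p = action g (action h p).
Proof. exact: (extension_mul (@hGV R) act_valid act1 actM h1 linked). Qed.

Lemma action_acts g f p : acts g f -> valid p -> action g p = f p.
Proof.
move=> af vp; have g1 := acts_ht af.
rewrite /action (extensionE (@hGV R) act_valid act1 actM h1 linked g1 vp).
exact: (acts_fun (local_actionP g1) af vp).
Qed.

End Representation.

(** * The index of [Pi] *)

Lemma Kl_uniq : uniq Kl. Proof. by rewrite KlE; vm_compute. Qed.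

(** Indices beyond the program yield [slp0], so the conclusion holds for every n. *)
Lemma slp_ind (P : slp_entry -> Prop) :
  (forall x y, P x -> P y -> P (slp_mul x y)) -> (forall x, P x -> P (slp_inv x)) ->
  P slp0 -> P (a1m, (1, 0, 0)%BZ) -> P (a2m, (0, 1, 0)%BZ) -> P (a3m, (0, 0, 1)%BZ) ->
  forall n, P (nth slp0 slp n).
Proof.
move=> PM PV P0 P1 P2 P3; rewrite slpE /slp_run.
have : forall n, P (nth slp0 slp_init n).
  by do 7?[case=> [|]]; rewrite /slp_init /=; auto; move=> n; rewrite nth_nil.
elim: slp_steps slp_init => //= st sts IH s Ps; apply: IH => n.
rewrite nth_rcons; case: ifP => // _; case: ifP => // _.
by case: st => *; [apply: PM|apply: PV].
Qed.

Section Cosets.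
Variable R : realType.
Local Notation Gamma := (Gamma R).
Local Notation toG := (toG R).
Local Notation hG := (@hG R).
Local Notation action := (@action R).
Local Open Scope group_scope.
Implicit Types (g h : Gamma) (p : state).

(** K and [b] generate Gamma: by [linked], a factor of height at most 1 can always be split off so
    that the height drops. *)
Lemma Gamma_ind (P : Gamma -> Prop) : P 1 ->
  (forall k g, k \in Kl -> P g -> P (toG k * g)) ->
  (forall g, P g -> P (toG bm * g)) -> forall g, P g.
Proof.
move=> P1 PK Pb; have PS s g : (hG s <= 1)%N -> P g -> P (s * g).
  move=> /acts_total[f [[k [Kk -> _]]|[k [k' [Kk Kk' -> _]]]]] Pg; first exact: PK.
  by rewrite -!mulgA; apply: (PK) => //; apply: Pb; apply: PK.
move=> g; have [n] := ubnP (hG g); elim: n g => // n IH g; rewrite ltnS => gn.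
have [g0|g0] := posnP (hG g); first by rewrite -[g]mulg1; apply: PS; rewrite ?g0.
have g0' : (0 < hG g^-1%g)%N by rewrite hGV.
have [c [c1 lt _]] := linked g0'; rewrite -[g](mulVKg c); apply: PS => //.
apply: IH; rewrite -hGV invgM invgK (leq_trans lt) // hGV.
exact: gn.
Qed.

Lemma action_k k p : k \in Kl -> valid p -> action (toG k) p = act_k k p.
Proof. by move=> Kk; apply: action_acts; left; exists k. Qed.
Lemma action_b p : valid p -> action (toG bm) p = act_b p.
Proof.
have Kid := Kl_id; apply: (@action_acts R _ act_b); right; exists mid, mid.
by split; rewrite ?toG_id ?mulg1 ?mul1g // => q; rewrite !(act_k1 R).
Qed.
Lemma action1 p : valid p -> action 1 p = p.
Proof. by move=> vp; rewrite -toG_id action_k ?Kl_id ?(act_k1 R). Qed.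

Lemma valid_shift d p : valid (pshift d p) = valid p. Proof. by []. Qed.
Lemma action_shift g d p : valid p -> action g (pshift d p) = pshift d (action g p).
Proof.
move: g p; apply: Gamma_ind => [p vp|k g Kk IH p vp|g IH p vp].
- by rewrite !action1 ?valid_shift.
- by rewrite !actionM // IH // !action_k ?act_k_shift // ?valid_shift ?action_valid.
- by rewrite !actionM // IH // !action_b ?act_b_shift // ?valid_shift ?action_valid.
Qed.

Lemma base_valid : valid base_state. Proof. exact: Kl_id. Qed.

Definition label g := (action g base_state).2.
(** The stabilizer of the base coset, whatever happens to its label; a priori larger than [Pi]. As
    shifts commute with the action, labels are additive on it. *)
Definition stab : {pred Gamma} := fun g => (action g base_state).1 == base_state.1.

Lemma stabE g : (g \in stab) = ((action g base_state).1 == base_state.1).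
Proof. by []. Qed.
Lemma stabP g : reflect (action g base_state = pshift (label g) base_state) (g \in stab).
Proof.
rewrite /label /pshift padd0; apply: (iffP eqP) => [|->//].
by case: (action g _) => x y /= ->.
Qed.
Lemma action_Mstab g h : h \in stab ->
  action (g * h) base_state = pshift (label h) (action g base_state).
Proof.
by move=> /stabP E; rewrite actionM ?base_valid // E action_shift ?base_valid.
Qed.
Lemma label_mul g h : h \in stab -> label (g * h) = padd (label g) (label h).
Proof. by move=> /(action_Mstab g); rewrite /label => ->. Qed.
Lemma label1 : label 1 = (0, 0)%BZ.
Proof. by rewrite /label action1 ?base_valid. Qed.

Fact stab1 : 1 \in stab.
Proof. by rewrite stabE action1 ?base_valid. Qed.
Fact stab_mul : mulg_closed stab.
Proof.
by move=> g h gs hs; rewrite stabE action_Mstab.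
Qed.
Fact stab_inv : invg_closed stab.
Proof.
move=> g /stabP gs; rewrite stabE.
have := action1 base_valid; rewrite -(mulVg g) actionM ?base_valid // gs.
rewrite action_shift ?base_valid //.
by move=> /(congr1 fst) /= ->.
Qed.
HB.instance Definition _ := isMulClosed.Build Gamma stab stab_mul.
HB.instance Definition _ := isMul1Closed.Build Gamma stab stab1.
HB.instance Definition _ := isInvClosed.Build Gamma stab stab_inv.

Lemma generatorP l a r t : generator_check Kl btab (labels_of slp) (l, a, r, t) ->
  [/\ unim a, toG a \in stab & label (toG a) = t].
Proof.
rewrite /generator_check -/act_b => /and5P[Kl1 Kr ua pe /eqP E].
have ur := uKl Kr; have ubr := unim_mul R bm_unim ur.
have aE : action (toG a) base_state = (0%N, mid, t).
  rewrite (proj2 (toG_eq R ua (unim_mul R (uKl Kl1) ubr)) pe) -E.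
  rewrite (toG_mul R (uKl Kl1) ubr) (toG_mul R bm_unim ur).
  have v1 := act_k_valid R Kr base_valid; have v2 := act_b_valid R v1.
  rewrite (actionM _ _ base_valid) (actionM _ _ base_valid).
  by rewrite (action_k Kr base_valid) (action_b v1) (action_k Kl1 v2).
by split=> //; rewrite ?/label ?stabE aE.
Qed.
Lemma generator1P : [/\ unim a1m, toG a1m \in stab & label (toG a1m) = (2, 1)%BZ].
Proof. by have [/generatorP h _ _] := generators_checkP. Qed.
Lemma generator2P : [/\ unim a2m, toG a2m \in stab & label (toG a2m) = (3, -2)%BZ].
Proof. by have [_ /generatorP h _] := generators_checkP. Qed.
Lemma generator3P : [/\ unim a3m, toG a3m \in stab & label (toG a3m) = (0, -1)%BZ].
Proof. by have [_ _ /generatorP h] := generators_checkP. Qed.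

Definition Pi : {pred Gamma} := generated [set toG a1m; toG a2m; toG a3m].
HB.instance Definition _ := GroupClosed.on Pi.

Lemma Pi_gen1 : toG a1m \in Pi.
Proof. by apply/generatedP => H; apply; left; left. Qed.
Lemma Pi_gen2 : toG a2m \in Pi.
Proof. by apply/generatedP => H; apply; left; right. Qed.
Lemma Pi_gen3 : toG a3m \in Pi.
Proof. by apply/generatedP => H; apply; right. Qed.
Lemma Pi_stab g : g \in Pi -> g \in stab.
Proof.
move=> /generatedP; apply => a [[->|->]|->].
- by have [] := generator1P.
- by have [] := generator2P.
- by have [] := generator3P.
Qed.

Lemma slp_Pi n : unim (nth slp0 slp n).1 /\ toG (nth slp0 slp n).1 \in Pi.
Proof.
apply: (@slp_ind (fun e => unim e.1 /\ toG e.1 \in Pi)).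
- move=> x y [ux Px] [uy Py]; split; first exact: (unim_mul R ux uy).
  by rewrite [(slp_mul _ _).1]/= (toG_mul R ux uy) gpredM.
- move=> x [ux Px]; split; first exact: (proj1 (unim_inv R ux)).
  by rewrite [(slp_inv _).1]/= (toG_inv R ux) gpredV.
- split; first exact: (uKl Kl_id).
  by rewrite [slp0.1]/= toG_id gpred1.
- by split; [have [] := generator1P|exact: Pi_gen1].
- by split; [have [] := generator2P|exact: Pi_gen2].
- by split; [have [] := generator3P|exact: Pi_gen3].
Qed.

Lemma xm_unim i : unim (xm i).
Proof.
elim: i => [|i IH]; first exact: (uKl Kl_id).
exact: (unim_mul R bm_unim IH).
Qed.

(** This bounds the index above: the table rewrites [b k b^i] as [k' b^j] times an element of
    [Pi]. *)
Lemma coset_decomposition g : exists i k h,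
  [/\ (i < 3)%N, k \in Kl, h \in Pi & g = toG k * toG (xm i) * h].
Proof.
move: g; apply: Gamma_ind => [|k' g Kk' [i [k [h [i3 Kk Ph ->]]]]|g [i [k [h [i3 Kk Ph ->]]]]].
- exists 0%N, mid, 1; split; rewrite ?Kl_id ?gpred1 //.
  by rewrite [xm 0%N]/= toG_id !mulg1.
- exists i, (mmul k' k), h; split=> //; first exact: (Kl_mul R).
  by rewrite (toG_Kl R Kk' Kk) !mulgA.
have [j [k' [n [_ j3 Kk' _ pe]]]] := table_find R i3 Kk.
have [un Pn] := slp_Pi n.
have ui := xm_unim i; have uj := xm_unim j; have uk := uKl Kk; have uk' := uKl Kk'.
exists j, k', (toG (nth slp0 slp n).1 * h); split; rewrite ?gpredM //.
have uki := unim_mul R uk ui; have ukj := unim_mul R uk' uj.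
have := proj2 (toG_eq R (unim_mul R bm_unim uki) (unim_mul R ukj un)) pe.
rewrite (toG_mul R bm_unim uki) (toG_mul R uk ui) (toG_mul R ukj un) (toG_mul R uk' uj).
by move=> E; rewrite !mulgA -E !mulgA.
Qed.

(** This bounds the index below: the image of the base state tells the cosets apart. *)
Lemma action_rep i k h : (i < 3)%N -> k \in Kl -> h \in Pi ->
  (action (toG k * toG (xm i) * h) base_state).1 = (i, k).
Proof.
move=> i3 Kk /Pi_stab hs; rewrite action_Mstab // actionM ?base_valid //.
have -> : action (toG (xm i)) base_state = (i, mid, (0, 0)%BZ).
  elim: i i3 => [|i IH] i3; first by rewrite toG_id action1 ?base_valid.
  rewrite [xm _]/= (toG_mul R bm_unim (xm_unim i)) actionM ?base_valid //.
  have i3' := ltnW i3; rewrite IH // action_b; last by rewrite /valid i3' Kl_id.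
  apply/eqP; have := cosets_checkP; rewrite /cosets_check => /allP; apply.
  by case: i i3 {IH i3'} => [|[|]].
rewrite action_k // /valid ?i3 ?Kl_id //.
by rewrite /= (mmul1 R).
Qed.

Lemma coset_inj i k h j k' h' : (i < 3)%N -> k \in Kl -> (j < 3)%N -> k' \in Kl ->
  h \in Pi -> h' \in Pi ->
  toG k * toG (xm i) * h = toG k' * toG (xm j) * h' -> (i, k) = (j, k').
Proof.
move=> i3 Kk j3 Kk' Ph Ph' E.
by rewrite -(action_rep i3 Kk Ph) -(action_rep j3 Kk' Ph') E.
Qed.

Lemma Pi_index : has_index Pi 864.
Proof.
pose rep n := toG (nth mid Kl (n %/ 3)) * toG (xm (n %% 3)).
have Krep n : (n < 864)%N -> nth mid Kl (n %/ 3) \in Kl.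
  by move=> n8; apply: mem_nth; rewrite Kl_size ltn_divLR.
pose coset (g : Gamma) : set Gamma := [set g * h | h in [set` Pi]]%classic.
rewrite /has_index -[X in (X #= _)%card]/(left_cosets Pi).
have <- : [set coset (rep n) | n in `I_864]%classic = left_cosets Pi.
  apply/seteqP; split=> [_ [n _ <-]|_ [g _ <-]]; first by exists (rep n).
  have [i [k [h [i3 Kk Ph ->]]]] := coset_decomposition g.
  exists (index k Kl * 3 + i)%N.
    by move: Kk i3; rewrite -index_mem Kl_size /=; lia.
  rewrite /rep divnMDl // divn_small // addn0 modnMDl modn_small // nth_index //.
  apply/seteqP; split=> [_ [h' Ph' <-]|_ [h' Ph' <-]].
    exists (h^-1 * h'); last by rewrite !mulgA mulgK.
    by rewrite /= gpredM ?gpredV.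
  exists (h * h'); last by rewrite !mulgA.
  by rewrite /= gpredM.
apply: inj_card_eq => n m; rewrite !inE /= => n8 m8 E.
have [h Ph hE] : coset (rep m) (rep n) by rewrite -E; exists 1; rewrite ?mulg1 //= gpred1.
have n3 k : (k %% 3 < 3)%N by rewrite ltn_pmod.
have P1 : 1 \in Pi by apply: gpred1.
have hE' : rep n * 1 = rep m * h by rewrite mulg1.
have := coset_inj (n3 n) (Krep n n8) (n3 m) (Krep m m8) P1 Ph hE'.
move=> [e1 /eqP]; rewrite nth_uniq ?Kl_uniq ?Kl_size ?ltn_divLR // => /eqP e2.
by rewrite (divn_eq n 3) (divn_eq m 3) e1 e2.
Qed.

End Cosets.

(** * Elements of finite order *)

Section FixedPoints.
Variable R : realType.
Local Notation Gamma := (Gamma R).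
Local Notation toG := (toG R).
Local Notation hG := (@hG R).
Local Notation action := (@action R).
Local Open Scope group_scope.
Implicit Types (g h : Gamma) (p q : state).

Lemma fixes_refl p : fixes p p. Proof. by rewrite /fixes !eqxx. Qed.
Lemma fixes_shift d p q : fixes (pshift d p) (pshift d q) = fixes p q.
Proof.
rewrite /fixes /pshift; congr (_ && _); apply/eqP/eqP => [|->//].
case: p => a [x y]; case: q => a' [x' y']; rewrite /padd /= => -[ex ey].
by congr (_, _); lia.
Qed.
Lemma fixes_kl k p q : fixes (act_k k p) q = fixes p q.
Proof. by case: p => [[i m] t]. Qed.
Lemma fixes_kr k p q : fixes p (act_k k q) = fixes p q.
Proof. by case: q => [[i m] t]. Qed.

Lemma act_b_fixes p : valid p -> fixes p (act_b p) = false.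
Proof.
move=> /valid_origin[q qO ->]; rewrite act_b_shift fixes_shift.
by apply/negbTE; have := allP torsion_check1P q qO.
Qed.
Lemma act_bmb_fixes_rep m p : m \in double_reps Kl ->
  ht (mmul bm (mmul m bm)) = 2%N -> valid p ->
  fixes p (act_b (act_k m (act_b p))) = false.
Proof.
move=> Dm h2 /valid_origin[q qO ->].
rewrite act_b_shift act_k_shift act_b_shift fixes_shift; apply/negbTE.
have := allP torsion_check2P m Dm; rewrite h2 eqxx => /allP/(_ q qO).
exact.
Qed.
Lemma act_bmb_fixes m p : m \in Kl -> hG (toG bm * toG m * toG bm)%g = 2%N ->
  valid p -> fixes p (act_b (act_k m (act_b p))) = false.
Proof.
move=> Km h2 vp; have [m' [w [w' [Dm' Km' Ww Ww' mE]]]] :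
    exists m' w w', [/\ m' \in double_reps Kl, m' \in Kl, w \in vpows, w' \in vpows
    & m = mmul (mmul w m') w'] by apply: (@double_decomposition R m Km); rewrite h2.
have [Kw _ _] := vpow_comm R Ww; have [Kw' _ _] := vpow_comm R Ww'.
have [gE pE] := double_bmb R Ww Km' Ww'.
rewrite mE gE (hG_mulKl _ Kw') (hG_Klmul _ Kw) in h2; rewrite mE (pE _ vp).
rewrite fixes_kr -(fixes_kl w'); apply: (act_bmb_fixes_rep Dm'); last first.
  exact: (act_k_valid R Kw' vp).
have um'b := unim_mul R (uKl Km') bm_unim.
rewrite -(hG_toG R (unim_mul R bm_unim um'b)) (toG_mul R bm_unim um'b).
by rewrite (toG_mul R (uKl Km') bm_unim) mulgA.
Qed.

Lemma action_k_fixed k p : k \in Kl -> valid p -> action (toG k) p = p ->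
  toG k = 1.
Proof.
case: p => [[i m] t] Kk vp; rewrite action_k // /act_k => -[mE].
have /andP[_ Km] := vp; have := congr1 (fun M => mmul M (minv m)) mE.
by rewrite -(mmulA R) (mmulV R) ?uKl // (mmul1 R) => ->; rewrite toG_id.
Qed.

(** Such a g lies in K, in [K b K] or, by [linked], in [K b K b K]. K acts freely on states, and the
    other two cases are excluded by the torsion checks, after the outer factors are moved into the
    state. *)
Lemma small_fixed g p : (hG g <= 2)%N -> valid p -> action g p = p -> g = 1.
Proof.
move=> g2 vp gp; have [g1|g1] := leqP (hG g) 1.
  have [f af] := acts_total g1.
  move: (af) gp => [[k [Kk -> _]]|[k [k' [Kk Kk' _ fE]]]]; first exact: action_k_fixed.
  rewrite (action_acts af vp) fE => pE.
  have := act_b_fixes (act_k_valid R Kk' vp).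
  by rewrite fixes_kl -(fixes_kr k) pE fixes_refl.
have g0 : (0 < hG g)%N := ltnW g1.
have gE2 : hG g = 2%N by apply/eqP; rewrite eqn_leq g2 g1.
have [c [c1 lt _]] := linked g0; rewrite gE2 ltnS in lt.
have cV1 : (hG c^-1%g <= 1)%N by rewrite hGV.
have gE : g = g * c * c^-1 by rewrite mulgK.
have [f [[k [Kk sE _]]|[k [k' [Kk Kk' sE _]]]]] := acts_total lt.
  by move: g1; rewrite gE sE (hG_Klmul _ Kk) ltnNge cV1.
have [f' [[k1 [K1 cE _]]|[k1 [k1' [K1 K1' cE _]]]]] := acts_total cV1.
  by move: g1; rewrite gE cE (hG_mulKl _ K1) ltnNge lt.
pose m := mmul k' k1; have Km : m \in Kl := Kl_mul R Kk' K1.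
have gE' : g = toG k * (toG bm * (toG m * (toG bm * toG k1'))).
  by rewrite gE sE cE (toG_Kl R Kk' K1) !mulgA.
have hm : hG (toG bm * toG m * toG bm)%g = 2%N.
  by rewrite -gE2 gE' (hG_Klmul _ Kk) !mulgA (hG_mulKl _ K1').
have v1 := act_k_valid R K1' vp; have v2 := act_b_valid R v1.
have v3 := act_k_valid R Km v2; have v4 := act_b_valid R v3.
move: gp; rewrite gE' !(actionM _ _ vp) (action_k R K1' vp) (action_b R v1).
rewrite (action_k R Km v2) (action_b R v3) (action_k R Kk v4) => pE.
have := act_bmb_fixes Km hm v1.
by rewrite fixes_kl -(fixes_kr k) pE fixes_refl.
Qed.

End FixedPoints.

(** * Positive eigenvectors of matrices of finite order *)

Section Eigenvector.
Variable R : realType.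
Local Notation C := R[i].
Local Notation ev := (@ev R).
Local Notation vec := (vec R).
Local Notation nC := (@nC R).
Implicit Types (x y : vec) (a : C).

Definition vscale a x : vec := (a * x.1.1, a * x.1.2, a * x.2).
Definition e3 : vec := (0, 0, 1).

Lemma hform_polar H x : hform H x = polar H x x.
Proof. by []. Qed.

Lemma vec_eq (x1 x2 x3 y1 y2 y3 : C) : x1 = y1 -> x2 = y2 -> x3 = y3 ->
  (x1, x2, x3) = (y1, y2, y3) :> vec.
Proof. by move=> -> -> ->. Qed.

Lemma vscaleD a x y : vscale a (x + y) = vscale a x + vscale a y.
Proof. by apply: vec_eq; apply: mulrDr. Qed.
Lemma vscaler0 a : vscale a 0 = 0. Proof. by apply: vec_eq; apply: mulr0. Qed.
Lemma vscaleDl a b x : vscale (a + b) x = vscale a x + vscale b x.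
Proof. by apply: vec_eq; apply: mulrDl. Qed.
Lemma vscale0r x : vscale 0 x = 0. Proof. by apply: vec_eq; apply: mul0r. Qed.
Lemma vscaleA a b x : vscale a (vscale b x) = vscale (a * b) x.
Proof. by apply: vec_eq; apply: mulrA. Qed.
Lemma vscale1 x : vscale 1 x = x.
Proof. by case: x => [[x1 x2] x3]; apply: vec_eq; apply: mul1r. Qed.

Lemma vmulD M x y : vmul (x + y) M = vmul x M + vmul y M.
Proof.
case: M => a b c d e f g h k; case: x => [[x1 x2] x3]; case: y => [[y1 y2] y3].
by apply: vec_eq; rewrite /=; ring.
Qed.
Lemma vmul0 M : vmul 0 M = 0 :> vec.
Proof.
by case: M => a b c d e f g h k; apply: vec_eq; rewrite !mul0r !addr0.
Qed.
Lemma vmul_vscale M a x : vmul (vscale a x) M = vscale a (vmul x M).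
Proof.
case: M => m1 m2 m3 m4 m5 m6 m7 m8 m9; case: x => [[x1 x2] x3].
by apply: vec_eq; rewrite /=; ring.
Qed.
Lemma polarDl H x x' y : polar H (x + x') y = polar H x y + polar H x' y.
Proof.
case: H => a b c d e f g h k; case: x => [[x1 x2] x3]; case: x' => [[x1' x2'] x3'].
by case: y => [[y1 y2] y3]; rewrite /=; ring.
Qed.
Lemma polarDr H x y y' : polar H x (y + y') = polar H x y + polar H x y'.
Proof.
case: H => a b c d e f g h k; case: x => [[x1 x2] x3]; case: y => [[y1 y2] y3].
by case: y' => [[y1' y2'] y3']; rewrite /= !rmorphD; ring.
Qed.
Lemma polar0l H y : polar H 0 y = 0.
Proof.
by case: H => a b c d e f g h k; case: y => [[y1 y2] y3]; rewrite /= !mul0r !addr0.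
Qed.
Lemma polar0r H x : polar H x 0 = 0.
Proof.
case: H => a b c d e f g h k; case: x => [[x1 x2] x3].
by rewrite /= !rmorph0 !(mulr0, addr0).
Qed.
Lemma polar_vscalel H a x y : polar H (vscale a x) y = a * polar H x y.
Proof.
case: H => m1 m2 m3 m4 m5 m6 m7 m8 m9; case: x => [[x1 x2] x3].
by case: y => [[y1 y2] y3]; rewrite /=; ring.
Qed.
Lemma polar_vscaler H a x y : polar H x (vscale a y) = a^* * polar H x y.
Proof.
case: H => m1 m2 m3 m4 m5 m6 m7 m8 m9; case: x => [[x1 x2] x3].
by case: y => [[y1 y2] y3]; rewrite /= !rmorphM; ring.
Qed.
Lemma polar_Fim x y M : unim M -> polar Fim (vmul x M) (vmul y M) = polar Fim x y.
Proof. by move=> /(unim_Fim R) E; rewrite polar_vmul E. Qed.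
Lemma polar_FimE (x1 x2 x3 y1 y2 y3 : C) :
  polar Fim (x1, x2, x3) (y1, y2, y3) =
  x1 * ((1 - rr R) * y1^* - y2^*) - x2 * (y1^* + (1 + rr R) * y2^*) + x3 * y3^*.
Proof. by rewrite /= !evE !evsq !zrE !zrm1; ring. Qed.
Lemma rr_conj : (rr R)^* = rr R.
Proof. by rewrite rrC; apply/CrealP; rewrite complex_real. Qed.
Lemma hform_Fim_real x : hform Fim x \is Num.real.
Proof.
apply/CrealP; rewrite hform_polar; case: x => [[x1 x2] x3]; rewrite polar_FimE.
move: (rr R) rr_conj => r rJ; rewrite !(rmorphD, rmorphB, rmorphM, rmorphN) /=.
rewrite !conjCK rJ rmorph1.
by ring.
Qed.

Lemma prim_root n : (0 < n)%N -> exists w : C, n.-primitive_root w.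
Proof.
pose p : {poly C} := 'X^n - 1; have [r Dp] := closed_field_poly_normal p.
move=> n_gt0; rewrite (monicP _) ?monicXnsubC // scale1r in Dp.
have rn1 : all n.-unity_root r by apply/allP=> w; rewrite -root_prod_XsubC -Dp.
have sz_r : (n < (size r).+1)%N.
  by rewrite -(size_prod_XsubC r id) -Dp size_XnsubC.
have [|w] := hasP (has_prim_root n_gt0 rn1 _ sz_r); last by exists w.
by rewrite -separable_prod_XsubC -Dp separable_Xn_sub_1 // pnatr_eq0 -lt0n.
Qed.

Lemma unity_conj n a : (0 < n)%N -> a ^+ n = 1 -> a * a^* = 1.
Proof.
move=> n0 an; rewrite -normCK; apply/eqP; rewrite -(pexpr_eq1 n0) ?exprn_ge0 //.
by rewrite -exprM mulnC exprM -normrX an normr1 expr1n.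
Qed.

(* For [w] a primitive [n]-th root of unity the vectors [sum_k w^(jk) e3 M^k] are
   eigenvectors adding up to [n e3], and [e3] is positive. *)
Lemma positive_eigenvector M n : (0 < n)%N -> unim M ->
  iter n (fun x => vmul x M) e3 = e3 ->
  exists a x, [/\ a * a^* = 1, 0 < hform Fim x & vmul x M = vscale a x].
Proof.
move=> n0 uM Mn; have [w wP] := prim_root n0.
pose v k := iter k (fun x => vmul x M) e3.
pose G j k := vscale (w ^+ (j * k)) (v k).
pose y j := \sum_(k < n) G j k.
have wn j : w ^+ j * (w ^+ j)^* = 1.
  by apply: (unity_conj n0); rewrite -exprM mulnC exprM (prim_expr_order wP) expr1n.
have yM j : vscale (w ^+ j) (vmul (y j) M) = y j.
  transitivity (\sum_(k < n) G j k.+1).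
    rewrite /y (big_morph (fun x => vmul x M) (vmulD M) (vmul0 M)).
    rewrite (big_morph _ (vscaleD _) (vscaler0 _)); apply: eq_bigr => k _.
    by rewrite vmul_vscale vscaleA -exprD -mulnS.
  have Gn : G j n = G j 0%N.
    by rewrite /G muln0 mulnC exprM (prim_expr_order wP) expr1n /v Mn.
  have E : G j 0%N + \sum_(k < n) G j k.+1 = \sum_(k < n.+1) G j k.
    by rewrite big_ord_recl.
  by apply: (addrI (G j 0%N)); rewrite E big_ord_recr /= Gn addrC.
have yMk j k : y j = vscale (w ^+ (j * k)) (iter k (fun x => vmul x M) (y j)).
  elim: k => [|k IH]; first by rewrite muln0 vscale1.
  by rewrite iterS mulnS exprD -vscaleA -vmul_vscale -IH yM.
have inv k x : polar Fim (iter k (fun x => vmul x M) x) (v k) = polar Fim x e3.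
  by elim: k => // k IH; rewrite iterS -[v k.+1]/(vmul (v k) M) polar_Fim.
(* M preserves the form, so every term of the sum [y j] pairs with [y j] as [e3] does. The sum over
   j of these values is thus n times the pairing of [n e3] with [e3], which is positive. *)
have yq j : hform Fim (y j) = n%:R * polar Fim (y j) e3.
  rewrite hform_polar {2}/y (big_morph _ (polarDr _ _) (polar0r _ _)).
  rewrite (eq_bigr (fun=> polar Fim (y j) e3)) => [|k _].
    by rewrite sumr_const card_ord mulr_natl.
  rewrite polar_vscaler {1}(yMk j k) polar_vscalel inv mulrA.
  by rewrite [_^* * _]mulrC wn mul1r.
have ysum : \sum_(j < n) y j = vscale n%:R e3.
  rewrite exchange_big (bigD1 (Ordinal n0)) //= [X in _ + X]big1 => [|k k0].
    rewrite addr0 (eq_bigr (fun=> e3)) => [|j _]; last by rewrite /G muln0 vscale1.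
    rewrite sumr_const card_ord; elim: (n) => [|m IH]; first by rewrite vscale0r.
    by rewrite mulrSr (mulrSr 1) vscaleDl -IH vscale1.
  rewrite /G -(big_morph (fun a => vscale a (v k)) (fun a b => vscaleDl a b (v k))
    (vscale0r (v k))).
  have wk : w ^+ k - 1 != 0.
    by rewrite subr_eq0 -(prim_order_dvd wP) gtnNdvd // lt0n.
  rewrite (_ : \sum_(j < n) _ = 0) ?vscale0r //; apply: (mulfI wk); rewrite mulr0.
  rewrite (eq_bigr (fun j : 'I_n => (w ^+ k) ^+ j)) => [|j _]; last by rewrite -exprM mulnC.
  by rewrite -subrX1 -exprM mulnC exprM (prim_expr_order wP) expr1n subrr.
have e1 : polar Fim e3 e3 = 1.
  by rewrite /e3 polar_FimE rmorph1 !mul0r mul1r subrr add0r.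
have pos : 0 < \sum_(j < n) hform Fim (y j).
  rewrite (eq_bigr (fun j : 'I_n => n%:R * polar Fim (y j) e3)) => [|j _]; last exact: yq.
  rewrite -mulr_sumr.
  rewrite -(big_morph (fun x => polar Fim x e3) (fun x x' => polarDl Fim x x' e3) (polar0l Fim e3)).
  by rewrite ysum polar_vscalel e1 mulr1 mulr_gt0 // ltr0n.
have [j yj] : exists j : 'I_n, 0 < hform Fim (y j).
  apply/not_existsP => h; move: pos; rewrite lt_neqAle andbC => /andP[p0 /eqP]; apply.
  apply/le_anti; rewrite p0 sumr_le0 // => j _.
  by rewrite real_leNgt ?hform_Fim_real //; apply/negP/h.
exists (w ^+ j)^*, (y j); split=> //; first by rewrite conjCK mulrC wn.
by rewrite -{2}(yM j) vscaleA mulrC wn vscale1.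
Qed.

End Eigenvector.

(** * Conjugation of torsion elements to small height *)

Section Torsion.
Variable R : realType.
Local Notation C := R[i].
Local Notation ev := (@ev R).
Local Notation vec := (vec R).
Local Notation nC := (@nC R).
Local Notation polar := (@polar R).
Local Notation e3 := (e3 R).
Local Notation hv := (hv R).
Implicit Types (x y : vec) (a : C).

(** The part of [Fim] on the first two coordinates has determinant 1, so the Gram determinant of two
    vectors is the squared absolute value of their determinant. *)
Lemma gram_identity x f :
  (polar Fim x x - x.2 * x.2^*) * (polar Fim f f - f.2 * f.2^*) -
  (polar Fim x f - x.2 * f.2^*) * (polar Fim x f - x.2 * f.2^*)^* =
  (x.1.1 * f.1.2 - x.1.2 * f.1.1) * (x.1.1 * f.1.2 - x.1.2 * f.1.1)^*.
Proof.
case: x => [[x1 x2] x3]; case: f => [[f1 f2] f3]; rewrite !polar_FimE.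
have := rr2 R; move: (rr R) (rr_conj R) => r rJ r2.
rewrite !(rmorphD, rmorphB, rmorphM, rmorphN) /= !conjCK rJ !rmorph1.
by ring: r2.
Qed.

(* In terms of [t = sqrt T]: [(E - q) (t^2 - 1) >= E (t - 1)^2], so [t <= 2 E / q - 1]. *)
Lemma gram_bound (q E T c : R) : 0 < q -> 0 <= E -> 0 <= T -> E < 2 * q ->
  c * c <= E * (E * T) ->
  0 <= (q - E) * (1 - T) - (E + E * T - 2 * c) -> T < 9.
Proof.
move=> q0 E0 T0 Eq cE h; rewrite ltNge; apply/negP => T9.
pose t := Num.sqrt T; have tT : T = t * t by rewrite -expr2 sqr_sqrtr.
have t0 : 0 <= t by apply: sqrtr_ge0.
have t3 : 3 <= t by rewrite leNgt; apply/negP => t3; nra.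
have ct : c <= E * t.
  rewrite leNgt; apply/negP => lt; have Et0 : 0 <= E * t by rewrite mulr_ge0.
  by nra.
have t1 : 0 < t - 1 by lra.
have h1 : E * (t - 1) <= (E - q) * (t + 1).
  by rewrite -(ler_pM2l t1); rewrite tT in h; nra.
have h2 : 0 <= E * (t - 3) by rewrite mulr_ge0 // subr_ge0.
have h3 : 0 < (2 * q - E) * (t + 1) by rewrite mulr_gt0 //; lra.
by nra.
Qed.

(** Let f be the third row, so f = [e3 M]. Invariance of the form and |a| = 1 give |<x, f>| = |x_3|,
    and nonnegativity of the Gram determinant in [gram_identity] is then the last hypothesis of
    [gram_bound]. *)
Lemma eigen_hv M a x (q : R) : unim M -> a * a^* = 1 -> vmul x M = vscale a x ->
  hform Fim x = q%:C%C -> 0 < q -> nC x.2 < 2 * q -> hv M < 9.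
Proof.
move=> uM aa xM xq q0 Eq; pose f := row3 R M; pose w := polar Fim x f.
have fE : f = vmul e3 M.
  rewrite /f /e3 /row3 /vmul; case: (M) => *.
  by apply: vec_eq; rewrite !mul0r mul1r !add0r.
have xe : polar Fim x e3 = x.2.
  case: (x) => [[x1 x2] x3]; rewrite /e3 polar_FimE rmorph0 rmorph1.
  by rewrite !mulr0 subrr addr0 !mulr0 subrr add0r mulr1.
have wE : nC w = nC x.2.
  have : a * w = x.2 by rewrite -xe -(polar_Fim x e3 uM) xM -fE polar_vscalel.
  move=> <-; rewrite nCM; suff -> : nC a = 1 by rewrite mul1r.
  by apply: (@complexI R); rewrite -nCE aa.
rewrite -nC_row3 -/f.
have [E0 T0] : 0 <= nC x.2 /\ 0 <= nC f.2 by split; apply: nC_ge0.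
have fq : polar Fim f f = 1 by rewrite -hform_polar hform_Fim_row3.
apply: (@gram_bound q (nC x.2) (nC f.2) (complex.Re (w * (x.2 * f.2^*)^*)) q0 E0 T0 Eq).
  have nf : nC (f.2^*) = nC f.2 by case: (f.2) => b d /=; ring.
  have := nC_ge0 (w * (x.2 * f.2^*)^*).
  have : nC (w * (x.2 * f.2^*)^*) = nC x.2 * (nC x.2 * nC f.2).
    rewrite nCM wE; congr (_ * _); rewrite -nf -nCM.
    by case: (x.2 * f.2^*) => b d /=; ring.
  move=> <- _; case: (w * _) => b d /=.
  by rewrite lerDl -expr2 sqr_ge0.
have := gram_identity x f; rewrite -/w fq -hform_polar xq !nCE => E.
have SE : nC (w - x.2 * f.2^*) =
    nC x.2 + nC x.2 * nC f.2 - 2 * complex.Re (w * (x.2 * f.2^*)^*).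
  rewrite nCD wE; congr (_ + _ + _).
    rewrite -[nC x.2 * _]/(nC x.2 * nC f.2) -mulN1r !nCM.
    rewrite (_ : nC (f.2^*) = nC f.2); last by case: (f.2) => b d /=; ring.
    by rewrite /= oppr0; ring.
  by rewrite rmorphN mulrN /=; case: (w * _) => b d /=; rewrite mulrN.
rewrite -SE -lecR; rewrite (rmorph0 (real_complex R)).
rewrite (rmorphB (real_complex R)) (rmorphM (real_complex R)).
rewrite !(rmorphB (real_complex R)) (rmorph1 (real_complex R)) /= E.
by rewrite -(rmorph0 (real_complex R)) lecR nC_ge0.
Qed.

Lemma vmul_id x : vmul x mid = x.
Proof.
case: x => [[x1 x2] x3]; apply: vec_eq; rewrite !evE !(mulr0, mulr1).
- by rewrite !addr0.
- by rewrite add0r addr0.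
- by rewrite !add0r.
Qed.

Lemma descend_step (q m E Y : R) : 0 < q -> 0 <= m -> Y <= 49 / 50 * E ->
  50 * E < 2 * q * (50 + (m + 1)) -> 50 * Y < 2 * q * (50 + m).
Proof.
move=> q0 m0 hY hE; have qm : 0 <= q * m by rewrite mulr_ge0 // ltW.
by nra.
Qed.

(** While |x_3|^2 is at least 2 q, a step to the hub removes a fiftieth of it, hence at least 2 q
    from [50 * nC x.2]; so n steps suffice. *)
Lemma descend n x (q : R) : hform Fim x = q%:C%C -> 0 < q ->
  50 * nC x.2 < 2 * q * (50 + n%:R) ->
  exists2 h, unim h & nC (vmul x h).2 < 2 * q.
Proof.
elim: n x => [|n IH] x xq q0 hE.
  by exists mid; [exact: (uKl Kl_id)|rewrite vmul_id; lra].
have [lt|ge] := ltP (nC x.2) (2 * q).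
  by exists mid; [exact: (uKl Kl_id)|rewrite vmul_id].
have x0 : x.2 != 0.
  by apply/eqP => E; move: ge; rewrite E /= mul0r addr0 leNgt mulr_gt0.
have [||k Kk [_ _ _ hub]] := @hub_exists R x x0.
- by rewrite xq -(rmorph0 (real_complex R)) lecR ltW.
- rewrite xq nCE -(rmorph_nat (real_complex R)) -(rmorphM (real_complex R)).
  by rewrite subr_ge0 lecR.
have uk := uKl Kk; have ukb := unim_mul R uk bm_unim.
have [||h uh hh] := IH (vmul x (mmul k bm)) _ q0; first by rewrite hform_Fim.
  have hE1 : 50 * nC x.2 < 2 * q * (50 + (n%:R + 1)) by rewrite natr1.
  by rewrite -vmulA; exact: (descend_step q0 (ler0n R n) hub hE1).
by exists (mmul (mmul k bm) h); [exact: (unim_mul R)|rewrite -vmulA].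
Qed.

Local Open Scope group_scope.
Local Notation Gamma := (Gamma R).
Local Notation toG := (toG R).
Local Notation action := (@action R).
Implicit Types g : Gamma.

Lemma mpow_comm M n : mmul (mpow M n) M = mmul M (mpow M n).
Proof.
elim: n => [|n IH]; first by rewrite (m1mul R) (mmul1 R).
by rewrite [mpow M _]/= -(mmulA R) IH (mmulA R).
Qed.
Lemma iter_vmul M n x : iter n (fun x => vmul x M) x = vmul x (mpow M n).
Proof.
elim: n => [|n IH]; first by rewrite vmul_id.
by rewrite iterS IH vmulA mpow_comm.
Qed.
Lemma mpow_unim M n : unim M -> unim (mpow M n).
Proof.
move=> uM; elim: n => [|n IH]; first exact: (uKl Kl_id).
exact: (unim_mul R uM IH).
Qed.
Lemma toG_mpow M n : unim M -> toG (mpow M n) = toG M ^+ n.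
Proof.
move=> uM; elim: n => [|n IH]; first by rewrite toG_id.
by rewrite (toG_mul R uM (mpow_unim n uM)) IH expgS.
Qed.

Lemma vmul_scalar s x : vmul x (mscale s mid) = vscale (ev s) x.
Proof.
have -> : mscale s mid = Mat s z0 z0 z0 s z0 z0 z0 s.
  by congr Mat; apply: (@ev_inj R); rewrite evM !evE ?mulr0 ?mulr1.
case: x => [[x1 x2] x3]; rewrite /vmul !evE.
by apply: vec_eq; rewrite /=; ring.
Qed.

(** In Gamma, [g ^+ n = 1] makes the n-th power of the matrix only a scalar, a power of [zeta];
    hence the factor 12. *)
Lemma finite_order_iter g n : (0 < n)%N -> g ^+ n = 1 ->
  iter (12 * n) (fun x => vmul x (gM g)) e3 = e3.
Proof.
move=> n0 gn; have uM := gM_unim g.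
have /hasP[c _ /eqP E] : peq (mpow (gM g) n) mid.
  apply: (proj1 (toG_eq R (mpow_unim n uM) (uKl Kl_id))).
  by rewrite toG_mpow // gMK gn toG_id.
have f : iter n (fun x => vmul x (gM g)) =1 vscale (ev (zpow c)).
  by move=> x; rewrite iter_vmul E vmul_scalar.
rewrite iterM (eq_iter f) evX.
have it m : iter m (vscale (zeta R ^+ c)%R) e3 = vscale (zeta R ^+ (c * m))%R e3.
  elim: m => [|m IH]; first by rewrite muln0 vscale1.
  by rewrite iterS IH vscaleA mulnS exprD.
by rewrite it mulnC exprM zeta12 expr1n vscale1.
Qed.

Lemma torsion_stab g n : (0 < n)%N -> g ^+ n = 1 -> g \in @stab R ->
  label g = (0, 0)%BZ -> g = 1.
Proof.
move=> n0 gn /stabP gs g0; have uM := gM_unim g.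
have N0 : (0 < 12 * n)%N by rewrite muln_gt0.
have [a [x [aa xq xM]]] := positive_eigenvector N0 uM (finite_order_iter n0 gn).
pose q := complex.Re (hform Fim x).
have qE : hform Fim x = q%:C%C.
  by rewrite /q; have /complex_realP[r ->] := hform_Fim_real x.
have q0 : (0 < q)%R by rewrite qE -(rmorph0 (real_complex R)) ltcR in xq.
have [n1 hn1] : exists n1, (50 * nC x.2 < 2 * q * (50 + n1%:R))%R.
  exists (Num.bound (50 * nC x.2 / (2 * q))).
  have q2 : (0 < 2 * q)%R by rewrite mulr_gt0.
  have : (50 * nC x.2 / (2 * q) < (Num.bound (50 * nC x.2 / (2 * q)))%:R)%R.
    by apply: archi_boundP; rewrite divr_ge0 ?mulr_ge0 ?nC_ge0 // ltW.
  rewrite ltr_pdivrMr // => h; apply: (lt_trans h).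
  by rewrite mulrC ltr_pM2l // ltrDr ltr0n.
have [h uh hE] := descend qE q0 hn1.
have [uV _] := unim_inv R uh; have uMh := unim_mul R uM uh.
pose M' := mmul (minv h) (mmul (gM g) h); have uM' := unim_mul R uV uMh.
have hv9 : (hv M' < 9)%R.
  apply: (@eigen_hv M' a (vmul x h) q uM' aa) => //; last by rewrite hform_Fim.
  rewrite vmulA /M' (mmulA R) (mmulV R uh) (m1mul R) -vmulA xM.
  by rewrite vmul_vscale.
have gE : toG M' = (toG h)^-1 * (g * toG h).
  by rewrite (toG_mul R uV uMh) (toG_mul R uM uh) (toG_inv R uh) gMK.
have h2 : (hG (toG M') <= 2)%N.
  by rewrite (hG_toG R uM'); exact: (hv_lt9 uM' hv9).
have bv := base_valid; have v1 := action_valid (toG h)^-1 bv.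
(* The conjugate of g by h fixes the image of the base state under h^-1. *)
have := small_fixed h2 v1; rewrite gE.
have -> : action ((toG h)^-1 * (g * toG h)) (action (toG h)^-1 base_state) =
    action (toG h)^-1 base_state.
  rewrite -(actionM _ _ bv) -!mulgA mulgV mulg1 (actionM _ _ bv) gs g0.
  by [].
move=> /(_ erefl) E.
have := congr1 (fun t : Gamma => toG h * t * (toG h)^-1) E.
by rewrite /= mulVKg mulgK mulg1 mulgV.
Qed.

End Torsion.

(** * The abelianization of [Pi] *)

Section GeneratedInd.
Variables (G : groupType) (A : set G) (Q : G -> Prop).
Hypotheses (Q1 : Q 1%g) (QM : forall x y, Q x -> Q y -> Q (x * y)%g).
Hypotheses (QV : forall x, Q x -> Q x^-1%g) (QA : forall a, A a -> Q a).

Lemma generated_ind x : x \in generated A -> Q x.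
Proof.
pose S : {pred G} := fun x => `[< Q x >].
have S1 : 1%g \in S by apply/asboolP.
have SM : mulg_closed S by move=> y y' /asboolP Qy /asboolP Qy'; apply/asboolP/QM.
have SV : invg_closed S by move=> y /asboolP Qy; apply/asboolP/QV.
pose M1 := isMulClosed.Build G S SM; pose M2 := isMul1Closed.Build G S S1.
pose M3 := isInvClosed.Build G S SV.
pose H : groupClosed G := HB.pack S M1 M2 M3.
move=> /generatedP/(_ H) h; suff : x \in H by move=> /asboolP.
by apply: h => a Aa; apply/asboolP/QA.
Qed.
End GeneratedInd.

Section Abelianization.
Variable G : groupType.
Implicit Types x y : G.

(* the abelianization in additive notation *)
Definition abz : Type := abelianization G.
HB.instance Definition _ := Choice.on abz.
Definition abpi x : abz := \pi_(quotient_group (@derived G)) x.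
Let mulz : abz -> abz -> abz := @quotient_mul G (@derived G).

Lemma abpi_surj (a : abz) : exists x, a = abpi x.
Proof. by exists (repr a); rewrite /abpi reprK. Qed.
Lemma abpi_eq x y : abpi x = abpi y -> (x^-1 * y)%g \in @derived G.
Proof. by move=> /eqP; rewrite coset_eqE. Qed.

Let mulzC : commutative mulz.
Proof.
move=> a b; have [x ->] := abpi_surj a; have [y ->] := abpi_surj b.
rewrite /mulz /abpi -!pi_quotient_mul; apply/eqP; rewrite coset_eqE.
apply/generatedP => H; apply; exists y, x.
by rewrite commgEl conjgE invgM !mulgA.
Qed.
HB.instance Definition _ := GRing.isZmodule.Build abz
  (@quotient_mulA G (@derived G)) mulzC (@quotient_mul1g G (@derived G))
  (@quotient_mulVg G (@derived G)).

Lemma abpiM x y : abpi (x * y)%g = abpi x + abpi y.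
Proof. exact: (pi_quotient_mul (@derived G) x y). Qed.
Lemma abpi1 : abpi 1%g = 0.
Proof. by apply: (addrI (abpi 1%g)); rewrite -abpiM mulg1 addr0. Qed.
Lemma abpiV x : abpi x^-1%g = - abpi x.
Proof. by apply/eqP; rewrite -addr_eq0 -abpiM mulVg abpi1. Qed.

Variables (V : zmodType) (f : G -> V).
Hypothesis fM : forall x y, f (x * y)%g = f x + f y.
Let f1 : f 1%g = 0. Proof. by apply: (addrI (f 1%g)); rewrite -fM mulg1 addr0. Qed.
Let fV x : f x^-1%g = - f x.
Proof. by apply/eqP; rewrite -addr_eq0 -fM mulVg f1. Qed.

Definition ablift (a : abz) : V := f (repr a).
(** f has values in an abelian group and vanishes on commutators, so the chosen representative does
    not matter. *)
Lemma ablift_pi x : ablift (abpi x) = f x.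
Proof.
have /abpi_eq : abpi (repr (abpi x)) = abpi x by rewrite /abpi reprK.
set y := repr _ => h; suff : f (y^-1 * x)%g = 0.
  by rewrite fM fV addrC => /eqP; rewrite subr_eq0 => /eqP ->.
apply: (generated_ind (Q := fun z => f z = 0)) h => //.
- by move=> z z' fz fz'; rewrite fM fz fz' addr0.
- by move=> z fz; rewrite fV fz oppr0.
- by move=> _ [z [z' ->]]; rewrite commgEl conjgE !fM !fV [- f z' + _]addrCA addNr addr0 addNr.
Qed.
Lemma ablift_additive : {morph ablift : a b / a + b}.
Proof.
move=> a b; have [x ->] := abpi_surj a; have [y ->] := abpi_surj b.
by rewrite -abpiM !ablift_pi fM.
Qed.
Lemma ablift0 : ablift 0 = 0.
Proof. by rewrite -abpi1 ablift_pi f1. Qed.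
End Abelianization.

Section Relations.
Variables (V : zmodType) (x1 x2 x3 : V).
Hypothesis rel : x1 *+ 3 + x3 *+ 7 = x2 *+ 2.
(** For the generators of [Pi], [U] and [- x3] have the labels (1, 0) and (0, 1). The relation makes
    them generate: [x1 = 2 U - x3] and [x2 = 3 U + 2 x3]. *)
Let U := x2 - x1 - x3 *+ 3.

Lemma relation1 : U *~ 2 - x3 *~ 1 = x1.
Proof.
apply/eqP; rewrite mulr1z -[U *~ 2]/(U *+ 2) /U !mulrnBl -mulrnA !subr_eq -rel.
rewrite -[(3 * 2)%N]/6%N (mulrS x1 2) (mulrS x3 6).
by move: (x1 *+ 2) (x3 *+ 6) => A B; rewrite addrACA (addrC A) addrA.
Qed.
Lemma relation2 : U *~ 3 - x3 *~ (- 2) = x2.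
Proof.
apply/eqP; rewrite -[U *~ 3]/(U *+ 3) /U !mulrnBl -mulrnA -[(3 * 3)%N]/(7 + 2)%N mulrNz opprK.
rewrite -[x3 *~ 2]/(x3 *+ 2) addrAC subr_eq addrAC subr_eq.
rewrite (mulrnDr x3 7 2) (mulrS x2 2) -rel.
move: (x1 *+ 3) (x3 *+ 7) (x3 *+ 2) => A B D.
by rewrite -!addrA (addrC A) !addrA (addrAC (x2 + B)).
Qed.
End Relations.

Section Structure.
Variable R : realType.
Local Notation Gamma := (Gamma R).
Local Notation toG := (toG R).
Local Notation Pi := (@Pi R).
Local Notation P := (subgroup_type Pi).
Local Notation Z2 := (int * int)%type.
Implicit Types (g : Gamma) (x y : P).

Definition zpair (t : Z * Z) : Z2 := (int_of_Z t.1, int_of_Z t.2).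
Lemma zpair_add s t : zpair (padd s t) = zpair s + zpair t.
Proof. by rewrite /zpair !(rmorphD int_of_Z). Qed.

Definition plabel x : Z2 := zpair (label (val x)).
Lemma plabelM x y : plabel (x * y)%g = plabel x + plabel y.
Proof. by rewrite /plabel -zpair_add -label_mul // Pi_stab // (valP y). Qed.

(* The generators as elements of [P], sealed like [toG]. *)
Fact p1_key : {x : P | val x = toG a1m}. Proof. by exists (Subgroup (Pi_gen1 R)). Qed.
Fact p2_key : {x : P | val x = toG a2m}. Proof. by exists (Subgroup (Pi_gen2 R)). Qed.
Fact p3_key : {x : P | val x = toG a3m}. Proof. by exists (Subgroup (Pi_gen3 R)). Qed.
Definition p1 := sval p1_key.
Definition p2 := sval p2_key.
Definition p3 := sval p3_key.
Lemma p1E : val p1 = toG a1m. Proof. exact: (svalP p1_key). Qed.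
Lemma p2E : val p2 = toG a2m. Proof. exact: (svalP p2_key). Qed.
Lemma p3E : val p3 = toG a3m. Proof. exact: (svalP p3_key). Qed.
Lemma plabel1 : plabel p1 = (2, 1).
Proof. by rewrite /plabel p1E; have [_ _ ->] := generator1P R. Qed.
Lemma plabel2 : plabel p2 = (3, -2).
Proof. by rewrite /plabel p2E; have [_ _ ->] := generator2P R. Qed.
Lemma plabel3 : plabel p3 = (0, -1).
Proof. by rewrite /plabel p3E; have [_ _ ->] := generator3P R. Qed.

Definition expo_image (e : expo) : abz P :=
  abpi p1 *~ int_of_Z e.1.1 + abpi p2 *~ int_of_Z e.1.2 + abpi p3 *~ int_of_Z e.2.
Lemma expo_imageD e e' : expo_image (eadd e e') = expo_image e + expo_image e'.
Proof.
rewrite /expo_image !(rmorphD int_of_Z) !mulrzDr.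
by rewrite [RHS]addrACA [X in X + _ = _]addrACA.
Qed.
Lemma expo_imageN e : expo_image (eopp e) = - expo_image e.
Proof. by rewrite /expo_image !(rmorphN int_of_Z) !mulrNz !opprD. Qed.

Lemma slp_image n : let e := nth slp0 slp n in
  unim e.1 /\ exists2 x : P, val x = toG e.1 & abpi x = expo_image e.2.
Proof.
apply: (@slp_ind (fun e => unim e.1 /\
  exists2 x : P, val x = toG e.1 & abpi x = expo_image e.2)).
- move=> e e' [ue [x xe xE]] [ue' [y ye yE]].
  split; first exact: (unim_mul R ue ue').
  exists (x * y)%g; last by rewrite abpiM xE yE -expo_imageD.
  by rewrite [(slp_mul _ _).1]/= (toG_mul R ue ue') -xe -ye.
- move=> e [ue [x xe xE]]; split; first exact: (proj1 (unim_inv R ue)).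
  exists x^-1%g; last by rewrite abpiV xE -expo_imageN.
  by rewrite [(slp_inv _).1]/= (toG_inv R ue) -xe.
- split; first exact: (uKl Kl_id); exists 1%g; first by rewrite [slp0.1]/= toG_id.
  by rewrite abpi1 /expo_image !mulr0z !addr0.
- split; first by have [] := generator1P R.
  by exists p1; [exact: p1E|rewrite /expo_image !mulr0z !addr0].
- split; first by have [] := generator2P R.
  by exists p2; [exact: p2E|rewrite /expo_image !mulr0z add0r addr0].
- split; first by have [] := generator3P R.
  by exists p3; [exact: p3E|rewrite /expo_image !mulr0z !add0r].
Qed.

(** The program reaches one element of [Pi] with two exponent vectors, whose difference must vanish
    in the abelianization. *)
Lemma relator : abpi p1 *+ 3 + abpi p3 *+ 7 = abpi p2 *+ 2.
Proof.
have := relator_checkP; rewrite /relator_check; case: slp_relator => -[i j] k.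
have [ui [x xe xE]] := slp_image i; have [uj [y ye yE]] := slp_image j.
have [uk [t te tE]] := slp_image k.
move=> /andP[pe /eqP eE].
have xyt : (x * y = t)%g.
  apply: val_inj; rewrite te -(proj2 (toG_eq R (unim_mul R ui uj) uk) pe).
  by rewrite [val _]/= xe ye (toG_mul R ui uj).
have /eqP : expo_image (3, -2, 7)%BZ = 0.
  apply: (addrI (abpi t)); rewrite {1}tE -expo_imageD -eE addr0 -xyt abpiM.
  by rewrite xE yE -expo_imageD.
rewrite /expo_image -[int_of_Z (-2)]/(- 2%:Z) mulrNz addrAC subr_eq0.
by move=> /eqP.
Qed.

Definition Z2_image (t : Z2) : abz P :=
  (abpi p2 - abpi p1 - abpi p3 *+ 3) *~ t.1 - abpi p3 *~ t.2.
Lemma Z2_imageD s t : Z2_image (s + t) = Z2_image s + Z2_image t.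
Proof.
rewrite /Z2_image; move: (_ - _ *+ 3) => U.
by rewrite [(s + t).1]/= [(s + t).2]/= !mulrzDr opprD addrACA.
Qed.

Lemma Z2_image_plabel x : Z2_image (plabel x) = abpi x.
Proof.
have N t : Z2_image (- t) = - Z2_image t.
  rewrite /Z2_image; move: (_ - _ *+ 3) => U.
  by rewrite [(- t).1]/= [(- t).2]/= !mulrNz opprK opprB addrC.
have lV y : plabel y^-1%g = - plabel y.
  apply/eqP; rewrite -addr_eq0 -plabelM mulVg.
  by rewrite /plabel -[val _]/(1%g : Gamma) label1.
(* Induction over [generated] runs in Gamma, so the lift to [P] is quantified existentially. *)
suff [y /val_inj -> //] : exists2 y : P, val y = val x & Z2_image (plabel y) = abpi y.
apply: (generated_ind (Q := fun g =>
  exists2 y : P, val y = g & Z2_image (plabel y) = abpi y)) (valP x).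
- exists 1%g => //; rewrite abpi1 /plabel -[val _]/(1%g : Gamma) label1.
  by rewrite /Z2_image !mulr0z subr0.
- move=> _ _ [y <- yE] [z <- zE]; exists (y * z)%g => //.
  by rewrite plabelM Z2_imageD yE zE abpiM.
- by move=> _ [y <- yE]; exists y^-1%g => //; rewrite lV N yE abpiV.
move=> a [[->|->]|->].
- by exists p1; [exact: p1E|rewrite plabel1; exact: (relation1 relator)].
- by exists p2; [exact: p2E|rewrite plabel2; exact: (relation2 relator)].
- exists p3; [exact: p3E|rewrite plabel3 /Z2_image].
  by rewrite mulr0z add0r mulrNz opprK.
Qed.

Definition abelianization_map : abz P -> Z2 := ablift plabel.
HB.instance Definition _ := GRing.isNmodMorphism.Build (abz P) Z2 abelianization_map
  (ablift0 plabelM, ablift_additive plabelM).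

Lemma Z2_imageK : cancel Z2_image abelianization_map.
Proof.
move=> [a b]; rewrite /Z2_image raddfB !raddfMz !raddfB raddfMn.
have mE x : abelianization_map (abpi x) = plabel x := ablift_pi plabelM x.
rewrite /= !mE plabel1 plabel2 plabel3.
have zM (x y n : int) : ((x, y) : Z2) *~ n = (x * n, y * n).
  by rewrite [LHS]surjective_pairing (raddfMz fst) (raddfMz snd) /= !mulrzz.
have -> : (3, -2) - (2, 1) - (0, -1) *+ 3 = (1, 0) :> Z2 by [].
rewrite !zM; transitivity (1 * a + (- 0) * b, 0 * a + (- -1) * b) => //.
by rewrite oppr0 opprK !mul1r !mul0r addr0 add0r.
Qed.

Lemma abelianization_Pi :
  isomorphic (abelianization P) (Algebra.to_multiplicative Z2).
Proof.
pose M := isMultiplicative.Build (abelianization P) (Algebra.to_multiplicative Z2)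
  abelianization_map (ablift_additive plabelM).
pose f : {multiplicative abelianization P -> Algebra.to_multiplicative Z2} :=
  HB.pack abelianization_map M.
exists f, Z2_image; last exact: Z2_imageK.
move=> a; have [x ->] := abpi_surj a.
rewrite -[f _]/(ablift plabel (abpi x)) (ablift_pi plabelM).
exact: Z2_image_plabel.
Qed.

Lemma torsion_free_Pi : torsion_free P.
Proof.
move=> x n n0 xn; pose y := val x : Gamma.
have yP : y \in Pi := valP x.
have valX m : val (x ^+ m)%g = (y ^+ m)%g.
  by elim: m => // m IH; rewrite !expgS -IH.
have yn : (y ^+ n)%g = 1%g by rewrite -valX xn.
apply: val_inj; apply: (torsion_stab n0 yn (Pi_stab yP)).
have : plabel x *+ n = 0.
  have plX m : plabel (x ^+ m)%g = plabel x *+ m.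
    elim: m => [|m IH]; first by rewrite /plabel -[val _]/(1%g : Gamma) label1.
    by rewrite expgS plabelM IH mulrS.
  by rewrite -plX xn /plabel -[val _]/(1%g : Gamma) label1.
have z0 (c : Z) : int_of_Z c *+ n = 0 -> c = Z0.
  move=> /eqP; rewrite mulrn_eq0 -leqn0 leqNgt n0 => /eqP h.
  by apply: (can_inj int_of_ZK); rewrite h.
rewrite /plabel -/y /zpair; case: (label y) => a b /= E.
have := congr1 fst E; have := congr1 snd E.
by rewrite (raddfMn snd) (raddfMn fst) /= => /z0-> /z0->.
Qed.

Lemma toG_mprod s : all unim s ->
  unim (mprod s) /\ toG (mprod s) = foldr (fun M g => toG M * g)%g 1%g s.
Proof.
elim: s => [_|M s IH /= /andP[uM /IH[us <-]]].
  by split; [exact: (uKl Kl_id)|exact: toG_id].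
by split; [exact: (unim_mul R uM us)|exact: (toG_mul R uM us)].
Qed.

(** Stated for variable matrices so that conversion cannot start to compute with [um], [vm], [bm]
    and [jm]. *)
Lemma toG_words U V B J : unim U -> unim V -> unim B -> unim J ->
  let u := toG U in let v := toG V in let b := toG B in let j := toG J in
  [/\ toG (mprod [:: V; U; minv V; mpow J 4; B; U; V; mpow J 2]) =
        (v * u * v^-1 * j ^+ 4 * b * u * v * j ^+ 2)%g,
      toG (mprod [:: mpow V 2; U; B; U; minv V; U; mpow V 2; J]) =
        (v ^+ 2 * u * b * u * v^-1 * u * v ^+ 2 * j)%g
    & toG (mprod [:: minv U; mpow V 2; U; mpow J 9; B; minv V; U; minv V; mpow J 8]) =
        (u^-1 * v ^+ 2 * u * j ^+ 9 * b * v^-1 * u * v^-1 * j ^+ 8)%g].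
Proof.
move=> uU uV uB uJ u v b j.
have uUV := proj1 (unim_inv R uU); have uVV := proj1 (unim_inv R uV).
have mu n := mpow_unim R n uJ; have mv n := mpow_unim R n uV.
have e := (toG_inv R uU, toG_inv R uV, fun n => toG_mpow R n uJ, fun n => toG_mpow R n uV).
split; (rewrite (proj2 (toG_mprod _));
  last by rewrite /all ?uU ?uV ?uB ?uJ ?uUV ?uVV ?mu ?mv);
  rewrite /foldr ?e -/u -/v -/b -/j mulg1.
- by move: (j ^+ 4)%g (j ^+ 2)%g => p q; rewrite !mulgA.
- by move: (v ^+ 2)%g => p; rewrite !mulgA.
- by move: (v ^+ 2)%g (j ^+ 9)%g (j ^+ 8)%g => p q r; rewrite !mulgA.
Qed.

Lemma toG_jm : toG jm = ((toG um * toG vm) ^+ 2)%g.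
Proof.
have -> : jm = mpow (mmul um vm) 2 by apply/eqP; vm_compute.
have uu : unim um by vm_compute.
by rewrite toG_mpow ?(toG_mul R uu vm_unim) // (unim_mul R uu vm_unim).
Qed.

End Structure.

Local Open Scope group_scope.

Theorem proposition3p5 (R : realType) :
  let u := gamma_u R in
  let v := gamma_v R in
  let b := gamma_b R in
  let j := (u * v) ^+ 2 in
  let a1 := v * u * v^-1 * j ^+ 4 * b * u * v * j ^+ 2 in
  let a2 := v ^+ 2 * u * b * u * v^-1 * u * v ^+ 2 * j in
  let a3 := u^-1 * v ^+ 2 * u * j ^+ 9 * b * v^-1 * u * v^-1 * j ^+ 8 in
  let Pi := generated [set a1; a2; a3] in
  [/\ torsion_free (subgroup_type Pi),
      has_index Pi 864 &
      isomorphic (abelianization (subgroup_type Pi))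
        (Algebra.to_multiplicative (int * int)%type)].
Proof.
move=> u v b j a1 a2 a3.
have uu : unim um by vm_compute.
have uj : unim jm by vm_compute.
have [h1 h2 h3] : [/\ toG R a1m = a1, toG R a2m = a2 & toG R a3m = a3].
  by have := toG_words R uu vm_unim bm_unim uj; rewrite toG_jm -uG -vG -bG.
rewrite -h1 -h2 -h3.
split; [exact: torsion_free_Pi|exact: Pi_index|exact: abelianization_Pi].
Qed.
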